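(* There exist four real numbers $q^{\star},Q^{\star},S^{\star},\gamma^{\star}$ with $0<q^{\star}<Q^{\star}<S^{\star}$ and $\gamma^{\star}\in\mathbb{R}$, and a continuously differentiable function $w^{\star}:[0,\infty)\to\mathbb{R}$, such that the following hold. (a) $$\tfrac12\sigma^2\,\frac{\mathrm{d}w^{\star}(x)}{\mathrm{d}x}+\pi(w^{\star}(x))+h(x)=\gamma^{\star}\quad\text{for } x\in[0,S^{\star}],$$ with the boundary conditions $$\int_0^{q^{\star}}\big[w^{\star}(x)+k\big]\,\mathrm{d}x=-K,\qquad \int_{Q^{\star}}^{S^{\star}}\big[w^{\star}(x)-\ell\big]\,\mathrm{d}x=L,$$ $$w^{\star}(q^{\star})=-k,\qquad w^{\star}(Q^{\star})=w^{\star}(S^{\star})=\ell.$$ (b) Define $\mu^{\star}(x)=\mu(w^{\star}(x))$ for $x\ge 0$. Then $\phi^{\star}=\{(0,q^{\star},Q^{\star},S^{\star}),\{\mu^{\star}(x):x\in[0,S^{\star}]\}\}$ is an admissible policy. Furthermore, there exists a number $x^{\star}\in(Q^{\star},S^{\star})$ such that $\mu^{\star}(x)$ is decreasing in $x\in[0,x^{\star}]$ and increasing in $x\in[x^{\star},\infty)$.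
   Context: Data. $\sigma>0$; $K,k,L,\ell>0$ are constants; $\mathcal{U}\subset\mathbb{R}$ is a nonempty compact set; $c:\mathcal{U}\to\mathbb{R}$ is a (Borel measurable) function; $h:[0,\infty)\to\mathbb{R}$ is strictly increasing and continuous with $h(0)=0$ and $\lim_{x\to\infty}h(x)=\infty$. For $w\in\mathbb{R}$ put $$\pi(w)=\min_{\mu\in\mathcal{U}}\big(\mu w+c(\mu)\big),\qquad \mu(w)=\text{the smallest element of }\operatorname{argmin}_{\mu\in\mathcal{U}}\big(\mu w+c(\mu)\big),$$ where it is assumed that for every $w\in\mathbb{R}$ the minimum is attained and a smallest minimizer exists. ''Increasing'' and ''decreasing'' are meant in the weak sense unless ''strictly'' is said. Model. $(\Omega,\mathcal{F},\{\mathcal{F}_t\},\mathbb{P})$ is a filtered probability space carrying a standard one-dimensional $\{\mathcal{F}_t\}$-Brownian motion $B$, $B_0=0$. A policy is $\phi=(\bm{\mu},\bm{Y})$, where $\bm{\mu}=\{\mu_t:t\ge0\}$ is a drift rate process and $\bm{Y}=(Y_1,Y_2)$ with $Y_i=\{(\tau^i_n,\xi^i_n):n\ge1\}$; $\tau^1_n$ (resp. $\tau^2_n$) is the $n$th time the inventory is increased (resp. decreased), by the amount $\xi^1_n\ge0$ (resp. $\xi^2_n\ge0$). The controlled inventory level, with initial level $X_{0-}=x_0\ge0$, is $$X_t=x_0+\int_0^t\mu_s\,\mathrm{d}s+\sigma B_t+\sum_{n=1}^{N^1_t}\xi^1_n-\sum_{n=1}^{N^2_t}\xi^2_n,\qquad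 N^i_t=\sup\{n:\tau^i_n\le t\}.$$ The policy is admissible if $\mu_t$ is $\mathcal{F}_t$-measurable with values in $\mathcal{U}$, each $\tau^i_n$ is a stopping time, each $\xi^i_n$ is $\mathcal{F}_{\tau^i_n-}$-measurable, and $X_t\ge0$ for all $t$. Policy $\{(0,q,Q,S),\{\mu(x):x\in[0,S]\}\}$ with $0<q<Q<S$: the drift rate at time $t$ is $\mu(X_t)$; upward impulses are $\tau^1_1=\inf\{t\ge0:X_{t-}=0\}$, $\tau^1_n=\inf\{t>\tau^1_{n-1}:X_{t-}=0\}$ for $n\ge2$, with $\xi^1_n=q$ for all $n\ge1$; downward impulses are $\tau^2_1=\inf\{t\ge0:X_{t-}\ge S\}$, $\tau^2_n=\inf\{t>\tau^2_{n-1}:X_{t-}=S\}$ for $n\ge2$, with $\xi^2_1=\max\{S,x_0\}-Q$ and $\xi^2_n=S-Q$ for $n\ge2$. *)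

(* Defs.v *)
From HB Require Import structures.
From mathcomp Require Import all_boot all_order all_algebra.
From mathcomp Require Import all_classical all_reals all_analysis.

Set Implicit Arguments.
Unset Strict Implicit.
Unset Printing Implicit Defensive.

Import Order.TTheory GRing.Theory Num.Theory.
Import numFieldNormedType.Exports.

Local Open Scope classical_set_scope.
Local Open Scope ring_scope.

(* Functions defined mathematically on [0, oo[ are total functions R -> R of
   which only the values at nonnegative arguments are constrained or used;
   likewise for time indices. Impulse sequences are indexed by n >= 1 and their
   value at n = 0 is never used. *)

Definition is_minimum (R : realType) (A : set R) (x : R) : Prop :=
  A x /\ (forall y, A y -> x <= y).

(* The minimum of A; the value is junk when A has no minimum. *)
Definition minimum (R : realType) (A : set R) : R := xget 0 (is_minimum A).

Definition argmin (R : realType) (U : set R) (f : R -> R) : set R :=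
  [set m | U m /\ (forall v, U v -> f m <= f v)].

Definition drift_objective (R : realType) (c : R -> R) (w : R) : R -> R :=
  fun m => m * w + c m.

Definition drift_value (R : realType) (U : set R) (c : R -> R) (w : R) : R :=
  minimum (drift_objective c w @` U).

Definition optimal_drift (R : realType) (U : set R) (c : R -> R) (w : R) : R :=
  minimum (argmin U (drift_objective c w)).

(* Derivative relative to D: one-sided at a boundary point such as 0 in
   [0, oo[. *)
Definition is_derive_within (R : realType) (D : set R) (f df : R -> R) : Prop :=
  forall x, D x -> (f y - f x) / (y - x) @[y --> within D x^'] --> df x.

Definition is_C1_within (R : realType) (D : set R) (f df : R -> R) : Prop :=
  is_derive_within D f df /\ {within D, continuous df}.

Definition measurable_wrt (R : realType) (T : Type) (G : set (set T))
    (f : T -> R) : Prop :=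
  forall C : set R, measurable C -> G (f @^-1` C).

Record is_filtration (R : realType) (d : measure_display)
    (Omega : measurableType d) (F : R -> set (set Omega)) : Prop := {
  filtration_sigma : forall t : R, 0 <= t -> sigma_algebra setT (F t) ;
  filtration_sub : forall t : R, 0 <= t -> F t `<=` measurable ;
  filtration_incr : forall s t : R, 0 <= s -> s <= t -> F s `<=` F t }.

(* The second parameter of normal_prob is the standard deviation. *)
Record is_brownian_motion (R : realType) (d : measure_display)
    (Omega : measurableType d) (P : probability Omega R)
    (F : R -> set (set Omega)) (B : R -> Omega -> R) : Prop := {
  bm_start : forall omega, B 0 omega = 0 ;
  bm_adapted : forall t : R, 0 <= t -> measurable_wrt (F t) (B t) ;
  bm_continuous : forall omega, {within `[0, +oo[, continuous (B ^~ omega)} ;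
  bm_gaussian : forall s t : R, 0 <= s -> s < t ->
    forall C : set R, measurable C ->
    P ((fun omega => B t omega - B s omega) @^-1` C)
      = normal_prob 0 (Num.sqrt (t - s)) C ;
  bm_indep : forall s t : R, 0 <= s -> s < t ->
    forall (A : set Omega) (C : set R), F s A -> measurable C ->
    P (A `&` (fun omega => B t omega - B s omega) @^-1` C)
      = (P A * P ((fun omega => (B t omega - B s omega)%R) @^-1` C))%E }.

(* Random times take values in [0, oo], with value oo for "never". *)
Definition is_stopping_time (R : realType) (Omega : Type)
    (F : R -> set (set Omega)) (tau : Omega -> \bar R) : Prop :=
  (forall omega, (0 <= tau omega)%E) /\
  (forall t : R, 0 <= t -> F t [set omega | (tau omega <= t%:E)%E]).

(* The sigma-algebra of events strictly prior to tau. *)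
Definition sigma_minus (R : realType) (Omega : Type)
    (F : R -> set (set Omega)) (tau : Omega -> \bar R) : set (set Omega) :=
  <<s F 0 `|` [set E | exists t : R, exists A : set Omega,
        [/\ 0 <= t, F t A & E = A `&` [set omega | (t%:E < tau omega)%E]]] >>.

Record impulses (R : realType) (Omega : Type) := Impulses {
  imp_time : nat -> Omega -> \bar R ;
  imp_size : nat -> Omega -> R }.

Record policy (R : realType) (Omega : Type) := Policy {
  drift : R -> Omega -> R ;
  upward : impulses R Omega ;
  downward : impulses R Omega }.

(* The supremum is -oo when no impulse has occurred, which gives the same
   (empty) sum below as the value 0. *)
Definition impulse_count (R : realType) (Omega : Type)
    (Y : impulses R Omega) (t : R) (omega : Omega) : \bar R :=
  ereal_sup [set (n%:R)%:E
    | n in [set n : nat | (0 < n)%N /\ (imp_time Y n omega <= t%:E)%E]].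

Definition cumulative_impulse (R : realType) (Omega : Type)
    (Y : impulses R Omega) (t : R) (omega : Omega) : \bar R :=
  (\sum_(1 <= n <oo | ((n%:R)%:E <= impulse_count Y t omega)%E)
     (imp_size Y n omega)%:E)%E.

(* The balance equation is between extended reals; as its left-hand side is
   finite and impulse sizes are nonnegative, it forces both cumulative impulses
   to be finite. *)
Definition is_controlled_inventory (R : realType) (d : measure_display)
    (Omega : measurableType d) (P : probability Omega R)
    (B : R -> Omega -> R) (sigma x0 : R) (phi : policy R Omega)
    (X : R -> Omega -> R) : Prop :=
  {ae P, forall omega, forall t : R, 0 <= t ->
    lebesgue_measure.-integrable `[0, t] (fun s => (drift phi s omega)%:E) /\
    ((X t omega)%:E =
      (x0 + \int[lebesgue_measure]_(s in `[0, t]) drift phi s omega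
          + sigma * B t omega)%R%:E
      + cumulative_impulse (upward phi) t omega
      - cumulative_impulse (downward phi) t omega)%E}.

Record are_admissible_impulses (R : realType) (Omega : Type)
    (F : R -> set (set Omega)) (Y : impulses R Omega) : Prop := {
  imp_stopping : forall n, (0 < n)%N -> is_stopping_time F (imp_time Y n) ;
  imp_ordered : forall n omega, (0 < n)%N ->
    (imp_time Y n omega <= imp_time Y n.+1 omega)%E ;
  imp_nonneg : forall n omega, (0 < n)%N -> 0 <= imp_size Y n omega ;
  imp_predictable : forall n, (0 < n)%N ->
    measurable_wrt (sigma_minus F (imp_time Y n)) (imp_size Y n) }.

Record is_admissible (R : realType) (d : measure_display)
    (Omega : measurableType d) (P : probability Omega R)
    (F : R -> set (set Omega)) (B : R -> Omega -> R) (sigma x0 : R)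
    (U : set R) (phi : policy R Omega) (X : R -> Omega -> R) : Prop := {
  adm_inventory : is_controlled_inventory P B sigma x0 phi X ;
  adm_drift_range : forall (t : R) omega, 0 <= t -> U (drift phi t omega) ;
  adm_drift_adapted : forall t : R, 0 <= t -> measurable_wrt (F t) (drift phi t) ;
  adm_upward : are_admissible_impulses F (upward phi) ;
  adm_downward : are_admissible_impulses F (downward phi) ;
  adm_nonneg : {ae P, forall omega, forall t : R, 0 <= t -> 0 <= X t omega} }.

Definition left_value (R : realType) (Omega : Type) (x0 : R)
    (X : R -> Omega -> R) (t : R) (omega : Omega) : R :=
  if t == 0 then x0 else lim (X s omega @[s --> t^'-]).

Definition first_time (R : realType) (A : set R) : \bar R :=
  ereal_inf [set t%:E | t in [set t : R | 0 <= t /\ A t]].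

Definition first_time_after (R : realType) (tau : \bar R) (A : set R) : \bar R :=
  first_time [set t | (tau < t%:E)%E /\ A t].

(* phi and X are generated by the policy {(0, q, Q, S), m}. *)
Definition follows_band_policy (R : realType) (d : measure_display)
    (Omega : measurableType d) (P : probability Omega R) (x0 q Q S : R)
    (m : R -> R) (phi : policy R Omega) (X : R -> Omega -> R) : Prop :=
  {ae P, forall omega,
    let Xl (t : R) := left_value x0 X t omega in
    let tau1 n := imp_time (upward phi) n omega in
    let xi1 n := imp_size (upward phi) n omega in
    let tau2 n := imp_time (downward phi) n omega in
    let xi2 n := imp_size (downward phi) n omega in
    [/\ forall t : R, 0 <= t -> drift phi t omega = m (X t omega),
        tau1 1%N = first_time [set t | Xl t = 0]
        /\ (forall n, (2 <= n)%N ->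
             tau1 n = first_time_after (tau1 n.-1) [set t | Xl t = 0]),
        forall n, (1 <= n)%N -> xi1 n = q,
        tau2 1%N = first_time [set t | S <= Xl t]
        /\ (forall n, (2 <= n)%N ->
             tau2 n = first_time_after (tau2 n.-1) [set t | Xl t = S])
      & xi2 1%N = Num.max S x0 - Q
        /\ (forall n, (2 <= n)%N -> xi2 n = S - Q)]}.

(* A feedback policy prescribes the drift and impulses in terms of the inventory
   they produce, so its admissibility includes the existence, on the given
   filtered space and for the given Brownian motion, of such a closed loop. *)
Definition band_policy_admissible (R : realType) (d : measure_display)
    (Omega : measurableType d) (P : probability Omega R)
    (F : R -> set (set Omega)) (B : R -> Omega -> R) (sigma x0 : R)
    (U : set R) (q Q S : R) (m : R -> R) : Prop :=
  exists (phi : policy R Omega) (X : R -> Omega -> R),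
    follows_band_policy P x0 q Q S m phi X /\
    is_admissible P F B sigma x0 U phi X.

(* Main.v *)
(* (a) For fixed q and gamma solve the equation with w(q) = -k. The area
   int_0^q (w + k) is continuous and strictly decreasing in gamma, which selects
   gamma(q) with area -K; write w_q for the resulting solution. As h is
   increasing, once w_q decreases it does so strictly for ever, so w_q is
   increasing and then decreasing. For small q the area int_q^2 (w_q - l)^+
   exceeds L, and for large q the function w_q never reaches l. At the infimum q
   of the values for which all the areas int_q^T (w_q - l)^+ are at most L, the
   total area above l is exactly L, and Q and S are the two points where
   w_q = l.
   (b) The drift b(x) = mu(w(x)) decreases and then increases, hence is bounded
   with countably many discontinuities. Its sup-convolutions are Lipschitz and
   decrease to b at the continuity points, and the corresponding paths decrease
   to an adapted path y with y - sigma B Lipschitz. Almost surely, for every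
   Lipschitz f at once, B s = f s only for a null set of times s: on the set E
   of such times in [0, N], |B (s + u) - B s| <= C u whenever s and s + u are in
   E; the expected measure of the times s where this holds tends to 0 with u,
   whereas the measure of E inter (E - u) tends to that of E. Hence y avoids the
   discontinuities of b at almost all times and solves the equation by dominated
   convergence. Restarting at each visit to 0 or S yields the controlled
   inventory; as the displacement between impulses is bounded below, there are
   finitely many impulses in bounded time. *)

Require Import Defs.
From HB Require Import structures.
From mathcomp Require Import all_boot all_order all_algebra.
From mathcomp Require Import all_classical all_reals all_analysis.
From mathcomp Require Import measurable_realfun.
From mathcomp Require Import ring lra.

Set Implicit Arguments.
Unset Strict Implicit.
Unset Printing Implicit Defensive.

Import Order.TTheory GRing.Theory Num.Theory.
Import numFieldNormedType.Exports.

Local Open Scope classical_set_scope.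
Local Open Scope ring_scope.

(** * Primitives and Gronwall estimates *)

(** The feedback drift is discontinuous and the inventory must be adapted, so neither a fixed-point
    theorem nor an extraction of subsequences yields the closed loop. Monotone approximation does:
    its limit exists on every path and inherits adaptedness from explicit Picard iterates. A null
    event enters only in the balance equation. As y - sigma B depends on the noise, Fubini for one
    fixed curve does not suffice; the occupation estimate must hold for all Lipschitz curves outside
    a single event. Lags u = 1/(n+1)^2 give increments of standard deviation 1/(n+1) against a
    tolerance C/(n+1)^2, hence probabilities of order 1/(n+1). In the boundary problem pi enters
    through a Lipschitz bound, and the shape of w comes from comparison: with constants, straight
    lines, a translate of w, or the solution for another gamma. That w_q stays below l for large q
    is delicate, since h may grow arbitrarily slowly; what is available is that q (h(q) - h(q/2)) is
    unbounded. The filtration is not assumed right-continuous, so stopping times must be attained: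
    hitting times of closed sets by continuous paths, and infima over locally finite sets of
    jumps. *)

HB.lock Definition prim (R : realType) (f : R -> R) (x : R) : R :=
  if 0 <= x then \int[lebesgue_measure]_(t in `[0, x]) f t
  else - \int[lebesgue_measure]_(t in `[x, 0]) f t.

Section calculus.
Context {R : realType}.
Implicit Types (f g d : R -> R) (a b x y t v L C : R).

Lemma is_derive_continuous f df : (forall x, is_derive x 1 f (df x)) ->
  continuous f.
Proof.
move=> fd x; apply: differentiable_continuous; apply/derivable1_diffP.
exact: (@ex_derive _ _ _ _ _ _ _ (fd x)).
Qed.

Lemma continuous_derivative_le f g df dg a b : a <= b ->
  continuous f -> continuous g ->
  (forall x, a < x -> x < b -> is_derive x 1 f (df x)) ->
  (forall x, a < x -> x < b -> is_derive x 1 g (dg x)) ->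
  (forall x, a < x -> x < b -> df x <= dg x) ->
  f b - f a <= g b - g a.
Proof.
move=> ab cf cg fd gd fg; have [->|aneb] := eqVneq a b; first by rewrite !subrr.
have {aneb}ab : a < b by rewrite lt_neqAle aneb.
have hd x : x \in `]a, b[%R -> is_derive x 1 (g - f) (dg x - df x).
  rewrite in_itv/= => /andP[ax xb].
  by have ? := fd x ax xb; have ? := gd x ax xb; exact: is_deriveB.
have hc : {within `[a, b], continuous (g - f)}.
  by apply: continuous_subspaceT => x; apply: cvgB; [exact: cg|exact: cf].
have [c] := MVT ab hd hc; rewrite in_itv/= => /andP[ac cb] e.
rewrite -subr_ge0.
have -> : g b - g a - (f b - f a) = (g - f) b - (g - f) a.
  by rewrite !fctE; ring.
by rewrite e mulr_ge0// subr_ge0 ?fg// ltW.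
Qed.

Lemma pos_derivative_increasing f df a b : a < b -> continuous f ->
  (forall x, a < x -> x < b -> is_derive x 1 f (df x)) ->
  (forall x, a < x -> x < b -> 0 < df x) -> f a < f b.
Proof.
move=> ab cf fd dpos.
have hd x : x \in `]a, b[%R -> is_derive x 1 f (df x).
  by rewrite in_itv/= => /andP[ax xb]; exact: fd.
have [c] := MVT ab hd (continuous_subspaceT cf).
rewrite in_itv/= => /andP[ac cb] e.
by rewrite -subr_gt0 e mulr_gt0// ?subr_gt0// dpos.
Qed.

Lemma continuous_itv_integrable f a b : continuous f ->
  lebesgue_measure.-integrable `[a, b] (EFin \o f).
Proof.
move=> cf; apply: continuous_compact_integrable; first exact: segment_compact.
exact: continuous_subspaceT.
Qed.

Lemma Rintegral_itv_add f a b c : a <= b -> b <= c ->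
  lebesgue_measure.-integrable `[a, c] (EFin \o f) ->
  \int[lebesgue_measure]_(t in `[a, c]) f t =
  \int[lebesgue_measure]_(t in `[a, b]) f t
  + \int[lebesgue_measure]_(t in `[b, c]) f t.
Proof.
move=> ab bc fi.
have := @Rintegral_itvB _ f (BLeft a) (BRight c) b fi.
rewrite !bnd_simp => /(_ ab bc) /eqP; rewrite subr_eq => /eqP ->.
rewrite addrC; congr (_ + _); apply: Rintegral_itv_obnd_cbnd.
apply: integrableS fi => //=.
by move=> x /=; rewrite !in_itv/= => /andP[bx ->]; rewrite andbT ltW// (le_lt_trans ab).
Qed.

Lemma prim0 f : prim f 0 = 0.
Proof. by rewrite prim.unlock lexx set_itv1 Rintegral_set1. Qed.

Lemma prim_itv f a b : continuous f -> a <= b ->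
  \int[lebesgue_measure]_(t in `[a, b]) f t = prim f b - prim f a.
Proof.
move=> cf ab; have ci u v := @continuous_itv_integrable f u v cf.
rewrite prim.unlock; case: (leP 0 a) => a0; case: (leP 0 b) => b0.
- by rewrite (@Rintegral_itv_add f 0 a b)//; ring.
- by have := le_lt_trans a0 (le_lt_trans ab b0); rewrite ltxx.
- by rewrite (@Rintegral_itv_add f a 0 b)// ?(ltW a0)//; ring.
- by rewrite (@Rintegral_itv_add f a b 0)// ?(ltW b0)//; ring.
Qed.

Lemma is_derive_prim f x : continuous f -> is_derive x 1 (prim f) (f x).
Proof.
(* The fundamental theorem needs a base point strictly left of x; near x the resulting primitive
   differs from [prim f] by the constant [prim f a]. *)
move=> cf; pose a := Num.min x 0 - 1.
have ax : a < x by rewrite ltrBlDr (le_lt_trans (_ : _ <= x)) ?ltrDl// ge_min lexx.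
have [] := @continuous_FTC1_closed R f a x (x + 1).
- by rewrite ltrDl.
- exact: continuous_itv_integrable.
- exact: ax.
- exact: cf.
set F := fun y => _ => dF eF.
have FE : \near x, F x + prim f a = prim f x.
  near=> y; rewrite /F prim_itv//; first by ring.
  by apply: ltW; near: y; exact: lt_nbhsr.
apply: (near_eq_is_derive FE).
have h1 : is_derive x 1 F (f x).
  by apply: DeriveDef; [exact: dF|rewrite -derive1E; exact: eF].
rewrite -[f x]addr0; exact: is_deriveD.
Unshelve. all: by end_near. Qed.

Lemma continuous_prim f : continuous f -> continuous (prim f).
Proof. by move=> cf; apply: is_derive_continuous => x; exact: is_derive_prim. Qed.

Lemma prim_le f (F dF : R -> R) a b : continuous f -> a <= b -> continuous F ->
  (forall x, a < x -> x < b -> is_derive x 1 F (dF x)) ->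
  (forall x, a < x -> x < b -> f x <= dF x) ->
  prim f b - prim f a <= F b - F a.
Proof.
move=> cf ab cF Fd fF.
apply: (continuous_derivative_le ab (continuous_prim cf) cF _ Fd fF).
by move=> x _ _; exact: is_derive_prim.
Qed.

Lemma continuous_opp_fun f : continuous f -> continuous (fun x => - f x).
Proof. by move=> cf x; apply: cvgN; exact: cf. Qed.

Lemma prim_norm_le f (F dF : R -> R) a b : continuous f -> a <= b ->
  continuous F ->
  (forall x, a < x -> x < b -> is_derive x 1 F (dF x)) ->
  (forall x, a < x -> x < b -> `|f x| <= dF x) ->
  `|prim f b - prim f a| <= F b - F a.
Proof.
move=> cf ab cF Fd fF; rewrite ler_norml; apply/andP; split; last first.
  by apply: (prim_le _ _ _ Fd) => // x ax xb; rewrite (le_trans (ler_norm _))// fF.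
rewrite lerNl opprB -[leLHS]/(prim f a - prim f b).
have : (fun x => - F x) b - (fun x => - F x) a <= prim f b - prim f a.
  apply: (@continuous_derivative_le (fun x => - F x) (prim f) (fun x => - dF x) f a b ab).
  - exact: continuous_opp_fun.
  - exact: continuous_prim.
  - by move=> x ax xb; have ? := Fd x ax xb; exact: is_deriveN.
  - by move=> x _ _; exact: is_derive_prim.
  - by move=> x ax xb; rewrite lerNl (le_trans (ler_norm _))// normrN fF.
by move=> /=; lra.
Qed.

Lemma prim_norm_le_cst f C a b : continuous f -> a <= b ->
  (forall x, a <= x -> x <= b -> `|f x| <= C) ->
  `|prim f b - prim f a| <= C * (b - a).
Proof.
move=> cf ab fC; rewrite mulrBr.
apply: (@prim_norm_le f (fun x => C * x) (fun=> C)) => //.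
- by move=> x; apply: cvgM; [exact: cvg_cst|exact: cvg_id].
- move=> x _ _; rewrite -[X in is_derive _ _ _ X]mulr1; exact: is_deriveZ.
- by move=> x ax xb; apply: fC; exact: ltW.
Qed.

Lemma prim_eq f g a b : continuous f -> continuous g -> a <= b ->
  (forall x, a <= x -> x <= b -> f x = g x) ->
  prim f b - prim f a = prim g b - prim g a.
Proof.
move=> cf cg ab fg; rewrite -!prim_itv//; apply: eq_Rintegral => x.
by rewrite inE/= in_itv/= => /andP[ax xb]; exact: fg.
Qed.

Lemma prim_ge0 f a b : continuous f -> a <= b ->
  (forall x, a <= x -> x <= b -> 0 <= f x) -> prim f a <= prim f b.
Proof.
move=> cf ab f0; rewrite -subr_ge0 -prim_itv//; apply: Rintegral_ge0 => x /=.
by rewrite in_itv/= => /andP[ax xb]; exact: f0.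
Qed.

Lemma primB f g a b : continuous f -> continuous g -> a <= b ->
  prim (fun x => f x - g x) b - prim (fun x => f x - g x) a =
  (prim f b - prim f a) - (prim g b - prim g a).
Proof.
move=> cf cg ab.
have ci u v h := @continuous_itv_integrable h u v.
rewrite -!prim_itv//; first by apply: RintegralB => //; exact: ci.
by move=> x; apply: cvgB; [exact: cf|exact: cg].
Qed.

Lemma continuous_gt_near f x v : continuous f -> v < f x ->
  exists2 e : R, 0 < e & forall y, `|y - x| < e -> v < f y.
Proof.
move=> cf vf; have /nbhs_ballP[e /= e0 be] : \forall y \near x, v < f y.
  exact: (cvgr_gt _ (cf x)).
by exists e => // y yx; apply: be; rewrite /ball/= distrC.
Qed.

Lemma continuous_lt_near f x v : continuous f -> f x < v ->
  exists2 e : R, 0 < e & forall y, `|y - x| < e -> f y < v.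
Proof.
move=> cf vf; have /nbhs_ballP[e /= e0 be] : \forall y \near x, f y < v.
  exact: (cvgr_lt _ (cf x)).
by exists e => // y yx; apply: be; rewrite /ball/= distrC.
Qed.

Lemma continuous_dist_near f x (e : R) : continuous f -> 0 < e ->
  exists2 r : R, 0 < r & forall y, `|y - x| < r -> `|f y - f x| <= e.
Proof.
move=> cf e0; have /nbhs_ballP[r /= r0 hr] : \forall y \near x, `|f x - f y| <= e.
  by have := cf x => /cvgr_dist_le; apply.
by exists r => // y yx; rewrite distrC; apply: hr; rewrite /ball/= distrC.
Qed.

Lemma last_nonpositive d a b : a <= b -> continuous d -> d a <= 0 -> 0 < d b ->
  exists t, [/\ a <= t, t < b, d t <= 0 & forall x, t < x -> x <= b -> 0 < d x].
Proof.
move=> ab cd da db.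
pose A := [set x | a <= x /\ x <= b /\ d x <= 0].
have A0 : A a by split.
have hA : has_sup A by split; [exists a|exists b => x [_ []]].
pose t := sup A.
have ta : a <= t by apply: sup_upper_bound.
have tb : t <= b by apply: ge_sup; [exists a|move=> x [_ []]].
have dt : d t <= 0.
  rewrite leNgt; apply/negP => dt0.
  have [e e0 be] := continuous_gt_near cd dt0.
  have [x [ax [xb dx]] tx] := sup_adherent e0 hA.
  have /be : `|x - t| < e.
    rewrite ltr_norml; have : x <= t by apply: sup_upper_bound.
    rewrite -/t in tx; lra.
  by rewrite ltNge dx.
exists t; split=> //.
  by rewrite lt_neqAle tb andbT; apply/eqP => e; move: dt; rewrite e leNgt db.
move=> x tx xb; rewrite ltNge; apply/negP => dx.
have : x <= t by apply: sup_upper_bound => //; split=> //; rewrite (le_trans ta)// ltW.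
by rewrite leNgt tx.
Qed.

Lemma is_derive_expRM L x : is_derive x 1 (fun y => expR (L * y)) (L * expR (L * x)).
Proof.
rewrite mulrC; apply: (@is_derive1_comp _ expR (fun y => L * y)).
by rewrite -[X in is_derive _ _ _ X]mulr1; exact: is_deriveZ.
Qed.

Lemma continuous_expRM L : continuous (fun y : R => expR (L * y)).
Proof. by apply: is_derive_continuous => x; exact: is_derive_expRM. Qed.

Lemma is_derive_expRM_mul L d dd x : is_derive x 1 d dd ->
  is_derive x 1 (fun y => expR (L * y) * d y) (expR (L * x) * (dd + L * d x)).
Proof.
move=> hd; have he := is_derive_expRM L x.
have -> : expR (L * x) * (dd + L * d x) =
  expR (L * x) *: dd + d x *: (L * expR (L * x)) by rewrite /GRing.scale/=; ring.
exact: is_deriveM.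
Qed.

(** The inequality is required only where d is positive. If d b were positive, it would hold on the
    whole stretch after the last nonpositive point, where exp(- L x) d x cannot increase. *)
Lemma gronwall_le d (dd : R -> R) L a b : a <= b -> continuous d ->
  (forall x, a < x -> x < b -> is_derive x 1 d (dd x)) ->
  (forall x, a < x -> x < b -> 0 < d x -> dd x <= L * d x) ->
  d a <= 0 -> d b <= 0.
Proof.
move=> ab cd hd hdd da; rewrite leNgt; apply/negP => db.
have [t [at_ tb dt dpos]] := last_nonpositive ab cd da db.
have := @continuous_derivative_le (fun y => expR (- L * y) * d y) (fun=> 0)
  (fun y => expR (- L * y) * (dd y + - L * d y)) (fun=> 0) t b (ltW tb).
rewrite subrr => H.
have : expR (- L * b) * d b - expR (- L * t) * d t <= 0.
  apply: H.
  - by move=> x; apply: cvgM; [exact: continuous_expRM|exact: cd].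
  - by move=> x; exact: cvg_cst.
  - by move=> x tx xb; apply: is_derive_expRM_mul; apply: hd => //; rewrite (le_lt_trans at_).
  - move=> x tx xb; rewrite mulr_ge0_le0 ?expR_ge0//.
    by rewrite mulNr subr_le0 hdd ?dpos// ?(ltW xb)// (le_lt_trans at_).
rewrite subr_le0 leNgt => /negP; apply.
rewrite (@le_lt_trans _ _ 0) ?mulr_gt0 ?expR_gt0//.
by rewrite mulr_ge0_le0 ?expR_ge0.
Qed.

(** By the previous lemma d stays nonpositive, so |d| = - d and exp(L x) d x does not increase: the
    strict sign at a persists. *)
Lemma gronwall_lt d (dd : R -> R) L a b : 0 <= L -> a <= b -> continuous d ->
  (forall x, a < x -> x < b -> is_derive x 1 d (dd x)) ->
  (forall x, a < x -> x < b -> dd x <= L * `|d x|) ->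
  d a < 0 -> d b < 0.
Proof.
move=> L0 ab cd hd hdd da.
have dle x : a <= x -> x <= b -> d x <= 0.
  move=> ax xb; apply: (gronwall_le (L := L) ax cd _ _ (ltW da)).
  - by move=> y ay yx; apply: hd => //; rewrite (lt_le_trans yx).
  - by move=> y ay yx dy; rewrite -[in leRHS](gtr0_norm dy) hdd// (lt_le_trans yx).
have := @continuous_derivative_le (fun y => expR (L * y) * d y) (fun=> 0)
  (fun y => expR (L * y) * (dd y + L * d y)) (fun=> 0) a b ab.
rewrite subrr => H.
have : expR (L * b) * d b - expR (L * a) * d a <= 0.
  apply: H.
  - by move=> x; apply: cvgM; [exact: continuous_expRM|exact: cd].
  - by move=> x; exact: cvg_cst.
  - by move=> x tx xb; apply: is_derive_expRM_mul; apply: hd.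
  - move=> x ax xb; rewrite mulr_ge0_le0 ?expR_ge0//.
    have := hdd x ax xb; rewrite (ler0_norm (dle x (ltW ax) (ltW xb))); lra.
rewrite subr_le0 => /le_lt_trans /(_ _)-/(_ 0).
rewrite !pmulr_rlt0 ?expR_gt0//; exact.
Qed.

(** Same weight as before, but the differential inequality is strict, so strictness is gained even
    from d a = 0. *)
Lemma gronwall_drift_lt d (dd : R -> R) L a b : 0 <= L -> a < b -> continuous d ->
  (forall x, a < x -> x < b -> is_derive x 1 d (dd x)) ->
  (forall x, a < x -> x < b -> dd x < L * `|d x|) ->
  d a <= 0 -> d b < 0.
Proof.
move=> L0 ab cd hd hdd da.
have dle x : a <= x -> x <= b -> d x <= 0.
  move=> ax xb; apply: (gronwall_le (L := L) ax cd _ _ da).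
  - by move=> y ay yx; apply: hd => //; rewrite (lt_le_trans yx).
  - by move=> y ay yx dy; rewrite -[in leRHS](gtr0_norm dy) ltW// hdd// (lt_le_trans yx).
have := @pos_derivative_increasing (fun y => - (expR (L * y) * d y))
  (fun y => - (expR (L * y) * (dd y + L * d y))) a b ab.
rewrite ltrN2 => H.
have : expR (L * b) * d b < expR (L * a) * d a.
  apply: H.
  - by apply: continuous_opp_fun => x; apply: cvgM; [exact: continuous_expRM|exact: cd].
  - move=> x ax xb; have ? := hd x ax xb; have ? := @is_derive_expRM_mul L d (dd x) x _.
    exact: is_deriveN.
  - move=> x ax xb; rewrite oppr_gt0 pmulr_rlt0 ?expR_gt0//.
    have := hdd x ax xb; rewrite (ler0_norm (dle x (ltW ax) (ltW xb))); lra.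
move=> /lt_le_trans /(_ _)-/(_ 0).
by rewrite pmulr_rlt0 ?expR_gt0// pmulr_rle0 ?expR_gt0//; exact.
Qed.

Lemma is_derive_reflect d dd x : is_derive (- x) 1 d dd ->
  is_derive x 1 (fun y => d (- y)) (- dd).
Proof.
by move=> hd; rewrite -mulrN1; exact: (@is_derive1_comp _ d (fun y => - y)).
Qed.

Lemma continuous_reflect d : continuous d -> continuous (fun y => d (- y)).
Proof.
by move=> cd x; apply: continuous_comp; [exact: opp_continuous|exact: cd].
Qed.

(** The reflection x -> - x turns each forward estimate into one that propagates from b down to
    a. *)
Lemma gronwall_le_left d (dd : R -> R) L a b : a <= b -> continuous d ->
  (forall x, a < x -> x < b -> is_derive x 1 d (dd x)) ->
  (forall x, a < x -> x < b -> 0 < d x -> - dd x <= L * d x) ->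
  d b <= 0 -> d a <= 0.
Proof.
move=> ab cd hd hdd db; rewrite -(opprK a).
apply: (@gronwall_le (fun y => d (- y)) (fun y => - dd (- y)) L (- b) (- a)).
- by rewrite lerN2.
- exact: continuous_reflect.
- by move=> x ax xb; apply: is_derive_reflect; apply: hd; lra.
- by move=> x ax xb dx; apply: hdd => //; lra.
- by rewrite opprK.
Qed.

Lemma gronwall_drift_lt_left d (dd : R -> R) L a b : 0 <= L -> a < b -> continuous d ->
  (forall x, a < x -> x < b -> is_derive x 1 d (dd x)) ->
  (forall x, a < x -> x < b -> - dd x < L * `|d x|) ->
  d b <= 0 -> d a < 0.
Proof.
move=> L0 ab cd hd hdd db; rewrite -(opprK a).
apply: (@gronwall_drift_lt (fun y => d (- y)) (fun y => - dd (- y)) L (- b) (- a)) => //.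
- by rewrite ltrN2.
- exact: continuous_reflect.
- by move=> x ax xb; apply: is_derive_reflect; apply: hd; lra.
- by move=> x ax xb; apply: hdd => //; lra.
- by rewrite opprK.
Qed.

Lemma gronwall_abs d (dd : R -> R) L C a b : 0 < L -> 0 <= C -> a <= b -> continuous d ->
  (forall x, a < x -> x < b -> is_derive x 1 d (dd x)) ->
  (forall x, a < x -> x < b -> `|dd x| <= L * `|d x| + C) ->
  `|d b| <= (`|d a| + C / L) * expR (L * (b - a)).
Proof.
wlog suff : d dd / 0 < L -> 0 <= C -> a <= b -> continuous d ->
    (forall x, a < x -> x < b -> is_derive x 1 d (dd x)) ->
    (forall x, a < x -> x < b -> `|dd x| <= L * `|d x| + C) ->
    d b <= (`|d a| + C / L) * expR (L * (b - a)).
  move=> H L0 C0 ab cd hd hdd; rewrite ler_norml (H d dd)// andbT lerNl.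
  have := H (fun x => - d x) (fun x => - dd x) L0 C0 ab (continuous_opp_fun cd).
  rewrite normrN; apply.
    by move=> x ax xb; have ? := hd x ax xb; exact: is_deriveN.
  by move=> x ax xb; rewrite !normrN hdd.
move=> L0 C0 ab cd hd hdd.
have CL : 0 <= C / L by rewrite divr_ge0// ltW.
have CE : C / L * L = C by rewrite divfK// gt_eqF.
(* [u] below is the solution of u' = L u + C with u a = |d a|, and d is compared with it. *)
pose K := (`|d a| + C / L) * expR (- (L * a)).
pose u x := K * expR (L * x) - C / L.
have uE x : u x = (`|d a| + C / L) * expR (L * (x - a)) - C / L.
  by rewrite /u /K -mulrA -expRD; congr (_ * expR _ - _); ring.
have ud x : is_derive x 1 u (L * u x + C).
  have -> : L * u x + C = K * (L * expR (L * x)) - 0.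
    by rewrite /u mulrBr (mulrC L (C / L)) CE; ring.
  have ? : is_derive x 1 (fun y => K * expR (L * y)) (K * (L * expR (L * x))).
    by have ? := is_derive_expRM L x; exact: is_deriveZ.
  exact: is_deriveB.
have u0 x : a <= x -> 0 <= u x.
  move=> ax; rewrite uE subr_ge0.
  have e1 : 1 <= expR (L * (x - a)).
    by rewrite leNgt expR_lt1 -leNgt mulr_ge0 ?(ltW L0)// subr_ge0.
  rewrite -[leLHS]mulr1 ler_pM// lerDr//.
suff : d b - u b <= 0 by rewrite uE; lra.
apply: (@gronwall_le (fun x => d x - u x) (fun x => dd x - (L * u x + C)) L a b ab).
- move=> x; apply: cvgB; first exact: cd.
  exact: (is_derive_continuous ud).
- by move=> x ax xb; have ? := hd x ax xb; exact: is_deriveB.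
- move=> x ax xb; rewrite subr_gt0 => ux.
  have dx : 0 <= d x by rewrite (le_trans (u0 x (ltW ax)))// ltW.
  have := hdd x ax xb; rewrite (ger0_norm dx) => h.
  by have := ler_norm (dd x); lra.
- by rewrite uE subrr mulr0 expR0; have := ler_norm (d a); lra.
Qed.

Lemma gronwall_abs_left d (dd : R -> R) L C a b : 0 < L -> 0 <= C -> a <= b ->
  continuous d ->
  (forall x, a < x -> x < b -> is_derive x 1 d (dd x)) ->
  (forall x, a < x -> x < b -> `|dd x| <= L * `|d x| + C) ->
  `|d a| <= (`|d b| + C / L) * expR (L * (b - a)).
Proof.
move=> L0 C0 ab cd hd hdd.
have := @gronwall_abs (fun y => d (- y)) (fun y => - dd (- y)) L C (- b) (- a) L0 C0.
rewrite !opprK (addrC (- a)); apply.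
- by rewrite lerN2.
- exact: continuous_reflect.
- by move=> x ax xb; apply: is_derive_reflect; apply: hd; lra.
- by move=> x ax xb; rewrite normrN; apply: hdd; lra.
Qed.

End calculus.

(** * Picard iteration *)

(* theta gives the base point: a constant theta yields the solution with a given
   value at that point, theta t = min t T the solution frozen before time T. *)
Fixpoint picard (R : realType) (f theta b : R -> R) n : R -> R :=
  if n is m.+1 then
    fun t => f t + (prim (b \o picard f theta b m) t
                    - prim (b \o picard f theta b m) (theta t))
  else f.

HB.lock Definition picard_lim (R : realType) (f theta b : R -> R) (t : R) : R :=
  limn (fun n => picard f theta b n t).

Section picard.
Context {R : realType}.
Implicit Types (f b theta : R -> R) (x y t s C N : R).

(** The sequences u m - 2 C 2^-m and u m + 2 C 2^-m are monotone and enclose u, so the limit and the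
    error bound both come from monotone convergence. *)
Lemma geometric_increments_cvg (u : nat -> R) C :
  (forall m, `|u m.+1 - u m| <= C * 2^-1 ^+ m) ->
  exists2 l, u @ \oo --> l & forall m, `|l - u m| <= 2 * C * 2^-1 ^+ m.
Proof.
move=> uC.
have uC' m : - (C * 2^-1 ^+ m) <= u m.+1 - u m <= C * 2^-1 ^+ m by rewrite -ler_norml.
have C0 : 0 <= C by have := uC 0%N; rewrite expr0 mulr1; apply: le_trans.
pose e m : R := 2 * C * 2^-1 ^+ m.
have e0 m : 0 <= e m by rewrite mulr_ge0 ?mulr_ge0 ?exprn_ge0 ?invr_ge0.
have eS m : e m.+1 = e m - C * 2^-1 ^+ m by rewrite /e exprS; lra.
pose v m := u m - e m; pose w m := u m + e m.
have vnd : {homo v : n m / (n <= m)%N >-> n <= m}.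
  apply/nondecreasing_seqP => m; rewrite /v eS.
  by have /andP[] := uC' m; lra.
have wni : {homo w : n m / (n <= m)%N >-> n >= m}.
  apply/nonincreasing_seqP => m; rewrite /w eS.
  by have /andP[] := uC' m; lra.
have vw n m : v n <= w m.
  have [nm|/ltnW mn] := leqP n m.
    by rewrite (le_trans (vnd _ _ nm))// /v /w; have := e0 m; lra.
  by rewrite (le_trans _ (wni _ _ mn))// /v /w; have := e0 n; lra.
have vc : cvgn v.
  by apply: nondecreasing_is_cvgn => //; exists (w 0%N) => _ [n _ <-].
exists (limn v).
  have -> : u = (fun n => v n + e n) by apply/funext => n; rewrite /v subrK.
  rewrite -[limn v]addr0; apply: cvgD => //.
  rewrite -(mulr0 (2 * C)); apply: cvgM; first exact: cvg_cst.
  by apply: cvg_expr; rewrite ger0_norm ?invr_ge0// invf_lt1// ltr1n.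
move=> m; rewrite ler_distl; apply/andP; split.
  exact: (nondecreasing_cvgn_le vnd vc).
by apply: limr_le => //; near=> n; exact: vw.
Unshelve. all: by end_near. Qed.

Lemma ler_normE x N : `|x| <= N -> - N <= x /\ x <= N.
Proof. by rewrite ler_norml => /andP. Qed.

Lemma continuous_bounded (g : R -> R) (a b : R) : continuous g ->
  exists2 C : R, 0 <= C & forall x, a <= x -> x <= b -> `|g x| <= C.
Proof.
move=> cg; have [ab|ba] := leP a b; last first.
  by exists 0 => // x ax xb; have := lt_le_trans ba (le_trans ax xb); rewrite ltxx.
have cn : continuous (fun x => `|g x|) by move=> x; apply: cvg_norm; exact: cg.
have [c _ hc] := EVT_max ab (continuous_subspaceT cn).
by exists `|g c| => // x ax xb; apply: hc; rewrite in_itv/= ax.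
Qed.

Lemma lipschitz_continuous (g : R -> R) C : (forall x y, `|g x - g y| <= C * `|x - y|) ->
  continuous g.
Proof.
move=> gC x; apply/cvgrPdist_le => e e0.
have C1 : 0 < `|C| + 1 by rewrite ltr_wpDl.
near=> y; rewrite (le_trans (gC _ _))//.
have : `|x - y| <= e / (`|C| + 1).
  by near: y; apply: cvgr_dist_le; [exact: cvg_id|exact: divr_gt0].
rewrite ler_pdivlMr// => h; rewrite (le_trans _ h)// mulrC ler_wpM2l//.
by rewrite (le_trans (ler_norm C))// lerDl.
Unshelve. all: by end_near. Qed.

Variables (f theta b : R -> R) (L c : R).
Hypothesis cf : continuous f.
Hypothesis ctheta : continuous theta.
Hypothesis L0 : 0 < L.
Hypothesis bL : forall x y, `|b x - b y| <= L * `|x - y|.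
Hypothesis theta_cst : forall t s,
  (theta t <= s /\ s <= t) \/ (t <= s /\ s <= theta t) -> theta s = theta t.
Hypothesis theta_bound : forall N t, c <= N -> `|t| <= N -> `|theta t| <= N.

Let y_ := picard f theta b.
Let ylim := picard_lim f theta b.

Let yS n t : y_ n.+1 t =
  f t + (prim (b \o y_ n) t - prim (b \o y_ n) (theta t)).
Proof. by []. Qed.

Let cb : continuous b. Proof. exact: lipschitz_continuous bL. Qed.

Lemma continuous_picard n : continuous (y_ n).
Proof.
elim: n => [|n ih] //=.
have cby : continuous (b \o picard f theta b n).
  by move=> t; apply: continuous_comp; [exact: ih|exact: cb].
move=> t; apply: cvgD; first exact: cf.
apply: cvgB; first exact: continuous_prim.
by apply: continuous_comp; [exact: ctheta|exact: continuous_prim].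
Qed.

Let continuous_b_picard n : continuous (b \o y_ n).
Proof. by move=> t; apply: continuous_comp; [exact: continuous_picard|exact: cb]. Qed.

Let is_derive_affine_exp (K l q x : R) :
  is_derive x 1 (fun s => K * expR (l * (s - q))) (K * (l * expR (l * (x - q)))).
Proof.
have h : is_derive x 1 (fun s => l * (s - q)) l.
  rewrite -[X in is_derive _ _ _ X]mulr1; apply: is_deriveZ.
  by rewrite -[X in is_derive _ _ _ X]subr0; exact: is_deriveB.
apply: is_deriveZ; rewrite mulrC.
exact: (@is_derive1_comp _ expR (fun s => l * (s - q))).
Qed.

(** Bielecki's weight exp(2 L |s - theta s|): integrating from theta t gains a factor 1 / (2 L),
    which makes the Picard map contract by 1/2 on every bounded interval. Between theta t and t the
    map theta is constant, so there the weight is an honest exponential. *)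
Let weighted_prim (phi : R -> R) N K : continuous phi -> c <= N -> 0 <= K ->
  (forall s, `|s| <= N -> `|phi s| <= K * (2 * L * expR (2 * L * `|s - theta s|))) ->
  forall t, `|t| <= N ->
  `|prim phi t - prim phi (theta t)| <= K * expR (2 * L * `|t - theta t|).
Proof.
move=> cphi cN K0 phiK t tN; set q := theta t.
have qN : `|q| <= N by exact: theta_bound.
have [q1 q2] := ler_normE qN; have [t1 t2] := ler_normE tN.
have [qt|tq] := leP q t.
  have dF := is_derive_affine_exp K (2 * L) q.
  rewrite (ger0_norm (_ : 0 <= t - q)) ?subr_ge0//.
  apply: (le_trans (prim_norm_le cphi qt (is_derive_continuous dF) (fun x _ _ => dF x) _)).
    move=> s qs st; have sq : theta s = q by apply: theta_cst; left; rewrite !ltW.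
    have sN : `|s| <= N by rewrite ler_norml; lra.
    by have := phiK s sN; rewrite sq (ger0_norm (_ : 0 <= s - q)) ?subr_ge0 ?(ltW qs).
  by rewrite subrr mulr0 expR0 mulr1 lerBlDr lerDl.
have dF := is_derive_affine_exp (- K) (- (2 * L)) q.
rewrite distrC (ltr0_norm (_ : t - q < 0)) ?subr_lt0//.
apply: (le_trans (prim_norm_le cphi (ltW tq) (is_derive_continuous dF) (fun x _ _ => dF x) _)).
  move=> s ts sq; have es : theta s = q by apply: theta_cst; right; rewrite !ltW.
  have sN : `|s| <= N by rewrite ler_norml; lra.
  have := phiK s sN; rewrite es (ltr0_norm (_ : s - q < 0)) ?subr_lt0//.
  have -> : - (2 * L) * (s - q) = 2 * L * - (s - q) by ring.
  by move=> /le_trans; apply; rewrite le_eqVlt; apply/orP; left; apply/eqP; ring.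
have -> : - (2 * L) * (t - q) = 2 * L * - (t - q) by ring.
by rewrite subrr mulr0 expR0; lra.
Qed.

(** The weighted increments halve at each step; on [-N, N] the weight is at most exp(4 L N), which
    gives the unweighted bound. *)
Lemma picard_increments N : c <= N -> exists2 C : R, 0 <= C &
  forall n t, `|t| <= N -> `|y_ n.+1 t - y_ n t| <= C * 2^-1 ^+ n.
Proof.
move=> cN.
have [C0 C00 hC0] := continuous_bounded (- N) N (@continuous_b_picard 0%N).
pose K := C0 / (2 * L).
have K0 : 0 <= K by rewrite divr_ge0// mulr_ge0// ltW.
have KE : K * (2 * L) = C0 by rewrite /K mulfVK// mulf_neq0// gt_eqF.
have step n t : `|t| <= N ->
    `|y_ n.+1 t - y_ n t| <= K * 2^-1 ^+ n * expR (2 * L * `|t - theta t|).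
  elim: n t => [|n ih] t tN.
    rewrite expr0 mulr1 /= addrAC subrr add0r.
    apply: (weighted_prim (@continuous_b_picard 0%N) cN) => // s sN.
    rewrite mulrA KE (le_trans (hC0 s _ _))//.
    - by move: sN; rewrite ler_norml => /andP[].
    - by move: sN; rewrite ler_norml => /andP[].
    by rewrite ler_peMr// leNgt expR_lt1 -leNgt mulr_ge0// mulr_ge0// ltW.
  have -> : y_ n.+2 t - y_ n.+1 t =
      prim (fun s => (b \o y_ n.+1) s - (b \o y_ n) s) t -
      prim (fun s => (b \o y_ n.+1) s - (b \o y_ n) s) (theta t).
    have [h|/ltW h] := leP (theta t) t.
      by rewrite primB// !yS; ring.
    by rewrite -[RHS]opprK opprB primB// !yS; ring.
  apply: (weighted_prim _ cN) => //.
  - by move=> s; apply: cvgB; exact: continuous_b_picard.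
  - by rewrite mulr_ge0// exprn_ge0// invr_ge0.
  move=> s sN; rewrite (le_trans (bL _ _))//.
  rewrite (le_trans (ler_wpM2l (ltW L0) (ih s sN)))// exprS le_eqVlt.
  by apply/orP; left; apply/eqP; field.
exists (K * expR (2 * L * (N + N))); first by rewrite mulr_ge0// expR_ge0.
move=> n t tN; rewrite (le_trans (step n t tN))// mulrAC ler_wpM2r//.
rewrite ler_wpM2l// ler_expR ler_wpM2l ?mulr_ge0 ?(ltW L0)//.
by rewrite (le_trans (ler_normB _ _))// lerD// theta_bound.
Qed.

Lemma picard_cvg_unif N : c <= N -> exists2 C : R, 0 <= C &
  forall n t, `|t| <= N -> `|ylim t - y_ n t| <= C * 2^-1 ^+ n.
Proof.
move=> cN; have [C C0 hC] := picard_increments cN.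
exists (2 * C) => [|n t tN]; first by rewrite mulr_ge0.
have [l ul hl] := geometric_increments_cvg (fun n => hC n t tN).
by rewrite /ylim picard_lim.unlock (_ : limn _ = l)//; exact/cvg_lim.
Qed.

Lemma picard_cvg t : y_ n t @[n --> \oo] --> ylim t.
Proof.
have cN : c <= Num.max c `|t| by rewrite le_max lexx.
have tN : `|t| <= Num.max c `|t| by rewrite le_max lexx orbT.
have [C C0 hC] := picard_increments cN.
have [l ul _] := geometric_increments_cvg (fun n => hC n t tN).
by rewrite /ylim picard_lim.unlock (_ : limn _ = l)//; exact/cvg_lim.
Qed.

Let half_pow_small (C e : R) : 0 < e -> 0 <= C -> exists n, C * 2^-1 ^+ n <= e.
Proof.
move=> e0 C0; have : C * 2^-1 ^+ n @[n --> \oo] --> C * 0.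
  apply: cvgM; first exact: cvg_cst.
  by apply: cvg_expr; rewrite ger0_norm ?invr_ge0// invf_lt1// ltr1n.
rewrite mulr0 => /cvgr_le /(_ _ e0)[n _ hn]; exists n; exact: (hn n (leqnn n)).
Qed.

Lemma continuous_picard_lim : continuous ylim.
Proof.
move=> t; apply/cvgrPdist_le => e e0.
pose N := Num.max c (`|t| + 1).
have cN : c <= N by rewrite le_max lexx.
have [C C0 hC] := picard_cvg_unif cN.
have e3 : 0 < e / 3 by rewrite divr_gt0.
have [n hn] := half_pow_small e3 C0.
near=> s.
have tN : `|t| <= N by rewrite le_max; apply/orP; right; rewrite lerDl.
have sN : `|s| <= N.
  rewrite le_max; apply/orP; right.
  have : `|t - s| <= 1 by near: s; apply: cvgr_dist_le; [exact: cvg_id|].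
  by have := ler_normD t (s - t); rewrite addrC subrK distrC; lra.
have h : `|y_ n t - y_ n s| <= e / 3.
  by near: s; apply: cvgr_dist_le => //; exact: continuous_picard.
have := hC n t tN; have := hC n s sN; rewrite (distrC (ylim s)) => h1 h2.
have -> : ylim t - ylim s = (ylim t - y_ n t) + ((y_ n t - y_ n s) + (y_ n s - ylim s)) by ring.
rewrite (le_trans (ler_normD _ _))//.
by have := ler_normD (y_ n t - y_ n s) (y_ n s - ylim s); lra.
Unshelve. all: by end_near. Qed.

Let continuous_b_lim : continuous (b \o ylim).
Proof. by move=> t; apply: continuous_comp; [exact: continuous_picard_lim|exact: cb]. Qed.

(** By uniform convergence on [-N, N], the defect in this equation is at most a constant times 2^-n
    for every n. *)
Lemma picard_limE t :
  ylim t = f t + (prim (b \o ylim) t - prim (b \o ylim) (theta t)).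
Proof.
pose N := Num.max c `|t|.
have cN : c <= N by rewrite le_max lexx.
have tN : `|t| <= N by rewrite le_max lexx orbT.
have [C C0 hC] := picard_cvg_unif cN.
have qN := theta_bound cN tN.
have N0 : 0 <= N by rewrite (le_trans _ tN).
have D0 : 0 <= C + L * C * (N + N) by rewrite addr_ge0// !mulr_ge0// ?(ltW L0)// addr_ge0.
apply/eqP; rewrite -subr_eq0 -normr_le0; apply/ler_addgt0Pr => e e0; rewrite add0r.
have [n hn] := half_pow_small e0 D0.
apply: le_trans hn.
have pB u v : u <= v -> `|u| <= N -> `|v| <= N ->
    `|prim (b \o y_ n) v - prim (b \o y_ n) u - (prim (b \o ylim) v - prim (b \o ylim) u)|
    <= L * C * (N + N) * 2^-1 ^+ n.
  move=> uv /ler_normE[u1 u2] /ler_normE[v1 v2]; rewrite -primB//.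
  apply: (@le_trans _ _ ((L * (C * 2^-1 ^+ n)) * (v - u))).
    apply: prim_norm_le_cst => //.
      by move=> s; apply: cvgB; [exact: continuous_b_picard|exact: continuous_b_lim].
    move=> s us sv; rewrite (le_trans (bL _ _))// ler_wpM2l// ?(ltW L0)// distrC hC//.
    by rewrite ler_norml; lra.
  rewrite -[leRHS]mulrA (mulrC (N + N)).
  rewrite -!mulrA ler_wpM2l ?(ltW L0)// ler_wpM2l// ler_wpM2l ?exprn_ge0 ?invr_ge0//.
  by lra.
have -> : ylim t - (f t + (prim (b \o ylim) t - prim (b \o ylim) (theta t))) =
   (ylim t - y_ n.+1 t) + (prim (b \o y_ n) t - prim (b \o y_ n) (theta t)
     - (prim (b \o ylim) t - prim (b \o ylim) (theta t))).
  by rewrite yS; ring.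
rewrite (le_trans (ler_normD _ _))// mulrDl lerD//.
  rewrite (le_trans (hC n.+1 t tN))// ler_wpM2l// exprS ler_piMl//.
  by rewrite invf_le1// ler1n.
have [h|/ltW h] := leP (theta t) t; first exact: pB.
rewrite -normrN; have -> : forall p q r s : R, - (p - q - (r - s)) = q - p - (s - r).
  by move=> *; ring.
exact: pB.
Qed.

End picard.

(** * The ordinary differential equation *)

Section ode.
Context {R : realType}.
Variables (a M : R) (pi H : R -> R).
Hypothesis a0 : 0 < a.
Hypothesis M0 : 0 < M.
Hypothesis piM : forall x y, `|pi x - pi y| <= M * `|x - y|.
Hypothesis cH : continuous H.
Hypothesis H_incr : forall x y : R, 0 <= x -> x < y -> H x < H y.
Hypothesis H_unbounded : forall C : R, exists2 x : R, 0 <= x & C < H x.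
Implicit Types (w : R -> R) (g q x y N s t v : R).

(** The equation of (a) solved for w', with a = 2 / sigma^2 and g for gamma. It is imposed on the
    whole line, so that no one-sided derivative occurs. *)
Definition solves_ode w g :=
  forall x, is_derive x 1 w (a * (g - pi (w x) - H x)).

Let aM0 : 0 < a * M. Proof. exact: mulr_gt0. Qed.
Let aM0' : 0 <= a * M. Proof. exact: ltW. Qed.

Let pi_le x y : a * (pi x - pi y) <= a * M * `|y - x|.
Proof.
by rewrite -mulrA ler_wpM2l ?(ltW a0)// distrC (le_trans (ler_norm _)).
Qed.

Let solves_continuous w g : solves_ode w g -> continuous w.
Proof. exact: is_derive_continuous. Qed.

Let is_derive_subcst w (dw v x : R) : is_derive x 1 w dw ->
  is_derive x 1 (fun y => w y - v) dw.
Proof. by move=> h; rewrite -[X in is_derive _ _ _ X]subr0; exact: is_deriveB. Qed.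

Let continuousB (f g : R -> R) : continuous f -> continuous g ->
  continuous (fun y => f y - g y).
Proof. by move=> cf cg x; apply: cvgB; [exact: cf|exact: cg]. Qed.

(** Two comparisons. As H increases past x1, w falls below the constant w x1. Hence the translate w
    (s + e) starts below w at x1; it solves the equation with a larger H, so it stays below, for
    every e > 0. *)
Lemma solution_decreasing w g x1 x y : solves_ode w g -> 0 <= x1 ->
  g - pi (w x1) - H x1 <= 0 -> x1 <= x -> x < y -> w y < w x.
Proof.
move=> hw x10 gx1.
have cw := solves_continuous hw.
have step1 z : x1 < z -> w z < w x1.
  move=> x1z; rewrite -subr_lt0.
  apply: (gronwall_drift_lt (d := fun y => w y - w x1) aM0' x1z _ _ _ _).
  - by apply: continuousB => // ?; exact: cvg_cst.
  - by move=> s _ _; apply: is_derive_subcst; exact: hw.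
  - move=> s x1s sz /=; apply: lt_le_trans (pi_le (w x1) (w s)).
    by rewrite ltr_pM2l//; have := H_incr x10 x1s; lra.
  - by rewrite subrr.
move=> x1x xy; pose e := y - x; have e0 : 0 < e by rewrite subr_gt0.
rewrite -subr_lt0 (_ : y = x + e); last by rewrite /e addrC subrK.
apply: (gronwall_lt (d := fun s => w (s + e) - w s) aM0' x1x _ _ _ _).
- apply: continuousB => // s; apply: continuous_comp; last exact: cw.
  by apply: cvgD; [exact: cvg_id|exact: cvg_cst].
- move=> s _ _; have ? := hw s.
  have ? : is_derive s 1 (fun s => w (s + e)) (a * (g - pi (w (s + e)) - H (s + e))).
    rewrite -[X in is_derive _ _ _ X]mulr1.
    apply: (@is_derive1_comp _ w (fun s => s + e)); first exact: hw.
    by rewrite -[X in is_derive _ _ _ X]addr0; exact: is_deriveD.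
  exact: is_deriveB.
- move=> s x1s sx /=; apply: le_trans (pi_le (w s) (w (s + e))).
  rewrite -mulrBr ler_pM2l//.
  have s0 : 0 <= s by rewrite (le_trans x10)// ltW.
  by have := H_incr s0 (_ : s < s + e); rewrite ltrDl e0 => /(_ isT); lra.
- by rewrite subr_lt0 step1// ltrDl.
Qed.

(** Left of x2 the value H is smaller than at x2, so the equation would push a solution at the level
    w x2 upwards; comparison backwards from x2 keeps w under that level. *)
Lemma solution_below w g x x2 : solves_ode w g -> 0 <= x -> x < x2 ->
  0 <= g - pi (w x2) - H x2 -> w x < w x2.
Proof.
move=> hw x0 xx2 gx2; have cw := solves_continuous hw.
rewrite -subr_lt0.
apply: (gronwall_drift_lt_left (d := fun y => w y - w x2) aM0' xx2 _ _ _ _).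
- by apply: continuousB => // ?; exact: cvg_cst.
- by move=> s _ _; apply: is_derive_subcst; exact: hw.
- move=> s xs sx2 /=; rewrite -normrN opprB; apply: lt_le_trans (pi_le (w s) (w x2)).
  rewrite -mulrN ltr_pM2l//.
  by have := H_incr (ltW (le_lt_trans x0 xs)) sx2; lra.
- by rewrite subrr.
Qed.

(** If the derivative were nonpositive at y, w would decrease from y on and w x2 < w y, against
    [solution_below]. So it is positive at y, and [solution_below] applies with y in place of x2. *)
Lemma solution_increasing w g x y x2 : solves_ode w g -> 0 <= x -> x < y -> y <= x2 ->
  0 <= g - pi (w x2) - H x2 -> w x < w y.
Proof.
move=> hw x0 xy; rewrite le_eqVlt => /predU1P[e |yx2] gx2.
  by rewrite e; apply: (solution_below hw x0) => //; rewrite -e.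
have y0 : 0 <= y by rewrite (le_trans x0)// ltW.
apply: (solution_below hw x0 xy); rewrite leNgt; apply/negP => /ltW gy.
have := solution_decreasing hw y0 gy (lexx y) yx2.
by rewrite ltNge (ltW (solution_below hw y0 yx2 gx2)).
Qed.

(** This and its backward version are applied to straight lines v, to force a solution with large g
    to be steep. *)
Lemma subsolution_le (v dv : R -> R) w g x y : solves_ode w g -> x <= y ->
  continuous v -> (forall s, is_derive s 1 v (dv s)) ->
  (forall s, x < s -> s < y -> dv s <= a * (g - pi (v s) - H s)) ->
  v x <= w x -> v y <= w y.
Proof.
move=> hw xy cv hv hdv vx; have cw := solves_continuous hw.
rewrite -subr_le0.
apply: (gronwall_le (L := a * M) (d := fun s => v s - w s) xy _ _ _ _).
- exact: continuousB.
- by move=> s _ _; have ? := hv s; have ? := hw s; exact: is_deriveB.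
- move=> s xs sy /= d0; have := pi_le (w s) (v s); rewrite (gtr0_norm d0) => h.
  by apply: le_trans h; have := hdv s xs sy; rewrite !mulrBr; lra.
- by rewrite subr_le0.
Qed.

Lemma subsolution_ge_left (v dv : R -> R) w g x y : solves_ode w g -> x <= y ->
  continuous v -> (forall s, is_derive s 1 v (dv s)) ->
  (forall s, x < s -> s < y -> dv s <= a * (g - pi (v s) - H s)) ->
  w y <= v y -> w x <= v x.
Proof.
move=> hw xy cv hv hdv vx; have cw := solves_continuous hw.
rewrite -subr_le0.
apply: (gronwall_le_left (L := a * M) (d := fun s => w s - v s) xy _ _ _ _).
- exact: continuousB.
- by move=> s _ _; have ? := hv s; have ? := hw s; exact: is_deriveB.
- move=> s xs sy /= d0; have := pi_le (w s) (v s).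
  rewrite -normrN opprB (gtr0_norm d0) => h.
  by apply: le_trans h; have := hdv s xs sy; rewrite !mulrBr; lra.
- by rewrite subr_le0.
Qed.

(** Where two solutions meet, the one with the larger constant is steeper, hence lower on the left.
    The area in the first boundary condition is therefore strictly decreasing in gamma. *)
Lemma solution_lt_left w w' g g' q x : solves_ode w g -> solves_ode w' g' ->
  w' q <= w q -> g < g' -> x < q -> w' x < w x.
Proof.
move=> hw hw' e gg' qx; rewrite -subr_lt0.
apply: (gronwall_drift_lt_left (d := fun s => w' s - w s) aM0' qx _ _ _ _).
- by apply: continuousB; apply: solves_continuous; [exact: hw'|exact: hw].
- by move=> s _ _; have ? := hw s; have ? := hw' s; exact: is_deriveB.
- move=> s _ _ /=; rewrite (distrC (w' s)); apply: lt_le_trans (pi_le (w' s) (w s)).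
  by rewrite -mulrBr -mulrN ltr_pM2l//; lra.
- by rewrite subr_le0.
Qed.

(** Gronwall for the difference with rate a M and source a |g - g'|, whose quotient is |g - g'| /
    M. *)
Lemma solution_dist w w' g g' q x : solves_ode w g -> solves_ode w' g' ->
  `|w x - w' x| <= (`|w q - w' q| + `|g - g'| / M) * expR (a * M * `|x - q|).
Proof.
move=> hw hw'; have cw := solves_continuous hw; have cw' := solves_continuous hw'.
have -> : `|g - g'| / M = a * `|g - g'| / (a * M).
  by rewrite invfM mulrACA divff ?gt_eqF// mul1r.
have hd (s : R) : is_derive s 1 (fun s => w s - w' s)
    (a * (g - pi (w s) - H s) - a * (g' - pi (w' s) - H s)).
  by have ? := hw s; have ? := hw' s; exact: is_deriveB.
have hb s : `|a * (g - pi (w s) - H s) - a * (g' - pi (w' s) - H s)| <=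
    a * M * `|w s - w' s| + a * `|g - g'|.
  rewrite -mulrBr normrM (gtr0_norm a0) -mulrA -mulrDr ler_pM2l//.
  have -> : g - pi (w s) - H s - (g' - pi (w' s) - H s) =
    (g - g') - (pi (w s) - pi (w' s)) by ring.
  by rewrite (le_trans (ler_normB _ _))// addrC lerD.
have c0 : 0 <= a * `|g - g'| by rewrite mulr_ge0// ltW.
have [qx|/ltW xq] := leP q x.
  rewrite (ger0_norm (_ : 0 <= x - q)) ?subr_ge0//.
  exact: (gronwall_abs (d := fun s => w s - w' s) aM0 c0 qx (continuousB cw cw')
    (fun s _ _ => hd s) (fun s _ _ => hb s)).
rewrite (ler0_norm (_ : x - q <= 0)) ?subr_le0// opprB.
exact: (gronwall_abs_left (d := fun s => w s - w' s) aM0 c0 xq (continuousB cw cw')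
    (fun s _ _ => hd s) (fun s _ _ => hb s)).
Qed.

Let integrand g s := a * (g - H s).
Let forcing (v : R) q g t := v + (prim (integrand g) t - prim (integrand g) q).
(** The term depending on x is integrated into the forcing, so that the iterated nonlinearity - a pi
    is autonomous and Lipschitz. *)
Definition solution (v : R) q g : R -> R :=
  picard_lim (forcing v q g) (fun=> q) (fun y => - (a * pi y)).

Let cintegrand g : continuous (integrand g).
Proof.
move=> s; apply: cvgM; first exact: cvg_cst.
by apply: cvgB; [exact: cvg_cst|exact: cH].
Qed.

Let solutionP (v : R) q g : [/\ continuous (solution v q g),
  solution v q g q = v & solves_ode (solution v q g) g].
Proof.
have cf : continuous (forcing v q g).
  move=> t; apply: cvgD; first exact: cvg_cst.
  by apply: cvgB; [exact: continuous_prim|exact: cvg_cst].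
have ct : continuous (fun _ : R => q) by move=> ?; exact: cvg_cst.
have bL x y : `|- (a * pi x) - - (a * pi y)| <= a * M * `|x - y|.
  by rewrite -opprD normrN -mulrBr normrM (gtr0_norm a0) -mulrA ler_pM2l.
have tb N t : `|q| <= N -> `|t| <= N -> `|(fun _ : R => q) t| <= N by [].
have cs : continuous (solution v q g).
  by apply: (continuous_picard_lim (L := a * M) (c := `|q|)).
have es t : solution v q g t = forcing v q g t +
    (prim ((fun y => - (a * pi y)) \o solution v q g) t
     - prim ((fun y => - (a * pi y)) \o solution v q g) q).
  by apply: (picard_limE (L := a * M) (c := `|q|)).
have cb : continuous ((fun y => - (a * pi y)) \o solution v q g).
  by move=> t; apply: continuous_comp; [exact: cs|exact: (@lipschitz_continuous R (fun y => - (a * pi y)) _ bL)].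
split => //; first by rewrite es /forcing; ring.
move=> x.
have -> : solution v q g = fun t => v - prim (integrand g) q
     - prim ((fun y => - (a * pi y)) \o solution v q g) q
    + (prim (integrand g) t + prim ((fun y => - (a * pi y)) \o solution v q g) t).
  by apply/funext => t; rewrite {1}es /forcing; ring.
have -> : a * (g - pi ((fun t => v - prim (integrand g) q
     - prim ((fun y => - (a * pi y)) \o solution v q g) q
    + (prim (integrand g) t + prim ((fun y => - (a * pi y)) \o solution v q g) t)) x) - H x)
   = 0 + (integrand g x + ((fun y => - (a * pi y)) \o solution v q g) x).
  rewrite /integrand /= [in RHS]es /forcing; set A := pi _; set B := pi _.
  have -> : A = B by rewrite /A /B; congr pi; ring.
  ring.
have h1 := is_derive_prim x (cintegrand (g := g)).
have h2 := is_derive_prim x cb.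
have h3 : is_derive x 1 (fun t => prim (integrand g) t +
   prim ((fun y => - (a * pi y)) \o solution v q g) t)
   (integrand g x + ((fun y => - (a * pi y)) \o solution v q g) x) by exact: is_deriveD.
exact: is_deriveD.
Qed.

Lemma solution_base v q g : solution v q g q = v.
Proof. by have [] := solutionP v q g. Qed.

Lemma solution_solves v q g : solves_ode (solution v q g) g.
Proof. by have [] := solutionP v q g. Qed.

Lemma continuous_solution v q g : continuous (solution v q g).
Proof. by have [] := solutionP v q g. Qed.

(** Both solutions are compared from the base point q': there one has the value v and the other
    [solution v q g q'], which is near v by continuity. *)
Lemma solution_cvg v q g N (e : R) : 0 < e -> exists2 d : R, 0 < d & forall q' g',
  `|q' - q| < d -> `|g' - g| < d ->
  forall x, `|x| <= N -> `|solution v q' g' x - solution v q g x| <= e.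
Proof.
move=> e0.
pose E := expR (a * M * (`|N| + `|q| + 1)).
have E0 : 0 < E by exact: expR_gt0.
have e1 : 0 < e / 2 / E by rewrite !divr_gt0.
have [d d0 hd] := continuous_dist_near q (@continuous_solution v q g) e1.
exists (Num.min (Num.min d 1) (M * (e / 2 / E))).
  by rewrite !lt_min d0 ltr01 mulr_gt0.
move=> q' g'; rewrite !lt_min => /andP[/andP[qd q1] _] /andP[_ gM] x xN.
have := @solution_dist _ _ _ _ q' x (solution_solves v q' g') (solution_solves v q g).
rewrite solution_base => h; apply: (le_trans h).
have h1 : `|v - solution v q g q'| <= e / 2 / E.
  by have := hd _ qd; rewrite solution_base distrC.
have h2 : `|g' - g| / M <= e / 2 / E by rewrite ler_pdivrMr// mulrC ltW.
apply: (@le_trans _ _ ((e / 2 / E + e / 2 / E) * E)).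
  apply: ler_pM; rewrite ?addr_ge0// ?expR_ge0// ?divr_ge0// ?(ltW M0)//.
    exact: lerD.
  rewrite ler_expR ler_pM2l//.
  have := ler_normB x q'; have := ler_norm N; have := ler_normD q (q' - q).
  by rewrite (addrC q) subrK; lra.
rewrite -mulrDl divfK ?gt_eqF//; lra.
Qed.

End ode.

(** * The free boundary problem *)

Section free_boundary.
Context {R : realType}.
Variables (a M : R) (pi H : R -> R).
Hypothesis a0 : 0 < a.
Hypothesis M0 : 0 < M.
Hypothesis piM : forall x y, `|pi x - pi y| <= M * `|x - y|.
Hypothesis H_incr : forall x y : R, 0 <= x -> x < y -> H x < H y.
Hypothesis H_unbounded : forall C : R, exists2 x : R, 0 <= x & C < H x.
Implicit Types (w : R -> R) (g q x y N s t v : R).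

Let pi_le x y : a * (pi x - pi y) <= a * M * `|y - x|.
Proof.
by rewrite -mulrA ler_wpM2l ?(ltW a0)// distrC (le_trans (ler_norm _)).
Qed.

Let continuousB (f g : R -> R) : continuous f -> continuous g ->
  continuous (fun y => f y - g y).
Proof. by move=> cf cg x; apply: cvgB; [exact: cf|exact: cg]. Qed.

Variables (K k L l : R).
Hypotheses (K0 : 0 < K) (k0 : 0 < k) (L0 : 0 < L) (l0 : 0 < l).

Variable W : R -> R -> R -> R.
Hypothesis cW : forall q g, continuous (W q g).
Hypothesis Wode : forall q g, solves_ode a pi H (W q g) g.
Hypothesis Wq : forall q g, W q g q = - k.
Hypothesis W_cvg : forall q g N (e : R), 0 < e -> exists2 d : R, 0 < d &
  forall q' g', `|q' - q| < d -> `|g' - g| < d ->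
  forall x, `|x| <= N -> `|W q' g' x - W q g x| <= e.

Let A q g := prim (fun x => W q g x + k) q.

Let cWk q g : continuous (fun x => W q g x + k).
Proof. by move=> x; apply: cvgD; [exact: cW|exact: cvg_cst]. Qed.

Let prim_dist (f g : R -> R) (c x y : R) : continuous f -> continuous g -> x <= y ->
  (forall s, x <= s -> s <= y -> `|f s - g s| <= c) ->
  `|prim f y - prim f x - (prim g y - prim g x)| <= c * (y - x).
Proof.
move=> cf cg xy fg; rewrite -primB//; apply: prim_norm_le_cst => //.
exact: continuousB.
Qed.

Let A_cvg q g (e : R) : 0 < q -> 0 < e -> exists2 d : R, 0 < d & forall q' g',
  `|q' - q| < d -> `|g' - g| < d -> `|A q' g' - A q g| <= e.
Proof.
move=> q0 e0; have q1 : 0 < q + q by lra.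
have e1 : 0 < e / 2 / (q + q) by rewrite !divr_gt0.
have [d1 d10 h1] := @W_cvg q g (q + q) _ e1.
have e2 : 0 < e / 2 by rewrite divr_gt0.
have [d2 d20 h2] := continuous_dist_near q (continuous_prim (@cWk q g)) e2.
exists (Num.min (Num.min d1 d2) q); first by rewrite !lt_min d10 d20.
move=> q' g'; rewrite !lt_min => /andP[/andP[q'1 q'2] q'3] /andP[/andP[g'1 _] _].
have [q'l q'u] : 0 < q' /\ q' < q + q by move: q'3; rewrite ltr_norml; lra.
have -> : A q' g' - A q g = (prim (fun x => W q' g' x + k) q' - prim (fun x => W q' g' x + k) 0
   - (prim (fun x => W q g x + k) q' - prim (fun x => W q g x + k) 0)) +
   (prim (fun x => W q g x + k) q' - prim (fun x => W q g x + k) q).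
  by rewrite !prim0 /A; ring.
rewrite (le_trans (ler_normD _ _))//.
have := h2 _ q'2; have : `|prim (fun x => W q' g' x + k) q' - prim (fun x => W q' g' x + k) 0
   - (prim (fun x => W q g x + k) q' - prim (fun x => W q g x + k) 0)| <= e / 2.
  apply: (@le_trans _ _ (e / 2 / (q + q) * (q' - 0))).
    apply: prim_dist => //; first exact: ltW.
    move=> s s0 sq; rewrite (_ : _ - _ = W q' g' s - W q g s); last by ring.
    by apply: h1 => //; rewrite ger0_norm//; lra.
  by rewrite subr0 mulrAC ler_pdivrMr// ler_pM2l// ltW.
lra.
Qed.

Let A_decr q g g' : 0 < q -> g < g' -> A q g' < A q g.
Proof.
move=> q0 gg'; rewrite -subr_gt0.
have := @pos_derivative_increasing R (fun x => prim (fun x => W q g x + k) x - prim (fun x => W q g' x + k) x)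
  (fun x => (W q g x + k) - (W q g' x + k)) 0 q q0.
rewrite !prim0 subrr; apply.
- by apply: continuousB; exact: continuous_prim.
- move=> x _ _; have ? := is_derive_prim x (@cWk q g).
  have ? := is_derive_prim x (@cWk q g').
  exact: is_deriveB.
- move=> x _ xq; have : W q g' x < W q g x; last by lra.
  by apply: (solution_lt_left a0 M0 piM (Wode q g) (Wode q g') _ gg' xq); rewrite !Wq.
Qed.

Let A_inj q g g' : 0 < q -> A q g < A q g' -> g' < g.
Proof.
move=> q0 h; rewrite ltNge le_eqVlt; apply/negP => /predU1P[e|/(A_decr q0)].
  by move: h; rewrite e ltxx.
by rewrite ltNge (ltW h).
Qed.

Lemma area_solvable q : 0 < q -> exists g, A q g = - K.
Proof.
have [K_gt0 k_gt0 L_gt0 l_gt0] := And4 K0 k0 L0 l0.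
move=> q0.
have [g1 h1] : exists g1, 0 <= A q g1.
  (* With this constant the right-hand side at the level - k is a (H 0 - H x) <= 0, so backward
     comparison from q keeps w above - k on [0, q]. *)
  exists (pi (- k) + H 0); rewrite [leLHS](_ : 0 = prim (fun x => W q (pi (- k) + H 0) x + k) 0); last by rewrite prim0.
  apply: prim_ge0 => //; first exact: ltW.
  move=> x x0; rewrite le_eqVlt => /predU1P[->|xq]; first by rewrite Wq addNr.
  pose d s := - k - W q (pi (- k) + H 0) s.
  suff : d x <= 0 by rewrite /d; lra.
  apply: (@gronwall_le_left R d (fun s => 0 - a * (pi (- k) + H 0 - pi (W q (pi (- k) + H 0) s) - H s)) (a * M) x q (ltW xq)).
  - by apply: continuousB => // ?; exact: cvg_cst.
  - by move=> s _ _; have ? := Wode q (pi (- k) + H 0) s; exact: is_deriveB.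
  - move=> s xs _ ds; rewrite sub0r opprK.
    have := pi_le (- k) (W q (pi (- k) + H 0) s).
    rewrite distrC (gtr0_norm ds); apply: le_trans.
    rewrite ler_pM2l//; have := H_incr (lexx 0) (le_lt_trans x0 xs); lra.
  - by rewrite /d Wq subrr.
have [g2 h2] : exists g2, A q g2 < - K.
  (* The line of slope p through (q, - k) cuts off the area p q^2 / 2 = 2 K below the level - k. *)
  pose p := 4 * K / (q * q).
  have p0 : 0 < p by rewrite divr_gt0 ?mulr_gt0.
  (* Large enough for that line to be a subsolution on [0, q], where pi along it exceeds pi (- k) by
     at most M p q. *)
  pose g2 := p / a + pi (- k) + M * (p * q) + H q.
  exists g2.
  have h x : 0 <= x -> x <= q -> W q g2 x <= - k + p * (x - q).
    move=> x0 xq.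
    have dv s : is_derive s 1 (fun s => - k + p * (s - q)) p.
      have ? : is_derive s 1 (fun s => p * (s - q)) p.
        rewrite -[X in is_derive _ _ _ X]mulr1; apply: is_deriveZ.
        by rewrite -[X in is_derive _ _ _ X]subr0; exact: is_deriveB.
      by rewrite -[X in is_derive _ _ _ X]add0r; exact: is_deriveD.
    apply: (subsolution_ge_left a0 piM (Wode q g2) xq (is_derive_continuous dv) dv).
      move=> s xs sq; have s0 : 0 < s := le_lt_trans x0 xs.
      have e : p = a * (p / a) by rewrite mulrC divfK ?gt_eqF.
      rewrite {1}e ler_pM2l// /g2; have := H_incr (ltW s0) sq.
      have := piM (- k + p * (s - q)) (- k).
      rewrite addrAC subrr add0r normrM (gtr0_norm p0) ltr0_norm ?subr_lt0//.
      have : M * (p * (- (s - q))) <= M * (p * q) by rewrite !ler_pM2l//; lra.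
      by have := ler_norm (pi (- k + p * (s - q)) - pi (- k)); lra.
    by rewrite Wq subrr mulr0 addr0.
  have cv : continuous (fun x : R => p * (x - q)).
    by move=> x; apply: cvgM; [exact: cvg_cst|apply: cvgB; [exact: cvg_id|exact: cvg_cst]].
  have := @prim_le R (fun x => W q g2 x + k) (fun x => p / 2 * ((x - q) * (x - q)))
    (fun x => p * (x - q)) 0 q (@cWk q g2) (ltW q0).
  rewrite prim0 subr0 -/(A q g2) subrr mulr0 mulr0 sub0r sub0r mulrNN => hh.
  apply: (@le_lt_trans _ _ (- (p / 2 * (q * q)))).
    have dF x : is_derive x 1 (fun x => p / 2 * ((x - q) * (x - q))) (p * (x - q)).
      have ? : is_derive x 1 (fun x => x - q) 1.
        by rewrite -[X in is_derive _ _ _ X]subr0; exact: is_deriveB.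
      have e : p * (x - q) = p / 2 * ((x - q) * 1 + (x - q) * 1) by field.
      by rewrite e; apply: is_deriveZ; exact: is_deriveM.
    apply: hh => //; first exact: is_derive_continuous dF.
    by move=> x x0 xq; have := h x (ltW x0) (ltW xq); lra.
  have -> : p / 2 * (q * q) = 2 * K by rewrite /p; field; rewrite gt_eqF.
  lra.
have cA : continuous (A q).
  move=> g; apply/cvgrPdist_le => e e0; have [d d0 hd] := A_cvg g q0 e0.
  near=> g'; rewrite distrC; apply: hd; first by rewrite subrr normr0.
  by rewrite distrC; near: g'; apply: cvgr_dist_lt; [exact: cvg_id|].
have g12 : g1 <= g2 by apply: ltW; apply: (A_inj q0); lra.
have [|g _ hg] := @IVT R (A q) g1 g2 (- K) g12 (continuous_subspaceT cA).
  by rewrite ge_min le_max (ltW h2) orbT/= (_ : - K <= A q g1)//; lra.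
by exists g.
Unshelve. all: by end_near. Qed.

Variable gam : R -> R.
Hypothesis A_gam : forall q, 0 < q -> A q (gam q) = - K.

(** At gam q + e / 2 and gam q - e / 2 the area lies strictly on either side of - K. These two
    strict inequalities survive a small change of q and trap gam q'. *)
Let gam_cvg q (e : R) : 0 < q -> 0 < e -> exists2 d : R, 0 < d &
  forall q', `|q' - q| < d -> `|gam q' - gam q| < e.
Proof.
move=> q0 e0.
have h1 : A q (gam q + e / 2) < - K by rewrite -(A_gam q0); apply: A_decr => //; lra.
have h2 : - K < A q (gam q - e / 2) by rewrite -(A_gam q0); apply: A_decr => //; lra.
have e1 : 0 < (- K - A q (gam q + e / 2)) / 2 by rewrite divr_gt0// subr_gt0.
have e2 : 0 < (A q (gam q - e / 2) - - K) / 2 by rewrite divr_gt0// subr_gt0.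
have [d1 d10 hd1] := A_cvg (gam q + e / 2) q0 e1.
have [d2 d20 hd2] := A_cvg (gam q - e / 2) q0 e2.
exists (Num.min (Num.min d1 d2) q); first by rewrite !lt_min d10 d20.
move=> q'; rewrite !lt_min => /andP[/andP[q'1 q'2] q'3].
have q'0 : 0 < q' by move: q'3; rewrite ltr_norml; lra.
have u : gam q' < gam q + e / 2.
  apply: (A_inj q'0); rewrite (A_gam q'0).
  have := hd1 q' (gam q + e / 2) q'1; rewrite subrr normr0 => /(_ d10).
  by move=> /ler_normE[]; lra.
have v : gam q - e / 2 < gam q'.
  apply: (A_inj q'0); rewrite (A_gam q'0).
  have := hd2 q' (gam q - e / 2) q'2; rewrite subrr normr0 => /(_ d20).
  by move=> /ler_normE[]; lra.
by rewrite ltr_norml; lra.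
Qed.

Let V q := W q (gam q).

Let V_cvg q N (e : R) : 0 < q -> 0 < e -> exists2 d : R, 0 < d & forall q',
  `|q' - q| < d -> forall x, `|x| <= N -> `|V q' x - V q x| <= e.
Proof.
move=> q0 e0; have [d1 d10 h1] := @W_cvg q (gam q) N _ e0.
have [d2 d20 h2] := gam_cvg q0 d10.
exists (Num.min d1 d2); first by rewrite lt_min d10.
by move=> q'; rewrite lt_min => /andP[q1 q2] x xN; apply: h1 => //; exact: h2.
Qed.

Let pos (y : R) := Num.max (y - l) 0.

Let posL x y : `|pos x - pos y| <= 1 * `|x - y|.
Proof.
rewrite mul1r /pos; case: (leP (x - l) 0) => h1; case: (leP (y - l) 0) => h2.
- by rewrite subrr normr0.
- rewrite sub0r normrN gtr0_norm//.
  by have := ler_norm (y - x); rewrite distrC; lra.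
- by rewrite subr0 gtr0_norm//; have := ler_norm (x - y); lra.
- by rewrite (_ : _ - _ = x - y)//; ring.
Qed.

Let cposV q : continuous (pos \o V q).
Proof.
by move=> x; apply: continuous_comp; [exact: cW|exact: (lipschitz_continuous posL)].
Qed.

Let pos0 y : 0 <= pos y. Proof. by rewrite le_max lexx orbT. Qed.

(** The truncation at T gives a finite quantity, continuous in q, before the total area above l is
    known to be finite. *)
Let Bt T q := prim (pos \o V q) T - prim (pos \o V q) q.

Let Bt_cvg T q (e : R) : 0 < q -> q < T -> 0 < e -> exists2 d : R, 0 < d &
  forall q', `|q' - q| < d -> `|Bt T q' - Bt T q| <= e.
Proof.
move=> q0 qT e0; have T0 : 0 < T := lt_trans q0 qT.
have e1 : 0 < e / 2 / T by rewrite !divr_gt0.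
have [d1 d10 h1] := V_cvg T q0 e1.
have e2 : 0 < e / 2 by rewrite divr_gt0.
have [d2 d20 h2] := continuous_dist_near q (continuous_prim (@cposV q)) e2.
exists (Num.min (Num.min d1 d2) (Num.min q (T - q))).
  by rewrite !lt_min d10 d20 q0 subr_gt0.
move=> q'; rewrite !lt_min => /andP[/andP[q'1 q'2] /andP[q'3 q'4]].
have [q'l q'u] : 0 < q' /\ q' < T by move: q'3 q'4; rewrite !ltr_norml; lra.
have -> : Bt T q' - Bt T q = (prim (pos \o V q') T - prim (pos \o V q') q'
   - (prim (pos \o V q) T - prim (pos \o V q) q')) -
   (prim (pos \o V q) q' - prim (pos \o V q) q).
  by rewrite /Bt; ring.
rewrite (le_trans (ler_normB _ _))//.
have := h2 _ q'2; have : `|prim (pos \o V q') T - prim (pos \o V q') q'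
   - (prim (pos \o V q) T - prim (pos \o V q) q')| <= e / 2.
  apply: (@le_trans _ _ (e / 2 / T * (T - q'))).
    apply: prim_dist => //; first exact: ltW.
    move=> s s0 sq; rewrite (le_trans (posL _ _))// mul1r.
    by apply: h1 => //; rewrite ger0_norm//; lra.
  rewrite -[leRHS](@divfK _ T) ?gt_eqF// ler_wpM2l ?divr_ge0 ?(ltW e0) ?(ltW T0)//; lra.
lra.
Qed.

Let prim_pos_mono q x y : x <= y -> prim (pos \o V q) x <= prim (pos \o V q) y.
Proof. by move=> xy; apply: prim_ge0 => // s _ _; exact: pos0. Qed.

Let prim_pos_eq q x y : x <= y -> (forall s, x <= s -> s <= y -> V q s <= l) ->
  prim (pos \o V q) y = prim (pos \o V q) x.
Proof.
move=> xy h; apply/eqP; rewrite -subr_eq0 -normr_le0 -(mul0r (y - x)).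
apply: prim_norm_le_cst => // s xs sy.
by rewrite normr_le0 /= /pos; apply/eqP/max_idPr; rewrite subr_le0 h.
Qed.

(** For a fixed constant g0 the area over [0, q] tends to 0 with q, so reaching - K forces gam q >
    g0. With g0 chosen large, w_q lies above a steep line up to the point 2. *)
Let small_q : exists2 q0 : R, 0 < q0 <= 1 / 2 & L < Bt 2 q0.
Proof.
have [K_gt0 k_gt0 L_gt0 l_gt0] := And4 K0 k0 L0 l0.
(* From x = 3/2 on, where x - q >= 1, the line of slope p exceeds l by at least 2 L + 1; the
   interval [3/2, 2] alone then contributes more than L. *)
pose p := k + l + 2 * L + 1.
have p0 : 0 < p by rewrite /p; lra.
pose g0 := p / a + pi (- k) + M * (p * 2) + H 2.
have [d d0 hd] := @W_cvg 0 g0 1 1 ltr01.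
have [C C0 hC] := continuous_bounded 0 1 (@cW 0 g0).
pose D := C + 1 + k; have D0 : 0 < D by rewrite /D; lra.
(* The first bound keeps [W q g0] within 1 of [W 0 g0], so that D bounds |w + k|; the second makes D
   q < K; the third gives q + 1 <= 3/2. *)
pose q := Num.min (Num.min (d / 2) (K / D / 2)) (1 / 2).
have q0 : 0 < q by rewrite !lt_min !divr_gt0.
have qd : q <= d / 2 by rewrite !ge_min lexx.
have qK : q <= K / D / 2 by rewrite !ge_min lexx orbT.
have q12 : q <= 1 / 2 by rewrite !ge_min lexx !orbT.
exists q; first by rewrite q0.
have hA : `|A q g0| < K.
  apply: (@le_lt_trans _ _ (D * (q - 0))).
    rewrite -[A q g0]subr0 -[X in _ - X](prim0 (fun x => W q g0 x + k)).
    apply: prim_norm_le_cst => //; first exact: ltW.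
    move=> x x0 xq; have := hd q g0; rewrite subr0 subrr normr0 gtr0_norm//.
    move=> /(_ _ d0 x) h; have {h} : `|W q g0 x - W 0 g0 x| <= 1.
      by apply: h; [lra|rewrite ger0_norm//; lra].
    have := hC x x0 _; move=> /(_ _) h1; have {h1} : `|W 0 g0 x| <= C by apply: h1; lra.
    move=> /ler_normE[h1 h2] /ler_normE[h3 h4].
    by rewrite ler_norml /D; lra.
  rewrite subr0 mulrC -ltr_pdivlMr//.
  by apply: (le_lt_trans qK); have : 0 < K / D by [rewrite divr_gt0]; lra.
have g0g : g0 < gam q.
  by apply: (A_inj q0); rewrite (A_gam q0); move: hA; rewrite ltr_norml; lra.
have dv s : is_derive s 1 (fun s => - k + p * (s - q)) p.
  have ? : is_derive s 1 (fun s => p * (s - q)) p.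
    rewrite -[X in is_derive _ _ _ X]mulr1; apply: is_deriveZ.
    by rewrite -[X in is_derive _ _ _ X]subr0; exact: is_deriveB.
  by rewrite -[X in is_derive _ _ _ X]add0r; exact: is_deriveD.
have hV x : q <= x -> x <= 2 -> - k + p * (x - q) <= V q x.
  move=> qx x2.
  apply: (subsolution_le a0 piM (Wode q (gam q)) qx (is_derive_continuous dv) dv); last first.
    by rewrite Wq subrr mulr0 addr0.
  move=> s qs sx; have s0 : 0 < s := lt_trans q0 qs.
  have e : p = a * (p / a) by rewrite mulrC divfK ?gt_eqF.
  rewrite {1}e ler_pM2l//; have := H_incr (ltW s0) (lt_le_trans sx x2).
  have := piM (- k + p * (s - q)) (- k).
  rewrite addrAC subrr add0r normrM (gtr0_norm p0) gtr0_norm ?subr_gt0//.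
  have : M * (p * (s - q)) <= M * (p * 2) by rewrite !ler_pM2l//; lra.
  by have := ler_norm (pi (- k + p * (s - q)) - pi (- k)); move: g0g; rewrite /g0; lra.
have : prim (pos \o V q) q <= prim (pos \o V q) (3 / 2) by apply: prim_pos_mono; lra.
have := @continuous_derivative_le R (fun x => (2 * L + 1) * x) (prim (pos \o V q))
  (fun=> 2 * L + 1) (pos \o V q) (3 / 2) 2.
move=> h1 h2.
have : (2 * L + 1) * 2 - (2 * L + 1) * (3 / 2) <= prim (pos \o V q) 2 - prim (pos \o V q) (3 / 2).
  apply: h1.
  - lra.
  - by move=> x; apply: cvgM; [exact: cvg_cst|exact: cvg_id].
  - exact: continuous_prim.
  - by move=> x _ _; rewrite -[X in is_derive _ _ _ X]mulr1; exact: is_deriveZ.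
  - by move=> x _ _; exact: is_derive_prim.
  - move=> x x1 x2 /=; rewrite le_max; apply/orP; left.
    have := hV x _ _; have : p <= p * (x - q) by rewrite ler_pMr//; lra.
    move=> h3 h4; have {h4} := h4 _ _; rewrite /p in h3 *.
    move=> h4; have {h4} : - k + p * (x - q) <= V q x by apply: h4; lra.
    by rewrite /p; lra.
by rewrite /Bt; lra.
Qed.

(** Otherwise H (2^(n+1)) - H (2^n) <= C / 2^(n+1) for all n, so H (2^n) + C / 2^n does not increase
    and H stays bounded. *)
Let H_jump (C : R) : 0 < C -> exists2 q : R, 1 <= q & C < (H q - H (q / 2)) * q.
Proof.
move=> C0; apply: contrapT => hn.
have hq q : 1 <= q -> (H q - H (q / 2)) * q <= C.
  by move=> q1; rewrite leNgt; apply/negP => h; apply: hn; exists q.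
have p1 n : (1 : R) <= 2 ^+ n by rewrite exprn_ege1// ler1n.
have p0 n : (0 : R) < 2 ^+ n by rewrite exprn_gt0.
have ih n : H (2 ^+ n) + C / 2 ^+ n <= H 1 + C.
  elim: n => [|n ih]; first by rewrite expr0 divr1.
  apply: le_trans ih.
  have := hq (2 ^+ n.+1) (p1 _).
  have -> : (2 : R) ^+ n.+1 / 2 = 2 ^+ n by rewrite exprS; field.
  rewrite -ler_pdivlMr//.
  have -> : C / 2 ^+ n = C / 2 ^+ n.+1 + C / 2 ^+ n.+1.
    by rewrite exprS; field; rewrite gt_eqF.
  lra.
have [x x0 hx] := H_unbounded (H 1 + C).
pose n := (Num.truncn x).+1.
have xn : x < 2 ^+ n.
  rewrite (lt_le_trans (truncnS_gt x))//.
  by rewrite -natrX ler_nat ltnW// ltn_expl.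
have := ih n; have := H_incr x0 xn; have : 0 <= C / 2 ^+ n by rewrite divr_ge0 ?ltW.
lra.
Qed.

(** If w exceeded l after q, it would have w' q > 0 and increase up to the value - k on [0, q]. The
    area K then gives w + k >= - 4 K / q at q / 4, so some y between q / 4 and q / 2 has slope at
    most 16 K / q^2. Subtracting the equation at y from w' q > 0 bounds a (H q - H y) q by 16 K + 4
    a M K, against the choice of q. *)
Let large_q : exists2 q1 : R, 1 <= q1 & forall T, q1 <= T -> Bt T q1 = 0.
Proof.
have [K_gt0 k_gt0 L_gt0 l_gt0] := And4 K0 k0 L0 l0.
pose C := (16 * K + 4 * (a * M) * K) / a.
have C0 : 0 < C.
  by rewrite divr_gt0// addr_gt0// ?mulr_gt0.
have [q q1 hq] := H_jump C0; have q0 : 0 < q := lt_le_trans ltr01 q1.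
exists q => // T qT.
suff hV x : q <= x -> V q x <= l.
  by rewrite /Bt (prim_pos_eq qT) ?subrr// => s qs _; exact: hV.
rewrite le_eqVlt => /predU1P[<-|qx]; first by rewrite /V Wq; lra.
rewrite leNgt; apply/negP => Vx.
have dq : 0 < gam q - pi (V q q) - H q.
  rewrite ltNge; apply/negP => h.
  have := solution_decreasing a0 M0 piM H_incr (Wode q (gam q)) (ltW q0) h (lexx q) qx.
  by move: Vx; rewrite /V Wq; lra.
have Vincr y z : 0 <= y -> y < z -> z <= q -> V q y < V q z.
  by move=> y0 yz zq; apply: (solution_increasing a0 M0 piM H_incr (Wode q (gam q)) y0 yz zq (ltW dq)).
have Vk y : 0 <= y -> y <= q -> V q y <= - k.
  move=> y0; rewrite le_eqVlt => /predU1P[->|yq]; first by rewrite /V Wq.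
  by rewrite -(Wq q (gam q)) ltW// Vincr.
have V4 : - (4 * K / q) <= V q (q / 4) + k.
  have hA := A_gam q0.
  have h1 : A q (gam q) - prim (fun x => V q x + k) (q / 4) <= 0 - 0.
    apply: (@prim_le R _ (fun=> 0) (fun=> 0)) => //.
    - lra.
    - by move=> ?; exact: cvg_cst.
    - by move=> y y1 y2; have : V q y <= - k by [apply: Vk; lra]; rewrite /V; lra.
  have h2 : prim (fun x => V q x + k) (q / 4) - prim (fun x => V q x + k) 0 <=
     (V q (q / 4) + k) * (q / 4) - (V q (q / 4) + k) * 0.
    apply: (@prim_le R _ (fun x => (V q (q / 4) + k) * x) (fun=> V q (q / 4) + k)) => //.
    - exact: cWk.
    - lra.
    - by move=> ?; apply: cvgM; [exact: cvg_cst|exact: cvg_id].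
    - by move=> y _ _; rewrite -[X in is_derive _ _ _ X]mulr1; exact: is_deriveZ.
    - by move=> y y1 y2; rewrite lerD2r ltW// Vincr//; lra.
  rewrite prim0 mulr0 in h2.
  rewrite lerNl ler_pdivlMr//; lra.
have [y y12 hy] : exists2 y, y \in `]q / 4, q / 2[%R & V q (q / 2) - V q (q / 4) =
    a * (gam q - pi (V q y) - H y) * (q / 2 - q / 4).
  apply: (@MVT R (V q) (fun y => a * (gam q - pi (V q y) - H y))); first by lra.
    by move=> y _; exact: Wode.
  by apply: continuous_subspaceT; exact: cW.
move: y12; rewrite in_itv/= => /andP[y1 y2].
have Vq2 : V q (q / 2) <= - k by apply: Vk; lra.
have V4y : V q (q / 4) <= V q y by rewrite ltW// Vincr//; lra.
have Vy : V q y <= - k by apply: Vk; lra.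
have Hy : H y < H (q / 2) by apply: H_incr; lra.
have qq : q - q / 2 = q / 2 by field.
have dy : a * (gam q - pi (V q y) - H y) * q <= 16 * K / q.
  have e : 4 * (4 * K / q) = 16 * K / q by field; rewrite gt_eqF.
  by rewrite -e; move: hy V4 Vq2; lra.
have py : pi (V q y) - pi (- k) <= M * (4 * K / q).
  apply: (le_trans (ler_norm _)); apply: (le_trans (piM _ _)).
  rewrite ler_pM2l// opprK ler_norml; have : 0 < 4 * K / q by rewrite !divr_gt0 ?mulr_gt0.
  by move: V4; lra.
have K16 : 16 * K / q <= 16 * K by rewrite ler_pdivrMr// ler_peMr// mulr_ge0// ltW.
have hC : C * a = 16 * K + 4 * (a * M) * K by rewrite /C divfK// gt_eqF.
have h0 : 0 < a * (gam q - pi (V q q) - H q) * q by rewrite !mulr_gt0.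
rewrite {1}/V Wq in h0.
have h3 : (pi (V q y) - pi (- k)) * q <= M * (4 * K).
  have := ler_wpM2r (ltW q0) py.
  by have -> : M * (4 * K / q) * q = M * (4 * K) by field; rewrite gt_eqF.
have h4 : (H q - H (q / 2)) * q <= (H q - H y) * q.
  by rewrite ler_wpM2r ?(ltW q0)//; lra.
have h5 : a * (pi (V q y) - pi (- k)) * q <= a * M * (4 * K).
  by rewrite -!mulrA ler_pM2l.
have h6 : C * a < a * ((H q - H y) * q).
  by rewrite mulrC ltr_pM2l// (lt_le_trans hq).
move: h0 dy h5 h6; rewrite hC; lra.
Qed.

(** Otherwise w >= l wherever w' <= 0. Then either w turns down and stays in a bounded range above
    l, or it increases for ever, past l or not. The unboundedness of H excludes the first and last
    cases, the bound L on the areas the middle one. *)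
Let reach_below q : 0 < q -> (forall T, q <= T -> Bt T q <= L) ->
  exists T, [/\ q < T, V q T < l & gam q - pi (V q T) - H T < 0].
Proof.
have [K_gt0 k_gt0 L_gt0 l_gt0] := And4 K0 k0 L0 l0.
move=> q0 hB.
have hw := Wode q (gam q); rewrite -/(V q) in hw.
suff [T1 [qT VT1 dT1]] : exists T, [/\ q <= T, V q T < l & gam q - pi (V q T) - H T <= 0].
  (* One unit further the derivative is strictly negative: otherwise [solution_below] would place w
     T1 below w (T1 + 1). Strictness makes the condition stable under a change of q. *)
  exists (T1 + 1); have T10 : 0 <= T1 by rewrite (le_trans (ltW q0)).
  have h : V q (T1 + 1) < V q T1.
    by apply: (solution_decreasing a0 M0 piM H_incr hw T10 dT1) => //; rewrite ltrDl.
  split; [lra|lra|].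
  rewrite ltNge; apply/negP => /(solution_below a0 M0 piM H_incr hw T10 (_ : T1 < T1 + 1)).
  by rewrite ltrDl ltr01 => /(_ isT); lra.
apply: contrapT => hn.
have {}hn T : q <= T -> V q T < l -> 0 < gam q - pi (V q T) - H T.
  by move=> qT VT; rewrite ltNge; apply/negP => h; apply: hn; exists T.
(* While w stays in [C1, C2], pi is bounded along it and the growth of H eventually makes the slope
   less than -1. *)
have unbounded C1 C2 : exists2 x, q < x & forall y, x <= y ->
    C1 <= V q y -> V q y <= C2 -> a * (gam q - pi (V q y) - H y) < - 1.
  have [x x0 hx] := H_unbounded (gam q - pi 0 + M * (`|C1| + `|C2|) + 1 / a).
  exists (Num.max x q + 1); first by rewrite ltr_pwDr// le_max lexx orbT.
  move=> y xy V1 V2; have xy' : x < y.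
    by apply: lt_le_trans xy; rewrite ltr_pwDr// le_max lexx.
  have := H_incr x0 xy'; have := piM 0 (V q y).
  rewrite sub0r normrN.
  have : `|V q y| <= `|C1| + `|C2|.
    have := ler_norm C2; have := ler_norm (- C1); have := normr_ge0 C1; have := normr_ge0 C2.
    by rewrite normrN ler_norml; lra.
  move=> h1 h2 h3; have := ler_wpM2l (ltW M0) h1; have := ler_norm (pi 0 - pi (V q y)) => h4 h5.
  have e : - 1 = a * (- (1 / a)) by field; rewrite gt_eqF.
  by rewrite e ltr_pM2l//; lra.
have go_down x : q < x -> (forall y, x <= y -> a * (gam q - pi (V q y) - H y) < - 1) ->
    forall C, exists2 y, x <= y & V q y < C.
  move=> qx hx C; pose y := x + `|V q x| + `|C| + 1.
  have xy : x <= y by rewrite /y; have := normr_ge0 C; have := normr_ge0 (V q x); lra.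
  exists y => //.
  have := @continuous_derivative_le R (V q) (fun s => -1 * s)
    (fun s => a * (gam q - pi (V q s) - H s)) (fun=> - 1) x y xy (@cW q (gam q)).
  move=> h; have : V q y - V q x <= -1 * y - -1 * x.
    apply: h.
    - by move=> s; apply: cvgM; [exact: cvg_cst|exact: cvg_id].
    - by move=> s _ _; exact: hw.
    - by move=> s _ _; rewrite -[X in is_derive _ _ _ X]mulr1; exact: is_deriveZ.
    - by move=> s xs _; exact/ltW/hx/ltW.
  rewrite /y; have := ler_norm (- C); rewrite normrN.
  by have := ler_norm (V q x); lra.
have [[x1 qx1 dx1]|hpos] := pselect (exists2 x1, q <= x1 & gam q - pi (V q x1) - H x1 <= 0).
  have x10 : 0 <= x1 by rewrite (le_trans (ltW q0)).
  have dec x y := solution_decreasing a0 M0 piM H_incr hw x10 dx1 (x := x) (y := y).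
  have dx x : x1 <= x -> gam q - pi (V q x) - H x <= 0.
    rewrite le_eqVlt => /predU1P[<- //|x1x]; rewrite leNgt; apply/negP => /ltW h.
    have := solution_below a0 M0 piM H_incr hw x10 x1x h; have := dec x1 x (lexx _) x1x.
    lra.
  have Vl x : x1 <= x -> l <= V q x.
    move=> x1x; rewrite leNgt; apply/negP => h.
    by have := hn x (le_trans qx1 x1x) h; have := dx x x1x; lra.
  have [x qx hx] := unbounded l (V q x1).
  have [||y xy] := go_down (Num.max x x1) _ _ l.
  - by rewrite lt_max qx.
  - move=> y; rewrite ge_max => /andP[xy x1y]; apply: hx => //; first exact: Vl.
    by move: x1y; rewrite le_eqVlt => /predU1P[-> //|h]; exact/ltW/dec.
  by rewrite ltNge Vl// (le_trans _ xy)// le_max lexx orbT.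
have {}hpos x : q <= x -> 0 < gam q - pi (V q x) - H x.
  by move=> qx; rewrite ltNge; apply/negP => h; apply: hpos; exists x.
have inc x y : q <= x -> x < y -> V q x < V q y.
  move=> qx xy; apply: (solution_increasing a0 M0 piM H_incr hw _ xy (lexx y)).
    by rewrite (le_trans (ltW q0)).
  by rewrite ltW// hpos// (le_trans qx)// ltW.
have [[x2 qx2 Vx2]|hle] := pselect (exists2 x, q <= x & l < V q x).
  pose c := V q x2 - l; have c0 : 0 < c by rewrite subr_gt0.
  pose T := x2 + (L + 1) / c.
  have x2T : x2 <= T by rewrite lerDl divr_ge0// ?ltW// addr_gt0.
  have := hB T (le_trans qx2 x2T); rewrite leNgt => /negP; apply.
  have : prim (pos \o V q) q <= prim (pos \o V q) x2 by exact: prim_pos_mono.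
  have := @continuous_derivative_le R (fun x => c * x) (prim (pos \o V q))
    (fun=> c) (pos \o V q) x2 T x2T => h1 h2.
  have : c * T - c * x2 <= prim (pos \o V q) T - prim (pos \o V q) x2.
    apply: h1.
    - by move=> x; apply: cvgM; [exact: cvg_cst|exact: cvg_id].
    - exact: continuous_prim.
    - by move=> x _ _; rewrite -[X in is_derive _ _ _ X]mulr1; exact: is_deriveZ.
    - by move=> x _ _; exact: is_derive_prim.
    - move=> x x2x _ /=; rewrite le_max; apply/orP; left.
      by rewrite lerD2r; apply/ltW/inc.
  have -> : c * T - c * x2 = L + 1.
    by rewrite /T mulrDr addrAC subrr add0r mulrC divfK// gt_eqF.
  rewrite /Bt; lra.
have [x qx hx] := unbounded (- k) l.
have h := hx x (lexx x) _ _.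
have : a * (gam q - pi (V q x) - H x) < - 1.
  apply: h; first by rewrite -(Wq q (gam q)); exact/ltW/inc.
  by rewrite leNgt; apply/negP => h; apply: hle; exists x => //; exact: ltW.
have : 0 < a * (gam q - pi (V q x) - H x) by rewrite mulr_gt0// hpos// ltW.
lra.
Qed.

Lemma free_boundary_exists : exists q Q S xs : R,
  [/\ [/\ 0 < q, q < Q, Q < xs & xs < S],
      V q Q = l /\ V q S = l,
      prim (fun x => V q x - l) S - prim (fun x => V q x - l) Q = L,
      forall x y, 0 <= x -> x < y -> y <= xs -> V q x < V q y
    & forall x y, xs <= x -> x < y -> V q y < V q x].
Proof.
have [K_gt0 k_gt0 L_gt0 l_gt0] := And4 K0 k0 L0 l0.
have [q0 /andP[q00 q012] Bq0] := small_q.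
have [q1 q11 Bq1] := large_q.
(* The bound q0 keeps the infimum positive; [A_gam] is available only for q > 0. *)
pose A' := [set q : R | q0 <= q /\ forall T : R, q <= T -> Bt T q <= L].
have A'q1 : A' q1.
  by split; [rewrite (le_trans q012)//; lra|move=> T qT; rewrite Bq1// ltW].
have hA : has_inf A' by split; [exists q1|exists q0 => x []].
pose q := inf A'.
have q0q : q0 <= q by apply: lb_le_inf; [exists q1|move=> x []].
have q_gt0 : 0 < q := lt_le_trans q00 q0q.
have A'q : A' q.
  split=> // T; rewrite le_eqVlt => /predU1P[<-|qT]; first by rewrite /Bt subrr ltW.
  apply/ler_addgt0Pr => e e0; have [d d0 hd] := Bt_cvg q_gt0 qT e0.
  have dT : 0 < Num.min d (T - q) by rewrite lt_min d0 subr_gt0.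
  have [q' A'q' q'q] := inf_adherent dT hA.
  have qq' : q <= q' by apply: ge_inf => //; exists q0 => x [].
  move: q'q; rewrite -/q -ltrBlDl lt_min => /andP[h1 h2].
  have := hd q' _; rewrite ger0_norm ?subr_ge0// => /(_ h1) /ler_normE[h3 _].
  have := A'q'.2 T _; have : q' <= T by lra.
  by move=> q'T /(_ q'T); lra.
(* The infimum belongs to the set and q0 does not, which leaves room for the competitor q' < q
   below. *)
have {}q0q : q0 < q.
  rewrite lt_neqAle q0q andbT; apply/eqP => e.
  have q2 : q0 <= 2 by lra.
  by move: A'q => [_ /(_ 2)]; rewrite -e => /(_ q2); rewrite leNgt Bq0.
have [T [qT VT dT]] := reach_below q_gt0 A'q.2.
have T0 : 0 < T := lt_trans q_gt0 qT.
have hw := Wode q (gam q); rewrite -/(V q) in hw.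
have decT x y := solution_decreasing a0 M0 piM H_incr hw (ltW T0) (ltW dT) (x := x) (y := y).
(* If the area were less than L, then for q' slightly less than q the area up to T is still less
   than L, and w_q' is still below l and decreasing at T. It stays below l afterwards and adds no
   area, so q' belongs to the set, against the infimum. *)
have BtT : Bt T q = L.
  apply/eqP; rewrite eq_le A'q.2 ?(ltW qT)//= leNgt; apply/negP => BL.
  have e1 : 0 < (L - Bt T q) / 2 by rewrite divr_gt0// subr_gt0.
  have [d1 d10 hd1] := Bt_cvg q_gt0 qT e1.
  have e2 : 0 < (l - V q T) / 2 by rewrite divr_gt0// subr_gt0.
  have e3 : 0 < - (gam q - pi (V q T) - H T) by rewrite oppr_gt0.
  have e4 : 0 < - (gam q - pi (V q T) - H T) / M / 4 by rewrite !divr_gt0.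
  have e5 : 0 < - (gam q - pi (V q T) - H T) / 4 by rewrite !divr_gt0.
  have [d2 d20 hd2] := V_cvg T q_gt0 e2.
  have [d3 d30 hd3] := gam_cvg q_gt0 e5.
  have [d4 d40 hd4] := V_cvg T q_gt0 e4.
  pose d := Num.min (Num.min d1 d2) (Num.min d3 d4).
  have d0 : 0 < d by rewrite !lt_min d10 d20 d30.
  pose q' := Num.max (q - d / 2) ((q0 + q) / 2).
  have q'q : q' < q by rewrite gt_max; apply/andP; split; lra.
  have q0q' : q0 < q' by rewrite lt_max; apply/orP; right; lra.
  have q'd : `|q' - q| < d.
    have : q - d / 2 <= q' by rewrite le_max lexx.
    by rewrite ltr_norml; lra.
  move: (q'd); rewrite !lt_min => /andP[/andP[q'1 q'2] /andP[q'3 q'4]].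
  have TT : `|T| <= T by rewrite ger0_norm// ltW.
  have VT' : V q' T < l by have /ler_normE[] := hd2 _ q'2 _ TT; lra.
  have dT' : gam q' - pi (V q' T) - H T < 0.
    have := ltW (hd3 _ q'3) => /ler_normE[_ h1].
    have := piM (V q' T) (V q T) => /ler_normE[h2 _].
    have h3 := ler_wpM2l (ltW M0) (hd4 _ q'4 _ TT).
    have e : M * (- (gam q - pi (V q T) - H T) / M / 4) = - (gam q - pi (V q T) - H T) / 4.
      by field; rewrite gt_eqF.
    rewrite e in h3; lra.
  have BL' : Bt T q' < L by have /ler_normE[] := hd1 _ q'1; lra.
  have q'T : q' < T := lt_trans q'q qT.
  have hw' := Wode q' (gam q'); rewrite -/(V q') in hw'.
  suff A'q' : A' q'.
    have : q <= q' by apply: ge_inf => //; exists q0 => x [].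
    by rewrite leNgt q'q.
  split=> [|x q'x]; first exact: ltW.
  have [xT|Tx] := leP x T.
    apply: le_trans (ltW BL'); rewrite /Bt lerD2r; exact: prim_pos_mono.
  apply: le_trans (ltW BL'); rewrite /Bt lerD2r (prim_pos_eq (ltW Tx))//.
  move=> s; rewrite le_eqVlt => /predU1P[<- _|Ts _]; first exact: ltW.
  have := solution_decreasing a0 M0 piM H_incr hw' (ltW T0) (ltW dT') (lexx T) Ts.
  lra.
have cV : continuous (V q) by exact: cW.
(* The maximum exceeds l because the area is positive, and the values at q and T are below l; so it
   is interior, w' vanishes there, and it separates the increasing branch from the decreasing
   one. *)
have [xs xsT xsmax] := EVT_max (ltW qT) (continuous_subspaceT cV).
move: xsT; rewrite in_itv/= => /andP[qxs xsT].
have Vxs : l < V q xs.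
  rewrite ltNge; apply/negP => h.
  have := BtT; rewrite /Bt (prim_pos_eq (ltW qT)) ?subrr; first lra.
  move=> s qs sT; apply: le_trans h; apply: xsmax; rewrite in_itv/= qs//.
have Vqk : V q q = - k by exact: Wq.
have {}qxs : q < xs.
  by rewrite lt_neqAle qxs andbT; apply/eqP => e; move: Vxs; rewrite -e Vqk; lra.
have {}xsT : xs < T.
  by rewrite lt_neqAle xsT andbT; apply/eqP => e; move: Vxs; rewrite e; lra.
have xs0 : 0 < xs := lt_trans q_gt0 qxs.
have dxs : gam q - pi (V q xs) - H xs = 0.
  have h1 := hw xs.
  have h2 : is_derive xs 1 (V q) 0.
    apply: (@derive1_at_max _ (V q) q T xs (ltW qT)).
    - by move=> t _; have ? := hw t; exact: ex_derive.
    - by rewrite in_itv/= qxs.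
    - by move=> t; rewrite in_itv/= => /andP[t1 t2]; apply: xsmax; rewrite in_itv/= !ltW.
  have := @derive_val _ _ _ _ _ _ _ h1; rewrite (@derive_val _ _ _ _ _ _ _ h2).
  by move=> /esym/eqP; rewrite mulf_eq0 gt_eqF//= => /eqP.
have inc x y : 0 <= x -> x < y -> y <= xs -> V q x < V q y.
  by move=> x0 xy yxs; apply: (solution_increasing a0 M0 piM H_incr hw x0 xy yxs); rewrite dxs.
have dec x y : xs <= x -> x < y -> V q y < V q x.
  by apply: (solution_decreasing a0 M0 piM H_incr hw (ltW xs0)); rewrite dxs.
have [Q Qxs VQ] : exists2 Q, Q \in `[q, xs]%R & V q Q = l.
  apply: IVT (ltW qxs) (continuous_subspaceT cV) _.
  by rewrite ge_min le_max (ltW Vxs) orbT andbT Vqk (_ : - k <= l)//; lra.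
have [S Sxs VS] : exists2 S, S \in `[xs, T]%R & V q S = l.
  apply: IVT (ltW xsT) (continuous_subspaceT cV) _.
  by rewrite ge_min le_max (ltW Vxs) (ltW VT) orbT.
move: Qxs Sxs; rewrite !in_itv/= => /andP[qQ Qxs] /andP[xsS ST].
have {}qQ : q < Q.
  by rewrite lt_neqAle qQ andbT; apply/eqP => e; move: VQ; rewrite -e Vqk; lra.
have {}Qxs : Q < xs.
  by rewrite lt_neqAle Qxs andbT; apply/eqP => e; move: VQ; rewrite e; lra.
have {}xsS : xs < S.
  by rewrite lt_neqAle xsS andbT; apply/eqP => e; move: VS; rewrite -e; lra.
exists q, Q, S, xs; split=> //.
have cVl : continuous (fun x => V q x - l).
  by apply: continuousB => // ?; exact: cvg_cst.
have Q0 : 0 < Q := lt_trans q_gt0 qQ.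
have VQS x : Q <= x -> x <= S -> l <= V q x.
  move=> Qx xS; have [xxs|xsx] := leP x xs.
    by rewrite -VQ; move: Qx; rewrite le_eqVlt => /predU1P[-> //|h]; rewrite ltW// inc// ltW.
  by rewrite -VS; move: xS; rewrite le_eqVlt => /predU1P[-> //|h]; rewrite ltW// dec// ltW.
rewrite -BtT /Bt.
rewrite (prim_pos_eq (x := S) ST); last first.
  by move=> s; rewrite le_eqVlt => /predU1P[<-|Ss _]; rewrite ?VS// -VS; exact/ltW/dec/Ss/ltW.
rewrite -(prim_pos_eq (y := Q) (ltW qQ)); last first.
  move=> s qs; rewrite le_eqVlt => /predU1P[->|sQ]; rewrite ?VQ// -VQ.
  by apply/ltW/inc => //; [rewrite (le_trans (ltW q_gt0))|exact: ltW].
apply: prim_eq => //; first by rewrite ltW// (lt_trans Qxs).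
by move=> x Qx xS /=; rewrite /pos; apply/esym/max_idPl; rewrite subr_ge0 VQS.
Qed.

End free_boundary.

(** * Measurable processes and Brownian occupation times *)

Section measurable_processes.
Context {R : realType} {d : measure_display} {T : measurableType d}.
Implicit Types (Y : R -> T -> R) (s t : R).
Local Notation mu := (@lebesgue_measure R).

Definition clip t s : R := Num.min (Num.max s 0) t.

Lemma clip_ge0 t s : 0 <= t -> 0 <= clip t s.
Proof. by move=> t0; rewrite le_min t0 le_max lexx orbT. Qed.

Lemma clip_le t s : clip t s <= t.
Proof. by rewrite ge_min lexx orbT. Qed.

Lemma clip_id t s : 0 <= s -> s <= t -> clip t s = s.
Proof. by move=> s0 st; rewrite /clip max_l// min_l. Qed.

Lemma continuous_clip t : continuous (clip t).
Proof.
move=> s; apply: (@continuous_min _ _ (fun s : R => Num.max s 0) (fun=> t)).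
  by apply: (@continuous_max _ _ (fun s : R => s) (fun=> 0)); [exact: cvg_id|exact: cvg_cst].
exact: cvg_cst.
Qed.

Lemma lebesgue_measure_segment s t : s <= t -> mu `[s, t]%classic = (t - s)%:E.
Proof.
move=> st; transitivity (if s < t then (t%:E - s%:E)%E else 0%E).
  exact: (@lebesgue_measure_itv R `[s, t]).
by move: st; rewrite le_eqVlt => /predU1P[->|->]; rewrite ?ltxx ?subrr.
Qed.

Let grid n s : R := (Num.truncn (n.+1%:R * Num.max s 0))%:R.

Let grid_nd n : {homo grid n : s t / s <= t}.
Proof.
move=> s t st; rewrite /grid ler_nat; apply: le_truncn.
by rewrite ler_wpM2l// ge_max !le_max st lexx orbT.
Qed.

Let measurable_grid n (k : nat) : measurable [set s | grid n s = k%:R].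
Proof.
have h := @nondecreasing_measurable R setT (grid n) measurableT (@grid_nd n).
by have := h measurableT [set k%:R] (measurable_set1 _); rewrite setTI.
Qed.

Let grid_cvg s : grid n s / n.+1%:R @[n --> \oo] --> Num.max s 0.
Proof.
set u := Num.max s 0; have u0 : 0 <= u by rewrite le_max lexx orbT.
have hc : u - n.+1%:R^-1 @[n --> \oo] --> u.
  by rewrite -[X in _ --> X]subr0; apply: cvgB; [exact: cvg_cst|exact: cvg_harmonic].
apply: (squeeze_cvgr _ hc (cvg_cst u)); apply: nearW => n.
have n0 : 0 < n.+1%:R :> R by rewrite ltr0n.
have /andP[h1 h2] := truncn_itv (mulr_ge0 (ltW n0) u0).
rewrite ler_pdivlMr// ler_pdivrMr// mulrBl mulVf ?gt_eqF// mulrC h1 andbT.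
rewrite lerBlDr natr1; exact: ltW.
Qed.

(** Joint measurability by sampling on the grid k / (n + 1). Clipping to [0, t] uses no value of Y
    after t, so over the sigma-algebra of time t this becomes progressive measurability. *)
Lemma measurable_clipped_process Y t : 0 <= t ->
  (forall s, 0 <= s -> s <= t -> measurable_fun setT (Y s)) ->
  (forall omega, continuous (Y ^~ omega)) ->
  measurable_fun setT (fun z : T * R => Y (clip t z.2) z.1).
Proof.
move=> t0 mY cY.
apply: (@measurable_fun_cvg _ _ _ _ (fun n z => Y (clip t (grid n z.2 / n.+1%:R)) z.1)).
  move=> n _ C mC; rewrite setTI.
  have -> : (fun z : T * R => Y (clip t (grid n z.2 / n.+1%:R)) z.1) @^-1` C =
      \bigcup_k ((Y (clip t (k%:R / n.+1%:R)) @^-1` C) `*` [set s | grid n s = k%:R]).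
    apply/seteqP; split=> [[w s] /= h|[w s] [k _ [/= h1 h2]]]; last by rewrite h2.
    by exists (Num.truncn (n.+1%:R * Num.max s 0)).
  apply: bigcupT_measurable => k; apply: measurableX; last exact: measurable_grid.
  rewrite -[X in measurable X]setTI; apply: mY => //; first exact: clip_ge0.
  exact: clip_le.
move=> [w s] _ /=.
have -> : clip t s = clip t (Num.max s 0) by rewrite /clip -maxA maxxx.
have c : {for Num.max s 0, continuous ((Y ^~ w) \o clip t)}.
  by apply: continuous_comp; [exact: continuous_clip|exact: cY].
exact: (cvg_comp _ _ (@grid_cvg s) c).
Qed.

Lemma measurable_prim_process Y t C : 0 <= t ->
  (forall s, 0 <= s -> s <= t -> measurable_fun setT (Y s)) ->
  (forall omega, continuous (Y ^~ omega)) ->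
  (forall s omega, `|Y s omega| <= C) ->
  measurable_fun setT (fun omega => prim (Y ^~ omega) t).
Proof.
move=> t0 mY cY YC.
have C0 : 0 <= C by apply: le_trans (YC 0 point).
(* Adding the bound C makes the integrand nonnegative, as Tonelli requires; C t is subtracted at the
   end. *)
pose f (z : T * R) : \bar R := ((Y (clip t z.2) z.1 + C) * \1_(`[0, t]%classic) z.2)%:E.
have f0 z : (0 <= f z)%E.
  rewrite lee_fin mulr_ge0//; have := YC (clip t z.2) z.1.
  by rewrite ler_norml; lra.
have mf : measurable_fun setT f.
  apply/measurable_EFinP; apply: measurable_funM.
    apply: measurable_funD; last exact: measurable_cst.
    exact: measurable_clipped_process.
  apply: measurableT_comp; last exact: measurable_snd.
  exact: measurable_indic.
have := @measurable_fun_fubini_tonelli_F _ _ _ _ _ mu f mf f0.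
move=> /(measurableT_comp (@fine_measurable R setT measurableT)) h.
have -> : (fun omega => prim (Y ^~ omega) t) =
    (fun omega => fine (fubini_F mu f omega) - C * t).
  apply/funext => w; rewrite /fubini_F /f /=.
  have cYC : continuous (fun s => Y s w + C).
    by move=> s; apply: cvgD; [exact: cY|exact: cvg_cst].
  have -> : (\int[mu]_y ((Y (clip t y) w + C) * \1_(`[0%R, t]%classic) y)%:E)%E =
      (\int[mu]_(y in `[0%R, t]) (Y y w + C)%:E)%E.
    rewrite [RHS]integral_mkcond; apply: eq_integral => s _.
    rewrite patchE indicE !mem_setE !in_itv/=.
    by case: andP => [[s0 st]|]; rewrite ?mulr0// mulr1 clip_id.
  rewrite -[fine _]/(\int[mu]_(y in `[0, t]) (Y y w + C)).
  rewrite RintegralD//; last 2 first.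
  - exact: continuous_itv_integrable.
  - by apply: (@continuous_itv_integrable _ (fun=> C)) => ?; exact: cvg_cst.
  rewrite prim_itv// prim0 subr0 Rintegral_cst//.
  rewrite [fine _](_ : _ = t) ?addrK//.
  by transitivity (fine (t - 0)%:E); [congr fine; exact: lebesgue_measure_segment|rewrite subr0].
by apply: measurable_funB => //; exact: measurable_cst.
Qed.

Lemma measurable_sampled_process Y t (theta : T -> R) : 0 <= t ->
  (forall s, 0 <= s -> s <= t -> measurable_fun setT (Y s)) ->
  (forall omega, continuous (Y ^~ omega)) ->
  measurable_fun setT theta ->
  (forall omega, 0 <= theta omega <= t) ->
  measurable_fun setT (fun omega => Y (theta omega) omega).
Proof.
move=> t0 mY cY mtheta htheta.
have := measurableT_comp (measurable_clipped_process t0 mY cY)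
  (measurable_fun_pair (@measurable_id _ T setT) mtheta).
rewrite (_ : _ \o _ = (fun omega => Y (theta omega) omega))//.
by apply/funext => w /=; have /andP[h1 h2] := htheta w; rewrite clip_id.
Qed.

End measurable_processes.

(** * Small translations of closed bounded sets *)

Section lebesgue_translation.
Context {R : realType}.
Local Notation mu := (@lebesgue_measure R).

Lemma lebesgue_measure_shift (u : R) (A : set R) : measurable A ->
  mu [set s | A (s + u)] = mu A.
Proof.
move=> mA; pose phi : measurableTypeR R -> measurableTypeR R := fun s => s + u.
have mphi : measurable_fun setT phi by exact: measurable_funD.
pose mphi_mixin := isMeasurableFun.Build _ _ _ _ _ mphi.
pose phi' : {mfun _ >-> _} := HB.pack phi mphi_mixin.
rewrite (_ : mu [set s | A (s + u)] = pushforward mu phi' A)//.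
apply/esym; apply: lebesgue_measure_unique => // _ [[a b] _ <-] /=.
rewrite /pushforward /phi' /=.
have -> : phi @^-1` `]a, b] = `]a - u, b - u]%classic.
  by apply/seteqP; split => s /=; rewrite /phi !in_itv/= ltrBlDr lerBrDr.
have [ab|ba] := ltP a b.
  transitivity (b%:E - a%:E)%E.
    by rewrite lebesgue_measure_itv/= lte_fin ab.
  by rewrite lebesgue_measure_itv/= lte_fin ltrD2r ab -!EFinB; congr (_%:E); ring.
by rewrite !lebesgue_measure_itv/= !lte_fin ltrD2r !ltNge ba.
Qed.

Lemma open_near_set (A : set R) (e : R) :
  open [set s | exists2 x, A x & `|s - x| < e].
Proof.
rewrite openE => s [x Ax sx]; rewrite /interior; apply/nbhs_ballP.
exists (e - `|s - x|) => /=; first by rewrite subr_gt0.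
move=> t; rewrite /ball/= => st; exists x => //.
rewrite (_ : t - x = (t - s) + (s - x)); last by ring.
by rewrite (le_lt_trans (ler_normD _ _))// (distrC t) -ltrBrDr.
Qed.

Lemma measure_near_set_cvg (A : set R) (N : R) (e : nat -> R) : closed A ->
  A `<=` `[0, N] -> (forall n, 0 < e n) -> (forall m n, (m <= n)%N -> e n <= e m) ->
  e n @[n --> \oo] --> 0 ->
  mu [set s | exists2 x, A x & `|s - x| < e n] @[n --> \oo] --> mu A.
Proof.
move=> cA AN e0 eni ecvg; pose O n := [set s | exists2 x, A x & `|s - x| < e n].
have AE : A = \bigcap_n O n.
  apply/seteqP; split => [s As n _|s sO]; first by exists s => //; rewrite subrr normr0.
  apply: cA => V /nbhs_ballP[r /= r0 hV].
  have [n _ /(_ n (leqnn n))/= nr] : \forall n \near \oo, e n < r by exact: (cvgr_lt _ ecvg).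
  have [x Ax sx] := sO n I; exists x; split => //; apply: hV.
  by rewrite /ball/=; exact: lt_trans nr.
rewrite [X in _ --> mu X]AE; apply: nonincreasing_cvg_mu.
- apply: (@le_lt_trans _ _ (mu `[- e 0%N, N + e 0%N])).
    apply: le_measure; rewrite ?inE//.
    + by apply: open_measurable; exact: open_near_set.
    + move=> s [x /AN]; rewrite /= !in_itv/= => /andP[x0 xN].
      by rewrite ltr_norml => /andP[h1 h2]; apply/andP; split; lra.
  rewrite lebesgue_measure_itv/=; case: ifP => _; rewrite ?ltry//.
- by move=> n; apply: open_measurable; exact: open_near_set.
- by rewrite -AE; exact: closed_measurable.
- move=> m n mn; apply/subsetPset => s [x Ax sx]; exists x => //.
  by rewrite (lt_le_trans sx)// eni.
Qed.

Lemma limn_einf_ge (u : nat -> \bar R) (c : \bar R) :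
  (\forall n \near \oo, (c <= u n)%E) -> (c <= limn_einf u)%E.
Proof.
move=> [N _ hN]; rewrite limn_einf_lim; apply: lime_ge; first exact: is_cvg_einfs.
exists N => // n /= Nn; apply: le_ereal_inf_tmp => _ [m /= nm <-].
exact/hN/(leq_trans Nn).
Qed.

(** A and its translate both lie in the 2 u n neighbourhood of A, so by inclusion-exclusion 2 mu A
    is at most the measure of that neighbourhood plus g n. The neighbourhoods shrink to the closed
    set A, whence mu A <= liminf g. A lower limit suffices, which is what Fatou's lemma provides. *)
Lemma closed_null_of_small_translates (A : set R) (N : R) (g : nat -> \bar R)
    (u : nat -> R) : closed A -> A `<=` `[0, N] ->
  (forall n, 0 < u n) -> (forall m n, (m <= n)%N -> u n <= u m) ->
  u n @[n --> \oo] --> 0 ->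
  (forall n, (mu (A `&` [set s | A (s + u n)%R]) <= g n)%E) ->
  limn_einf g = 0%E -> mu A = 0%E.
Proof.
move=> cA AN u0 uni ucvg hg g0.
have mA : measurable A by exact: closed_measurable.
have muA : (mu A < +oo)%E.
  apply: (@le_lt_trans _ _ (mu `[0, N])); first by apply: le_measure; rewrite ?inE.
  rewrite lebesgue_measure_itv/=; case: ifP => _; rewrite ?ltry//.
pose v n := 2 * u n.
have O_cvg : mu [set s | exists2 x, A x & `|s - x| < v n] @[n --> \oo] --> mu A.
  apply: (measure_near_set_cvg cA AN).
  - by move=> n; rewrite mulr_gt0.
  - by move=> m n mn; rewrite ler_pM2l// uni.
  - by rewrite -(mulr0 2); apply: cvgM => //; exact: cvg_cst.
have mAu n : measurable [set s | A (s + u n)].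
  have := @measurable_funD _ R R setT (fun s => s) (fun=> u n).
  move=> /(_ (@measurable_id _ _ _) (@measurable_cst _ _ _ _ _ _)) => h.
  by have := h measurableT A mA; rewrite setTI.
have key n : (mu A + mu A <= mu [set s | exists2 x, A x & (`|s - x| < v n)%R] + g n)%E.
  have e : (mu (A `|` [set s | A (s + u n)%R]) =
      mu A + mu A - mu (A `&` [set s | A (s + u n)%R]))%E.
    rewrite -[X in (_ + X - _)%E](lebesgue_measure_shift (u n) mA).
    exact: (@measureUfinl _ _ _ mu A _ mA (mAu n) muA).
  have fI : mu (A `&` [set s | A (s + u n)]) \is a fin_num.
    rewrite ge0_fin_numE//; apply: le_lt_trans muA.
    apply: le_measure; rewrite ?inE.
    - exact: (measurableI _ _ mA (mAu n)).
    - exact: mA.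
    - exact: subIsetl.
  have -> : (mu A + mu A = mu (A `|` [set s | A (s + u n)%R]) + mu (A `&` [set s | A (s + u n)%R]))%E.
    by rewrite e subeK.
  apply: leeD => //; apply: le_measure; rewrite ?inE.
  - exact: (measurableU _ _ mA (mAu n)).
  - by apply: open_measurable; exact: open_near_set.
  - move=> s [As|As]; [exists s => //|exists (s + u n) => //].
    + by rewrite subrr normr0 mulr_gt0.
    + by rewrite opprD addrA subrr add0r normrN gtr0_norm// /v; have := u0 n; lra.
have fA : mu A \is a fin_num by rewrite ge0_fin_numE.
apply/eqP; rewrite eq_le measure_ge0 andbT.
apply/lee_addgt0Pr => e e0; rewrite -leeBlDr//.
rewrite -g0; apply: limn_einf_ge.
have : \forall n \near \oo, (mu [set s | exists2 x, A x & (`|s - x| < v n)%R] < mu A + e%:E)%E.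
  have mAe : (mu A < mu A + e%:E)%E by rewrite lteDl// lte_fin.
  exact: (O_cvg _ (open_nbhs_nbhs (conj (@open_ereal_lt_ereal R (mu A + e%:E)%E) mAe))).
apply: filterS => n hn.
have h : (mu A + mu A <= (mu A + e%:E) + g n)%E.
  by apply: (le_trans (key n)); rewrite leeD2r// ltW.
rewrite leeBlDr//.
move: h; rewrite -addeA leeD2lE// addeC; exact.
Qed.

End lebesgue_translation.

Lemma continuous_extend0 (R : realType) (f : R -> R) :
  {within `[0, +oo[, continuous f} -> continuous (fun s : R => f (Num.max s 0)).
Proof.
move=> /continuous_within_itvcyP[fin f0] x.
have cmax : {for x, continuous (fun s : R => Num.max s 0)}.
  by apply: (@continuous_max _ _ (fun s : R => s) (fun=> 0)); [exact: cvg_id|exact: cvg_cst].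
have [x0|x0|->] := ltgtP x 0.
- rewrite /continuous_at (max_r (ltW x0)); apply: cvg_near_cst.
  near=> y; rewrite max_r// ltW//; near: y; exact: lt_nbhsl.
- have fx : {for Num.max x 0, continuous f}.
    by rewrite max_l ?(ltW x0)//; apply: fin; rewrite in_itv/= x0.
  exact: (@cvg_comp _ _ _ (fun s => Num.max s 0) f _ _ _ cmax fx).
- rewrite /continuous_at maxxx; apply/cvgrPdist_le => e e0.
  have /cvgrPdist_le/(_ _ e0) := f0.
  rewrite near_withinE => /nbhs_ballP[r /= r0 hr].
  apply/nbhs_ballP; exists r => //= y yr.
  have [y0|y0] := leP y 0; first by rewrite subrr normr0 ltW.
  by apply: hr => //.
Unshelve. all: by end_near. Qed.

(** * Times at which a Brownian path meets a Lipschitz curve *)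

Section brownian_motion.
Context {R : realType} {d : measure_display} {Omega : measurableType d}.
Variables (P : probability Omega R) (F : R -> set (set Omega)) (B : R -> Omega -> R).
Hypothesis hF : is_filtration F.
Hypothesis hB : is_brownian_motion P F B.
Local Notation mu := (@lebesgue_measure R).

Let W (s : R) omega := B (Num.max s 0) omega.

Let cW omega : continuous (W ^~ omega).
Proof. exact: (continuous_extend0 (@bm_continuous _ _ _ _ _ _ hB omega)). Qed.

Lemma measurable_brownian s : 0 <= s -> measurable_fun setT (B s).
Proof.
by move=> s0 _ C mC; rewrite setTI; apply: (filtration_sub hF s0); exact: (bm_adapted hB).
Qed.

Let mW s : measurable_fun setT (W s).
Proof. by apply: measurable_brownian; rewrite le_max lexx orbT. Qed.

(** The time lag is [step n ^+ 2], so that [step n] is the standard deviation of the increment. *)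
Let step n : R := n.+1%:R^-1.
Let step0 n : 0 < step n. Proof. by rewrite invr_gt0. Qed.

Let incr n s omega := W (s + step n ^+ 2) omega - W s omega.

Let small_incr_set (C N : R) n : set (Omega * R) :=
  [set z | 0 <= z.2 <= N /\ `|incr n z.2 z.1| <= C * step n ^+ 2].

Let measurable_small_incr (C N : R) n : 0 <= N -> measurable (small_incr_set C N n).
Proof.
move=> N0.
have m1 : measurable_fun setT (fun z : Omega * R => incr n (clip N z.2) z.1).
  apply: measurable_clipped_process => //.
    by move=> s _ _; exact: measurable_funB.
  move=> omega s; apply: cvgB; last exact: cW.
  apply: (@continuous_comp _ _ _ (fun s => s + step n ^+ 2) (W ^~ omega)); last exact: cW.
  by apply: cvgD; [exact: cvg_id|exact: cvg_cst].
have -> : small_incr_set C N n = (setT `*` `[0, N]%classic) `&`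
   (fun z : Omega * R => incr n (clip N z.2) z.1) @^-1` `[- (C * step n ^+ 2), C * step n ^+ 2].
  apply/seteqP; split=> [[w s] /= [/andP[s0 sN] h]|[w s] /= [[_ +] h]].
    by rewrite in_itv/= s0 sN clip_id// in_itv/= -ler_norml.
  rewrite in_itv/= => /andP[s0 sN]; split; first by rewrite /= s0.
  by move: h; rewrite clip_id// in_itv/= -ler_norml.
apply: measurableI; first exact: measurableX.
by rewrite -[X in measurable X]setTI; exact: m1.
Qed.

(** The Gaussian density is at most 1 / step n, on an interval of length 2 C (step n)^2. *)
Let incr_prob (C s : R) n : 0 <= s -> 0 <= C ->
  (P [set omega | (`|incr n s omega| <= C * step n ^+ 2)%R] <= (2 * C * step n)%:E)%E.
Proof.
move=> s0 C0; have u0 : 0 < step n ^+ 2 by rewrite exprn_gt0.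
have -> : [set omega | `|incr n s omega| <= C * step n ^+ 2] =
    (fun omega => B (s + step n ^+ 2) omega - B s omega) @^-1`
      `[- (C * step n ^+ 2), C * step n ^+ 2].
  apply/seteqP; split=> w /=; rewrite /incr /W !max_l ?in_itv/= -?ler_norml//.
  - by rewrite addr_ge0// ltW.
  - by rewrite addr_ge0// ltW.
rewrite (bm_gaussian hB)//; last by rewrite ltrDl.
rewrite addrAC subrr add0r sqrtr_sqr gtr0_norm// /normal_prob.
have sn0 : step n != 0 by rewrite gt_eqF.
apply: (@le_trans _ _ (\int[mu]_(x in `[(- (C * step n ^+ 2))%R, (C * step n ^+ 2)%R]) ((step n)^-1)%:E)%E).
  apply: ge0_le_integral => //.
  - by move=> x _; rewrite lee_fin normal_pdf_ge0.
  - apply/measurable_EFinP; apply: (measurable_funS measurableT) => //.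
    exact: measurable_normal_pdf.
  - move=> x _; rewrite lee_fin (le_trans (normal_pdf_ub _ _ sn0))//.
    rewrite /normal_peak lef_pV2 ?posrE//; last first.
      by rewrite sqrtr_gt0 mulrn_wgt0// mulr_gt0// pi_gt0.
    rewrite -[leLHS](gtr0_norm (step0 n)) -sqrtr_sqr ler_wsqrtr//.
    have p2 := pi_ge2 R; rewrite -mulrnAr ler_peMr ?(ltW u0)//.
    by rewrite (le_trans _ (_ : 2 <= pi *+ 2))//; rewrite mulr2n; lra.
rewrite integral_cst//= lebesgue_measure_segment; last first.
  by rewrite lerNl (@le_trans _ _ 0)// ?oppr_le0 mulr_ge0// ltW.
rewrite -EFinM lee_fin le_eqVlt; apply/orP; left; apply/eqP.
by field.
Qed.

(** The random Lebesgue measure of the times in [0, N] whose increment is small; by Tonelli its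
    expectation is of order [step n]. *)
Let g (C N : R) n omega : \bar R := (\int[mu]_s (\1_(small_incr_set C N n) (omega, s))%:E)%E.

Let measurable_g C N n : 0 <= N -> measurable_fun setT (g C N n).
Proof.
move=> N0; apply: (@measurable_fun_fubini_tonelli_F _ _ _ _ _ mu
  (fun z => (\1_(small_incr_set C N n) z)%:E)).
  by apply/measurable_EFinP; apply: measurable_indic; exact: measurable_small_incr.
by move=> z; rewrite lee_fin.
Qed.

Let integral_g (C N : R) n : 0 <= N -> 0 <= C ->
  (\int[P]_omega g C N n omega <= (2 * C * N * step n)%:E)%E.
Proof.
move=> N0 C0.
rewrite (@fubini_tonelli _ _ _ _ _ P mu (fun z => (\1_(small_incr_set C N n) z)%:E)); last 2 first.
- by apply/measurable_EFinP; apply: measurable_indic; exact: measurable_small_incr.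
- by move=> z; rewrite lee_fin.
apply: (@le_trans _ _ (\int[mu]_(s in `[0%R, N]) (2 * C * step n)%:E)%E); last first.
  rewrite integral_cst//= lebesgue_measure_segment// -EFinM lee_fin subr0.
  by rewrite le_eqVlt; apply/orP; left; apply/eqP; ring.
rewrite [leRHS]integral_mkcond; apply: ge0_le_integral => //.
- by move=> s _; apply: integral_ge0 => w _; rewrite lee_fin.
- apply: (@measurable_fun_fubini_tonelli_G _ _ _ _ _ P
    (fun z => (\1_(small_incr_set C N n) z)%:E)).
    by apply/measurable_EFinP; apply: measurable_indic; exact: measurable_small_incr.
  by move=> z; rewrite lee_fin.
- apply/(measurable_restrictT _ _).1 => //; exact: measurable_cst.
move=> s _; rewrite patchE mem_setE in_itv/=.
have mS : measurable [set w | small_incr_set C N n (w, s)].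
  have := measurable_ysection s (measurable_small_incr C n N0).
  by rewrite ysectionE.
have -> : (\int[P]_w (\1_(small_incr_set C N n) (w, s))%:E)%E =
   P [set w | small_incr_set C N n (w, s)].
  by rewrite -[X in P X]setIT -integral_indic.
case: ifPn => [/andP[s0 sN]|sN].
  apply: le_trans (incr_prob n s0 C0); apply: le_measure; rewrite ?inE//.
    have := mS; congr measurable; apply/seteqP; split => w /=; first by case.
    by move=> h; split=> //=; rewrite s0.
  by move=> w /= [].
rewrite (_ : [set w | _] = set0) ?measure0//.
by apply/seteqP; split => w //= -[/= h]; rewrite h in sN.
Qed.

Let g_liminf (C N : R) : 0 <= N -> 0 <= C ->
  {ae P, forall omega, limn_einf (fun n => g C N n omega) = 0%E}.
Proof.
move=> N0 C0.
have g0 n w : (0 <= g C N n w)%E by apply: integral_ge0 => s _; rewrite lee_fin.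
have l0 w : (0 <= limn_einf (fun n => g C N n w))%E.
  by apply: limn_einf_ge; apply: nearW => n.
have mlim : measurable_fun setT (fun w => limn_einf (fun n => g C N n w)).
  apply: (emeasurable_fun_cvg (fun n w => einfs (fun n => g C N n w) n)).
    by move=> n; apply: measurable_fun_einfs => m; exact: measurable_g.
  by move=> w _; rewrite limn_einf_lim; exact: is_cvg_einfs.
have int0 : (\int[P]_w `|limn_einf (fun n => g C N n w)| = 0)%E.
  apply/eqP; rewrite eq_le integral_ge0// andbT.
  under eq_integral do rewrite gee0_abs//.
  apply: le_trans (fatou P measurableT (fun n => measurable_g C n N0) (fun n w _ => g0 n w)) _.
  have cvg0 : (fun n => \int[P]_w g C N n w)%E @ \oo --> 0%E.
    apply: (squeeze_cvge (f := fun=> 0%E) (h := fun n => (2 * C * N * step n)%:E)).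
    - apply: nearW => n; rewrite integral_ge0//=; exact: integral_g.
    - exact: cvg_cst.
    - apply: cvg_EFin; first exact: nearW.
      rewrite -(mulr0 (2 * C * N)); apply: cvgM; first exact: cvg_cst.
      exact: cvg_harmonic.
  by rewrite (cvg_limn_einf_sup cvg0).1.
by have /(ae_eq_integral_abs P measurableT mlim) := int0; apply: filterS => w /(_ I).
Qed.

(** The exceptional event depends only on integers bounding C and the time horizon; the sets of
    small increments do not involve f. Hence f may be chosen path by path. *)
Lemma brownian_lipschitz_graph_null : {ae P, forall omega, forall (C : R) (f : R -> R),
  (forall s t, `|f s - f t| <= C * `|s - t|) ->
  mu.-negligible [set s | 0 <= s /\ B s omega = f s]}.
Proof.
have h : \forall omega \ae P, forall N K : nat,
    limn_einf (fun n => g K%:R N%:R n omega) = 0%E.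
  by apply/ae_foralln => N; apply/ae_foralln => K; exact: g_liminf.
apply: filterS h => w hw C f fC.
pose K := (Num.truncn `|C|).+1.
have CK : C <= K%:R by rewrite ltW// (le_lt_trans (ler_norm _))// truncnS_gt.
pose A N := [set s | 0 <= s <= N%:R /\ W s w = f s].
have AE : [set s | 0 <= s /\ B s w = f s] = \bigcup_N A N.
  apply/seteqP; split=> [s [s0 e]|s [N _ [/andP[s0 _]]]]; last by rewrite /W max_l.
  exists (Num.truncn s).+1 => //; split; last by rewrite /W max_l.
  by rewrite s0 ltW// truncnS_gt.
have cf : continuous f by exact: lipschitz_continuous fC.
have cA N : closed (A N).
  have -> : A N = `[0, N%:R]%classic `&` (fun s => W s w - f s) @^-1` [set 0].
    apply/seteqP; split=> s /=; rewrite in_itv/=.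
      by move=> [h1 ->]; rewrite subrr.
    by move=> [h1 /eqP]; rewrite subr_eq0 => /eqP.
  apply: closedI; first exact: itv_closed.
  apply: preimage_closed; last exact: closed_eq.
  by move=> s _; apply: cvgB; [exact: cW|exact: cf].
have mA N : measurable (A N) by exact: closed_measurable.
have nA N : mu (A N) = 0%E.
  apply: (@closed_null_of_small_translates R (A N) N%:R (fun n => g K%:R N%:R n w)
    (fun n => step n ^+ 2) (cA N)) => //.
  - by move=> s [/= h _]; rewrite in_itv.
  - by move=> n; rewrite exprn_gt0.
  - move=> m n mn; rewrite ler_sqr ?nnegrE ?(ltW (step0 _))//.
    by rewrite lef_pV2 ?posrE ?ltr0n// ler_nat.
  - rewrite -(mulr0 0); under eq_cvg do rewrite expr2.
    by apply: cvgM; exact: cvg_harmonic.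
  - move=> n; rewrite /g.
    have -> : (\int[mu]_s (\1_(small_incr_set K%:R N%:R n) (w, s))%:E)%E =
        mu [set s | small_incr_set K%:R N%:R n (w, s)].
      rewrite -[X in mu X]setIT -integral_indic//.
      have := measurable_xsection w (measurable_small_incr K%:R n (ler0n R N)).
      by rewrite xsectionE.
    apply: le_measure; rewrite ?inE.
    + apply: measurableI; first exact: mA.
      have := @measurable_funD _ R R setT (fun s => s) (fun=> step n ^+ 2).
      move=> /(_ (@measurable_id _ _ _) (@measurable_cst _ _ _ _ _ _)) => h.
      by have := h measurableT _ (mA N); rewrite setTI.
    + have := measurable_xsection w (measurable_small_incr K%:R n (ler0n R N)).
      by rewrite xsectionE.
    + move=> s [[h1 h2] [_ h3]]; split => //=.
      rewrite /incr h2 h3 (le_trans (fC _ _))// addrAC subrr add0r.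
      rewrite ger0_norm ?sqr_ge0// ler_wpM2r ?sqr_ge0//.
by rewrite AE; apply: negligible_bigcup => N; apply/(@negligibleP _ _ _ mu _ (mA N)); exact: nA.
Qed.

End brownian_motion.

(** * Flows with discontinuous drift *)

HB.lock Definition sup_conv (R : realType) (b : R -> R) (n : nat) (x : R) : R :=
  sup [set b y - n.+1%:R * `|x - y| | y in setT].

Section sup_convolution.
Context {R : realType}.
Variables (b : R -> R) (M : R).
Hypothesis bM : forall x, `|b x| <= M.
Implicit Types (x y : R) (n : nat).

Local Notation sup_conv := (sup_conv b).

Let has_sup_conv n x : has_sup [set b y - n.+1%:R * `|x - y| | y in setT].
Proof.
split; first by exists (b x - n.+1%:R * `|x - x|); exists x.
exists M => _ [y _ <-]; have := bM y; have : 0 <= n.+1%:R * `|x - y| by rewrite mulr_ge0.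
by rewrite ler_norml; lra.
Qed.

Let sup_conv_ub n x y : b y - n.+1%:R * `|x - y| <= sup_conv n x.
Proof. by rewrite sup_conv.unlock; apply: sup_upper_bound => //; exists y. Qed.

Let sup_conv_le n x c : (forall y, b y - n.+1%:R * `|x - y| <= c) -> sup_conv n x <= c.
Proof. by rewrite sup_conv.unlock => h; apply: ge_sup => [|_ [y _ <-]//]; case: (has_sup_conv n x). Qed.

Lemma le_sup_conv n x : b x <= sup_conv n x.
Proof. by have := sup_conv_ub n x x; rewrite subrr normr0 mulr0 subr0. Qed.

Lemma sup_conv_norm n x : `|sup_conv n x| <= M.
Proof.
have := bM x; rewrite !ler_norml => /andP[h1 h2]; apply/andP; split.
  exact: le_trans (le_sup_conv n x).
apply: sup_conv_le => y; have := bM y; have : 0 <= n.+1%:R * `|x - y| by rewrite mulr_ge0.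
by rewrite ler_norml; lra.
Qed.

Lemma sup_conv_lipschitz n x y : `|sup_conv n x - sup_conv n y| <= n.+1%:R * `|x - y|.
Proof.
wlog suff : x y / sup_conv n x - sup_conv n y <= n.+1%:R * `|x - y|.
  move=> h; rewrite ler_norml h andbT lerNl opprB distrC; exact: h.
rewrite lerBlDr; apply: sup_conv_le => z.
have := sup_conv_ub n y z; have : `|y - z| <= `|x - y| + `|x - z|.
  by rewrite (distrC x y) (le_trans _ (ler_normD _ _))// addrA subrK.
move=> /(ler_wpM2l (ler0n R n.+1)); rewrite mulrDr; lra.
Qed.

Lemma sup_conv_nonincreasing n x : sup_conv n.+1 x <= sup_conv n x.
Proof.
apply: sup_conv_le => y; apply: le_trans (sup_conv_ub n x y).
by rewrite lerB// ler_wpM2r// ler_nat.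
Qed.

(** The point u n moves because the n-th drift is evaluated along the n-th path. Points y at
    distance at least r / 2 are penalized by more than the oscillation 2 M of b, so only values of b
    near x compete. *)
Lemma sup_conv_cvg (u : nat -> R) x : {for x, continuous b} -> u @ \oo --> x ->
  sup_conv n (u n) @[n --> \oo] --> b x.
Proof.
move=> cb ux; have M0 : 0 <= M by rewrite (le_trans _ (bM 0)).
apply/cvgrPdist_le => e e0.
have /nbhs_ballP[r /= r0 hr] : \forall y \near x, `|b x - b y| <= e.
  by have := cb => /cvgr_dist_le; apply.
near=> n.
have ur : `|x - u n| < r / 2.
  by near: n; apply: cvgr_dist_lt => //; rewrite divr_gt0.
have nM : 2 * M <= n.+1%:R * (r / 2).
  rewrite -ler_pdivrMr ?divr_gt0//; near: n.
  exists (Num.truncn (2 * M / (r / 2))) => // n /= hn.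
  rewrite (le_trans (ltW (truncnS_gt _)))// ler_nat ltnS//.
rewrite ler_norml; apply/andP; split; last first.
  have := le_sup_conv n (u n); have := hr (u n); rewrite /ball/=.
  move=> /(_ _) h; have {h} : `|b x - b (u n)| <= e by apply: h; lra.
  by rewrite ler_norml; lra.
suff : sup_conv n (u n) <= b x + e by lra.
apply: sup_conv_le => y; have [yr|yr] := ltP `|u n - y| (r / 2).
  have /hr : ball x r y.
    rewrite /ball/= (_ : x - y = (x - u n) + (u n - y)); last by ring.
    by rewrite (le_lt_trans (ler_normD _ _))//; lra.
  rewrite ler_norml; have : 0 <= n.+1%:R * `|u n - y| by rewrite mulr_ge0.
  by lra.
have : n.+1%:R * (r / 2) <= n.+1%:R * `|u n - y| by rewrite ler_wpM2l.
by have := bM y; have := bM x; rewrite !ler_norml; lra.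
Unshelve. all: by end_near. Qed.

End sup_convolution.

(** The minimum of T and t as a real number, for T in [0, oo]. With T = oo it is t itself, and a
    path based there is frozen for ever. *)
Definition clamp (R : realType) (T : \bar R) (t : R) : R :=
  if (T <= t%:E)%E then fine T else t.

Section clamp.
Context {R : realType}.
Implicit Types (T : \bar R) (r s t : R).

Lemma clampy t : clamp +oo%E t = t.
Proof. by []. Qed.

Lemma clampE r t : clamp r%:E t = Num.min r t.
Proof. by rewrite /clamp lee_fin minEle. Qed.

Lemma clamp_le T t : (0 <= T)%E -> clamp T t <= t.
Proof.
by case: T => [r| |]//; rewrite ?clampE ?ge_min ?lexx ?orbT// clampy.
Qed.

Lemma clamp_ge0 T t : (0 <= T)%E -> 0 <= t -> 0 <= clamp T t.
Proof.
by case: T => [r| |]//; rewrite ?clampE ?clampy// lee_fin => r0 t0; rewrite le_min r0.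
Qed.

Lemma clamp_before T t : (0 <= T)%E -> (t%:E <= T)%E -> clamp T t = t.
Proof. by case: T => [r| |]//; rewrite ?clampE// !lee_fin => _ /min_r. Qed.

Lemma continuous_clamp T : (0 <= T)%E -> continuous (clamp T).
Proof.
case: T => [r| |]// _; last by move=> t; exact: cvg_id.
have -> : clamp r%:E = (fun t => Num.min r t) by apply/funext => t; rewrite clampE.
move=> t; apply: (@continuous_min _ _ (fun=> r) (fun s : R => s)); first exact: cvg_cst.
exact: cvg_id.
Qed.

Lemma clamp_cst T t s : (0 <= T)%E ->
  (clamp T t <= s /\ s <= t) \/ (t <= s /\ s <= clamp T t) -> clamp T s = clamp T t.
Proof.
case: T => [r| |]//; last by rewrite !clampy => _ [[h1 h2]|[h1 h2]]; apply/eqP; rewrite eq_le h1 h2.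
rewrite !clampE lee_fin => r0; case: (leP r t) => rt [[h1 h2]|[h1 h2]].
- exact: min_l.
- by rewrite min_l// (le_trans rt).
- by have -> : s = t by [apply/eqP; rewrite eq_le h1 h2]; rewrite min_r// ltW.
- by have -> : s = t by [apply/eqP; rewrite eq_le h1 h2]; rewrite min_r// ltW.
Qed.

Lemma clamp_bound T N t : (0 <= T)%E -> `|fine T| <= N -> `|t| <= N -> `|clamp T t| <= N.
Proof. by rewrite /clamp; case: ifP. Qed.

End clamp.

HB.lock Definition flow_forcing (R : realType) (beta : R -> R) (T : \bar R) (x t : R) : R :=
  x + (beta t - beta (clamp T t)).

HB.lock Definition flow_approx (R : realType) (b beta : R -> R) (T : \bar R) (x : R)
    (n : nat) (t : R) : R :=
  picard_lim (flow_forcing beta T x) (clamp T) (sup_conv b n) t.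

(* The maximal solution of y' = b(y) + beta' started at x at time T and constant
   before T, as the decreasing limit of the solutions with Lipschitz drift. *)
HB.lock Definition flow (R : realType) (b beta : R -> R) (T : \bar R) (x t : R) : R :=
  limn (fun n => flow_approx b beta T x n t).

Section flow.
Context {R : realType}.
Variables (b : R -> R) (M : R).
Hypothesis bM : forall x, `|b x| <= M.
Implicit Types (x s t : R) (n : nat).
Local Notation mu := (@lebesgue_measure R).

Variables (beta : R -> R) (T : \bar R) (x : R).
Hypothesis cbeta : continuous beta.
Hypothesis T0 : (0 <= T)%E.

Let ya := flow_approx b beta T x.
Let y := flow b beta T x.
Let f := flow_forcing beta T x.

Let M0 : 0 <= M. Proof. exact: le_trans (bM 0). Qed.

Let fE t : f t = x + (beta t - beta (clamp T t)).
Proof. by rewrite /f flow_forcing.unlock. Qed.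

Lemma continuous_flow_forcing : continuous f.
Proof.
rewrite (_ : f = fun t => x + (beta t - beta (clamp T t))); last exact/funext.
move=> t; apply: cvgD; first exact: cvg_cst.
apply: cvgB; first exact: cbeta.
by apply: (@continuous_comp _ _ _ (clamp T) beta); [exact: continuous_clamp|exact: cbeta].
Qed.

Let n0 n : 0 < n.+1%:R :> R. Proof. by rewrite ltr0n. Qed.

Lemma flow_approx_cvg n t :
  picard (flow_forcing beta T x) (clamp T) (sup_conv b n) m t @[m --> \oo] --> ya n t.
Proof.
rewrite /ya flow_approx.unlock; apply: (picard_cvg (L := n.+1%:R) (c := `|fine T|)) => //.
- exact: continuous_flow_forcing.
- exact: continuous_clamp.
- exact: sup_conv_lipschitz bM n.
- by move=> ? ?; exact: clamp_cst.
- by move=> ? ?; exact: clamp_bound.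
Qed.

Let cya n : continuous (ya n).
Proof.
rewrite (_ : ya n = picard_lim (flow_forcing beta T x) (clamp T) (sup_conv b n)); last first.
  by apply/funext => t; rewrite /ya flow_approx.unlock.
apply: (continuous_picard_lim (L := n.+1%:R) (c := `|fine T|)) => //.
- exact: continuous_flow_forcing.
- exact: continuous_clamp.
- exact: sup_conv_lipschitz bM n.
- by move=> ? ?; exact: clamp_cst.
- by move=> ? ?; exact: clamp_bound.
Qed.

Let c_sup_conv n : continuous (sup_conv b n).
Proof. exact: (@lipschitz_continuous R _ _ (sup_conv_lipschitz bM n)). Qed.

Let cb n : continuous (sup_conv b n \o ya n).
Proof. by move=> t; apply: continuous_comp; [exact: cya|exact: c_sup_conv]. Qed.

Let yaE n t : ya n t =
  f t + (prim (sup_conv b n \o ya n) t - prim (sup_conv b n \o ya n) (clamp T t)).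
Proof.
have e : ya n = picard_lim (flow_forcing beta T x) (clamp T) (sup_conv b n).
  by apply/funext => s; rewrite /ya flow_approx.unlock.
rewrite e; apply: (picard_limE (L := n.+1%:R) (c := `|fine T|)) => //.
- exact: continuous_flow_forcing.
- exact: continuous_clamp.
- exact: sup_conv_lipschitz bM n.
- by move=> ? ?; exact: clamp_cst.
- by move=> ? ?; exact: clamp_bound.
Qed.

Let prim_incr n s t : s <= t ->
  `|prim (sup_conv b n \o ya n) t - prim (sup_conv b n \o ya n) s| <= M * (t - s).
Proof. by move=> st; apply: prim_norm_le_cst => // u _ _; exact: sup_conv_norm. Qed.

Let ya_lipschitz n s t : `|(ya n t - f t) - (ya n s - f s)| <= M * `|t - s|.
Proof.
wlog st : s t / s <= t.
  move=> h; have [|/ltW] := leP s t; first exact: h.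
  by move=> /h; rewrite distrC (distrC s).
rewrite !yaE (addrAC (f t)) subrr add0r (addrAC (f s)) subrr add0r (ger0_norm (_ : 0 <= t - s)) ?subr_ge0//.
have [tT|Tt] := leP t%:E T.
  rewrite (clamp_before T0 tT) (clamp_before T0 (le_trans _ tT)) ?lee_fin//.
  by rewrite !subrr normr0 mulr_ge0// subr_ge0.
move: Tt; case: T T0 => [r| |]//; rewrite lee_fin lte_fin => r0 rt.
rewrite !clampE (min_l (ltW rt)); have [rs|sr] := leP r s.
  rewrite (_ : _ - _ = prim (sup_conv b n \o ya n) t - prim (sup_conv b n \o ya n) s); last by ring.
  exact: prim_incr.
rewrite subrr subr0 (le_trans (prim_incr n (ltW rt)))// ler_wpM2l// lerD2l lerN2 ltW//.
Qed.

(** The forcing need not be differentiable, but it cancels in the difference of two approximations;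
    that difference is differentiable and satisfies a Gronwall inequality with the Lipschitz
    constant n + 1 of the larger drift. *)
Let ya_nonincreasing n t : ya n.+1 t <= ya n t.
Proof.
have [tT|Tt] := leP t%:E T.
  by rewrite !yaE (clamp_before T0 tT) !subrr.
move: Tt; case E: T T0 => [r| |]//; rewrite lee_fin lte_fin => r0 rt.
pose D s := (prim (sup_conv b n.+1 \o ya n.+1) s - prim (sup_conv b n.+1 \o ya n.+1) r)
  - (prim (sup_conv b n \o ya n) s - prim (sup_conv b n \o ya n) r).
have DE s : r <= s -> ya n.+1 s - ya n s = D s.
  by move=> rs; rewrite !yaE E clampE min_l// /D; ring.
have dD s : is_derive s 1 D ((sup_conv b n.+1 (ya n.+1 s) - 0) - (sup_conv b n (ya n s) - 0)).
  have ? := is_derive_prim s (cb (n := n.+1)); have ? := is_derive_prim s (cb (n := n)).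
  have ? : is_derive s 1 (fun s => prim (sup_conv b n.+1 \o ya n.+1) s - prim (sup_conv b n.+1 \o ya n.+1) r)
    (sup_conv b n.+1 (ya n.+1 s) - 0) by exact: is_deriveB.
  have ? : is_derive s 1 (fun s => prim (sup_conv b n \o ya n) s - prim (sup_conv b n \o ya n) r)
    (sup_conv b n (ya n s) - 0) by exact: is_deriveB.
  exact: is_deriveB.
rewrite -subr_le0 DE; last exact: ltW.
apply: (@gronwall_le R D _ n.+1%:R r t (ltW rt) (is_derive_continuous dD) (fun s _ _ => dD s)).
  move=> s rs st Ds; have := DE s (ltW rs) => e.
  have := sup_conv_lipschitz bM n (ya n.+1 s) (ya n s).
  have := sup_conv_nonincreasing bM n (ya n.+1 s).
  rewrite e (gtr0_norm Ds); have := ler_norm (sup_conv b n (ya n.+1 s) - sup_conv b n (ya n s)).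
  lra.
by rewrite /D !subrr.
Qed.

Let ya_lower n t : f t - M * (t - clamp T t) <= ya n t.
Proof.
by rewrite yaE lerD2l; have := prim_incr n (clamp_le t T0); rewrite ler_norml => /andP[].
Qed.

Lemma flow_cvg t : ya n t @[n --> \oo] --> y t.
Proof.
rewrite /y flow.unlock; apply: nonincreasing_is_cvgn; first by apply/nonincreasing_seqP => n; exact: ya_nonincreasing.
by exists (f t - M * (t - clamp T t)) => _ [n _ <-].
Qed.

Lemma flow_lipschitz s t : `|(y t - f t) - (y s - f s)| <= M * `|t - s|.
Proof.
have h : `|(ya n t - f t) - (ya n s - f s)| @[n --> \oo] --> `|(y t - f t) - (y s - f s)|.
  by apply: cvg_norm; apply: cvgB; apply: cvgB; try exact: flow_cvg; exact: cvg_cst.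
rewrite -(cvg_lim _ h)//; apply: limr_le; first by apply/cvg_ex; eexists; exact: h.
exact: nearW.
Qed.

Lemma continuous_flow : continuous y.
Proof.
have -> : y = (fun t => (y t - f t) + f t) by apply/funext => t; rewrite subrK.
move=> t; apply: cvgD; last exact: continuous_flow_forcing.
exact: (@lipschitz_continuous R (fun t => y t - f t) M (fun s t => flow_lipschitz t s)).
Qed.

Lemma flow_before t : (t%:E <= T)%E -> y t = x.
Proof.
move=> tT; rewrite /y flow.unlock; apply/cvg_lim => //.
have -> : (fun n => flow_approx b beta T x n t) = (fun=> x).
  apply/funext => n; rewrite -/(ya n t) yaE (clamp_before T0 tT) subrr addr0 fE.
  by rewrite (clamp_before T0 tT) subrr addr0.
exact: cvg_cst.
Qed.

Lemma flow_integral r t (Z : set R) : T = r%:E -> r <= t -> measurable_fun setT b ->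
  mu.-negligible Z ->
  (forall s, r <= s -> s <= t -> ~ Z s -> {for y s, continuous b}) ->
  mu.-integrable `[r, t] (fun s => (b (y s))%:E) /\
  y t = x + (beta t - beta r) + \int[mu]_(s in `[r, t]) b (y s).
Proof.
move=> Tr rt mb Z0 hZ.
have yan n : \int[mu]_(s in `[r, t]) sup_conv b n (ya n s) = ya n t - f t.
  rewrite (prim_itv (@cb n) rt).
  by rewrite yaE Tr clampE (min_l rt) addrAC subrr add0r.
have my : measurable_fun `[r, t] (b \o y).
  apply: (@measurable_funS _ _ _ _ setT) => //.
  apply: measurableT_comp => //; exact: (continuous_measurable_fun continuous_flow).
have mya n : measurable_fun `[r, t] (fun s => (sup_conv b n (ya n s))%:E).
  by have /integrableP[] := @continuous_itv_integrable R _ r t (@cb n).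
have my' : measurable_fun `[r, t] (fun s => (b (y s))%:E) by exact/measurable_EFinP.
have ae_cvg : {ae mu, forall s, `[r, t]%classic s ->
    (sup_conv b n (ya n s))%:E @[n --> \oo] --> (b (y s))%:E}.
  apply: negligibleS Z0 => s /=; apply: contra_notP => nZs.
  rewrite in_itv/= => /andP[rs st]; apply: cvg_EFin; first exact: nearW.
  by apply: (sup_conv_cvg bM (hZ s rs st nZs)); exact: flow_cvg.
have ae_bd : {ae mu, forall s n, `[r, t]%classic s ->
    (`|(sup_conv b n (ya n s))%:E| <= M%:E)%E}.
  by apply: aeW => s n _; rewrite abse_EFin lee_fin sup_conv_norm.
have int_M : mu.-integrable `[r, t] (fun=> M%:E).
  by apply: (@continuous_itv_integrable R (fun=> M)) => ?; exact: cvg_cst.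
have [int_y _ lim_int] := dominated_convergence (mu := mu) (measurable_itv _) mya my' ae_cvg int_M ae_bd.
split => //.
have fin_int : (\int[mu]_(s in `[r, t]) (b (y s))%:E)%E \is a fin_num.
  exact: integrable_fin_num.
have : ya n t - f t @[n --> \oo] --> \int[mu]_(s in `[r, t]) b (y s).
  rewrite (_ : (fun n => _) = fun n => \int[mu]_(s in `[r, t]) sup_conv b n (ya n s)).
    by apply: fine_cvg; rewrite fineK.
  by apply/funext => n; rewrite yan.
have hy : ya n t - f t @[n --> \oo] --> y t - f t.
  by apply: cvgB; [exact: flow_cvg|exact: cvg_cst].
move=> /(cvg_unique _ hy) <-; first by rewrite fE Tr clampE (min_l rt); ring.
exact: Rhausdorff.
Qed.

End flow.

(** * Adaptedness and stopping times *)

Section adapted.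
Context {R : realType} {d : measure_display} {Omega : measurableType d}.
Variable F : R -> set (set Omega).
Hypothesis hF : is_filtration F.
Implicit Types (Y V : R -> Omega -> R) (t s x : R) (tau rho : Omega -> \bar R).

Definition adapted Y := forall t, 0 <= t -> measurable_wrt (F t) (Y t).

(** Each F t becomes the sigma-algebra of a measurable type, so the closure properties of measurable
    functions apply to adapted processes. *)
Lemma filtration_measurableE t : 0 <= t -> (F t).-sigma.-measurable = F t.
Proof. by move=> t0; apply: measurable_g_measurableTypeE; exact: (filtration_sigma hF). Qed.

Let measurable_wrtP t (f : Omega -> R) : 0 <= t -> measurable_wrt (F t) f <->
  measurable_fun (setT : set (g_sigma_algebraType (F t))) f.
Proof.
move=> t0; split=> h.
  by move=> _ C mC; rewrite setTI filtration_measurableE//; exact: h.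
by move=> C mC; rewrite -filtration_measurableE// -[X in _ X]setTI; exact: h.
Qed.

Let adapted_until Y t s : adapted Y -> 0 <= s -> s <= t ->
  measurable_fun (setT : set (g_sigma_algebraType (F t))) (Y s).
Proof.
move=> aY s0 st; apply/measurable_wrtP; first exact: le_trans st.
by move=> C mC; apply: (filtration_incr hF s0 st); exact: aY.
Qed.

Lemma adapted_prim Y (C : R) : adapted Y -> (forall omega, continuous (Y ^~ omega)) ->
  (forall t omega, `|Y t omega| <= C) -> adapted (fun t omega => prim (Y ^~ omega) t).
Proof.
move=> aY cY YC t t0; apply/measurable_wrtP => //.
apply: (measurable_prim_process (C := C)) => // s s0 st; exact: adapted_until.
Qed.

Lemma stopping_time_before tau t s : is_stopping_time F tau -> 0 <= s -> s <= t ->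
  F t [set omega | (tau omega <= s%:E)%E].
Proof. by move=> [_ h] s0 st; apply: (filtration_incr hF s0 st); exact: h. Qed.

Lemma measurable_before_stopping tau t s : is_stopping_time F tau -> 0 <= s -> s <= t ->
  measurable ([set omega | (tau omega <= s%:E)%E] : set (g_sigma_algebraType (F t))).
Proof.
move=> htau s0 st; rewrite filtration_measurableE; last exact: le_trans st.
exact: stopping_time_before.
Qed.

(** The sampling time lies in [0, t] and is F t-measurable: for 0 <= c < t it exceeds c exactly when
    tau does. *)
Lemma adapted_clamp Y tau : adapted Y -> (forall omega, continuous (Y ^~ omega)) ->
  is_stopping_time F tau -> adapted (fun t omega => Y (clamp (tau omega) t) omega).
Proof.
move=> aY cY htau t t0; apply/measurable_wrtP => //.
apply: (measurable_sampled_process t0) => //.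
- by move=> s s0 st; exact: adapted_until.
- apply: (measurability _ (@RGenOInfty.measurableE R)) => _ [_ [c ->] <-].
  rewrite setTI; have [ct|tc] := ltP c t; last first.
    rewrite (_ : _ @^-1` _ = set0) //; apply/seteqP; split=> w //=.
    rewrite in_itv/= andbT => h; have := clamp_le t (htau.1 w).
    by rewrite leNgt (le_lt_trans tc).
  have [c0|c0] := leP 0 c; last first.
    rewrite (_ : _ @^-1` _ = setT) //; apply/seteqP; split=> w //= _.
    by rewrite in_itv/= andbT (lt_le_trans c0)// clamp_ge0// htau.1.
  rewrite (_ : _ @^-1` _ = ~` [set w | (tau w <= c%:E)%E]).
    by apply: measurableC; apply: measurable_before_stopping => //; exact: ltW.
  apply/seteqP; split=> w /=; rewrite in_itv/= andbT; case: (tau w) (htau.1 w) => [r| |]// r0.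
  - by rewrite clampE lee_fin lt_min => /andP[cr _]; apply/negP; rewrite -ltNge.
  - by move=> /negP; rewrite clampE lee_fin -ltNge lt_min ct andbT.
- by move=> w; rewrite clamp_ge0 ?clamp_le ?htau.1.
Qed.

Lemma adapted_cst (c : R) : adapted (fun _ _ => c).
Proof. by move=> t t0; apply/measurable_wrtP. Qed.

Lemma adapted_add Y V : adapted Y -> adapted V -> adapted (fun t w => Y t w + V t w).
Proof.
move=> aY aV t t0; apply/measurable_wrtP => //; apply: measurable_funD.
- by apply/measurable_wrtP => //; exact: aY.
- by apply/measurable_wrtP => //; exact: aV.
Qed.

Lemma adapted_sub Y V : adapted Y -> adapted V -> adapted (fun t w => Y t w - V t w).
Proof.
move=> aY aV t t0; apply/measurable_wrtP => //; apply: measurable_funB.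
- by apply/measurable_wrtP => //; exact: aY.
- by apply/measurable_wrtP => //; exact: aV.
Qed.

Lemma adapted_comp Y (f : R -> R) : measurable_fun setT f -> adapted Y ->
  adapted (fun t w => f (Y t w)).
Proof.
move=> mf aY t t0 C mC.
have := aY t t0 (f @^-1` C); apply.
by rewrite -[X in measurable X]setTI; exact: mf.
Qed.

Lemma adapted_lim (Y : nat -> R -> Omega -> R) V : (forall n, adapted (Y n)) ->
  (forall t w, 0 <= t -> Y n t w @[n --> \oo] --> V t w) -> adapted V.
Proof.
move=> aY YV t t0; apply/measurable_wrtP => //.
apply: (@measurable_fun_cvg _ (g_sigma_algebraType (F t)) R setT (fun n => Y n t)).
  by move=> n; apply/measurable_wrtP => //; exact: aY.
by move=> w _; exact: YV.
Qed.

Lemma adapted_switch Y V tau : is_stopping_time F tau -> adapted Y -> adapted V ->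
  adapted (fun t w => if (tau w <= t%:E)%E then Y t w else V t w).
Proof.
move=> htau aY aV t t0; apply/measurable_wrtP => //.
apply: measurable_fun_ifT.
- apply: (measurable_fun_bool true); rewrite setTI.
  by have := measurable_before_stopping htau t0 (lexx t).
- by apply/measurable_wrtP => //; exact: aY.
- by apply/measurable_wrtP => //; exact: aV.
Qed.

Section flow.
Variables (b : R -> R) (M : R).
Hypothesis bM : forall x, `|b x| <= M.
Variables (beta : R -> Omega -> R) (tau : Omega -> \bar R) (x : R).
Hypothesis cbeta : forall omega, continuous (beta ^~ omega).
Hypothesis abeta : adapted beta.
Hypothesis htau : is_stopping_time F tau.

(** A double limit of iterates built from beta by integration, stopping at tau and composition with
    continuous functions; each operation and each pointwise limit preserves adaptedness. The level x
    is a constant. *)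
Lemma adapted_flow : adapted (fun t omega => flow b (beta ^~ omega) (tau omega) x t).
Proof.
apply: (adapted_lim (Y := fun n t w => flow_approx b (beta ^~ w) (tau w) x n t)); last first.
  by move=> t w t0; apply: (flow_cvg bM) => //; exact: htau.1.
move=> n.
apply: (adapted_lim (Y := fun m t w => picard (flow_forcing (beta ^~ w) (tau w) x)
    (clamp (tau w)) (sup_conv b n) m t)); last first.
  by move=> t w t0; apply: (flow_approx_cvg bM) => //; exact: htau.1.
have af : adapted (fun t w => flow_forcing (beta ^~ w) (tau w) x t).
  have -> : (fun t w => flow_forcing (beta ^~ w) (tau w) x t) =
      (fun t w => x + (beta t w - beta (clamp (tau w) t) w)).
    by apply/funext => t; apply/funext => w; rewrite flow_forcing.unlock.
  by apply: adapted_add; [exact: adapted_cst|apply: adapted_sub => //; exact: adapted_clamp].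
have cs : continuous (sup_conv b n).
  exact: (@lipschitz_continuous R _ _ (sup_conv_lipschitz bM n)).
have cp m w : continuous (picard (flow_forcing (beta ^~ w) (tau w) x)
    (clamp (tau w)) (sup_conv b n) m).
  apply: (continuous_picard (L := n.+1%:R)).
  - apply: continuous_flow_forcing; [exact: cbeta|exact: htau.1].
  - apply: continuous_clamp; exact: htau.1.
  - exact: (sup_conv_lipschitz bM n).
elim => [|m ih] //=.
have cY w : continuous ((fun t w => sup_conv b n (picard (flow_forcing (beta ^~ w) (tau w) x)
    (clamp (tau w)) (sup_conv b n) m t)) ^~ w).
  by move=> t; apply: (continuous_comp (@cp m w t)); exact: cs.
have ap : adapted (fun t w => prim (sup_conv b n \o picard (flow_forcing (beta ^~ w) (tau w) x)
    (clamp (tau w)) (sup_conv b n) m) t).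
  apply: (adapted_prim (C := M)) => //.
  - by apply: adapted_comp => //; exact: continuous_measurable_fun.
  - by move=> t w; exact: sup_conv_norm.
apply: adapted_add => //; apply: adapted_sub => //.
apply: (adapted_clamp (Y := fun t w => prim (sup_conv b n \o picard (flow_forcing (beta ^~ w)
  (tau w) x) (clamp (tau w)) (sup_conv b n) m) t)) => // w.
apply: continuous_prim; exact: cY.
Qed.

End flow.

End adapted.

(** * First times of sets closed under limits from the right *)

Section first_times.
Context {R : realType}.
Implicit Types (A : set R) (V : R -> R) (s t : R) (T : \bar R).

Lemma first_time_ge0 A : (0 <= first_time A)%E.
Proof. by apply: le_ereal_inf_tmp => _ [t [t0 _] <-]. Qed.

Lemma first_time_le A t : 0 <= t -> A t -> (first_time A <= t%:E)%E.
Proof. by move=> t0 At; apply: ereal_inf_lbound; exists t. Qed.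

Lemma first_time_ge A T : (forall t, 0 <= t -> A t -> (T <= t%:E)%E) ->
  (T <= first_time A)%E.
Proof. by move=> h; apply: le_ereal_inf_tmp => _ [t [t0 At] <-]; exact: h. Qed.

Lemma first_time_attained A t : (first_time A <= t%:E)%E ->
  (forall r, (forall e, 0 < e -> exists2 s, A s & r <= s < r + e) -> A r) ->
  exists2 r, first_time A = r%:E & [/\ 0 <= r, r <= t & A r].
Proof.
move=> At hA; have A0 := first_time_ge0 A.
case E : (first_time A) At A0 => [r| |]// rt r0; exists r => //; split=> //.
apply: hA => e e0.
have : (first_time A < (r + e)%:E)%E by rewrite E lte_fin ltrDl.
move=> /ereal_inf_lt[_ [s [s0 As] <-]]; rewrite lte_fin => sre; exists s => //.
by rewrite sre andbT -lee_fin -E; exact: first_time_le.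
Qed.

Lemma first_time_nonpositive V t : continuous V ->
  (first_time [set s | (V s <= 0)%R] <= t%:E)%E ->
  exists2 r, first_time [set s | V s <= 0] = r%:E & [/\ 0 <= r, r <= t & V r <= 0].
Proof.
move=> cV h; apply: first_time_attained h _ => r hr /=.
rewrite leNgt; apply/negP => Vr; have [e e0 he] := continuous_gt_near cV Vr.
have [s /= Vs /andP[rs sre]] := hr e e0.
have := he s; rewrite ger0_norm ?subr_ge0//.
by move=> /(_ _) h'; have {h'} : 0 < V s by [apply: h'; lra]; rewrite ltNge Vs.
Qed.

(** The restriction of tau to the event tau < rho, with oo elsewhere. It describes an exit through
    one of two barriers, and [after_time] plays the same part for the next jump after rho. *)
Definition before_time (tau rho : \bar R) : \bar R := if (tau < rho)%E then tau else +oo%E.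

Lemma before_time_le tau rho t : (before_time tau rho <= t%:E)%E <->
  (tau <= t%:E)%E /\ (tau < rho)%E.
Proof. by rewrite /before_time; case: ifP => //; split=> // -[]. Qed.

Definition after_time (rho tau : \bar R) : \bar R := if (rho < tau)%E then tau else +oo%E.

Lemma after_time_le rho tau t : (after_time rho tau <= t%:E)%E <->
  (tau <= t%:E)%E /\ (rho < tau)%E.
Proof. by rewrite /after_time; case: ifP => // _; split=> // -[]. Qed.

End first_times.

(** * Stopping times without right-continuity of the filtration *)

Section stopping_times.
Context {R : realType} {d : measure_display} {Omega : measurableType d}.
Variable F : R -> set (set Omega).
Hypothesis hF : is_filtration F.
Implicit Types (V : R -> Omega -> R) (t s : R) (tau rho : Omega -> \bar R).

Let FE := filtration_measurableE hF.

Let measurable_before := measurable_before_stopping hF.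

Lemma stopping_time_cst (T : \bar R) : (0 <= T)%E -> is_stopping_time F (fun=> T).
Proof.
move=> T0; split=> // t t0; rewrite -FE//.
have [h|h] := boolP (T <= t%:E)%E.
  by rewrite (_ : [set _ | _] = setT)//; apply/seteqP; split.
by rewrite (_ : [set _ | _] = set0)//; apply/seteqP; split.
Qed.

Lemma stopping_time_min tau rho : is_stopping_time F tau -> is_stopping_time F rho ->
  is_stopping_time F (fun w => mine (tau w) (rho w)).
Proof.
move=> ht hr; split=> [w|t t0]; first by rewrite le_min ht.1 hr.1.
rewrite -FE//; rewrite (_ : [set _ | _] =
    [set w | (tau w <= t%:E)%E] `|` [set w | (rho w <= t%:E)%E]).
  by apply: measurableU; exact: measurable_before.
by apply/seteqP; split=> w /=; rewrite ge_min => /orP.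
Qed.

(** A rational clipped to [0, t] witnesses tau < rho: one strictly between them if rho <= t, and
    otherwise any rational above t, which is clipped to t itself. *)
Let stopping_time_lt tau rho t : is_stopping_time F tau -> is_stopping_time F rho ->
  0 <= t -> F t [set w | [/\ (tau w <= t%:E)%E & (tau w < rho w)%E]].
Proof.
move=> ht hr t0; rewrite -FE//.
rewrite (_ : [set _ | _] = \bigcup_(q : rat)
    ([set w | (tau w <= (clip t (ratr q))%:E)%E] `&`
     ~` [set w | (rho w <= (clip t (ratr q))%:E)%E])).
  apply: bigcupT_measurable_rat => q; apply: measurableI; last apply: measurableC.
  - by apply: measurable_before => //; [exact: clip_ge0|exact: clip_le].
  - by apply: measurable_before => //; [exact: clip_ge0|exact: clip_le].
apply/seteqP; split=> w /=.
  case=> tt tr.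
  suff [q h1 h2] : exists2 q : rat, (tau w <= (clip t (ratr q))%:E)%E &
      ((clip t (ratr q))%:E < rho w)%E.
    by exists q => //; split => //; apply/negP; rewrite -ltNge.
  have [rt|tr'] := leP (rho w) t%:E.
    have := ht.1 w; case: (tau w) tr tt => [r| |]//.
    case: (rho w) rt => [p| |]//; rewrite !lee_fin lte_fin => pt rp _ r0.
    have [q] := rat_in_itvoo rp; rewrite in_itv/= => /andP[rq qp].
    have q0 : 0 <= ratr q :> R by rewrite (le_trans r0)// ltW.
    have qt : ratr q <= t by rewrite (le_trans (ltW qp)).
    by exists q; rewrite clip_id ?lee_fin ?lte_fin// ltW.
  have t1 : t < t + 1 by rewrite ltrDl.
  have [q] := rat_in_itvoo t1.
  rewrite in_itv/= => /andP[tq _]; exists q.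
  - by rewrite (_ : clip t (ratr q) = t)// /clip min_r// le_max (ltW tq).
  - by rewrite (_ : clip t (ratr q) = t)// /clip min_r// le_max (ltW tq).
case=> q _ [h1 /negP]; rewrite -ltNge => h2; split.
  by rewrite (le_trans h1)// lee_fin clip_le.
exact: le_lt_trans h2.
Qed.

Lemma stopping_time_before_time tau rho : is_stopping_time F tau ->
  is_stopping_time F rho -> is_stopping_time F (fun w => before_time (tau w) (rho w)).
Proof.
move=> ht hr; split=> [w|t t0].
  by rewrite /before_time; case: ifP => // _; exact: ht.1.
rewrite (_ : [set _ | _] = [set w | [/\ (tau w <= t%:E)%E & (tau w < rho w)%E]]).
  exact: stopping_time_lt.
by apply/seteqP; split=> w /=; rewrite before_time_le => -[].
Qed.

Lemma stopping_time_after_time rho tau : is_stopping_time F tau ->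
  is_stopping_time F rho -> is_stopping_time F (fun w => after_time (rho w) (tau w)).
Proof.
move=> ht hr; split=> [w|t t0].
  by rewrite /after_time; case: ifP => // _; exact: ht.1.
have -> : [set w | (after_time (rho w) (tau w) <= t%:E)%E] =
    [set w | (tau w <= t%:E)%E] `&` [set w | [/\ (rho w <= t%:E)%E & (rho w < tau w)%E]].
  apply/seteqP; split=> w /=; rewrite after_time_le => -[h1].
    by move=> h2; split => //; split => //; rewrite (le_trans (ltW h2)).
  by case=> _ h2.
rewrite -FE//; apply: measurableI; first exact: measurable_before.
by rewrite FE//; exact: stopping_time_lt.
Qed.

Lemma stopping_time_attained_inf (tau : nat -> Omega -> \bar R) rho :
  (forall n, is_stopping_time F (tau n)) ->
  (forall w t, (rho w <= t%:E)%E <-> exists n, (tau n w <= t%:E)%E) ->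
  (forall w, (0 <= rho w)%E) -> is_stopping_time F rho.
Proof.
move=> ht hr r0; split=> // t t0.
rewrite (_ : [set _ | _] = \bigcup_n [set w | (tau n w <= t%:E)%E]).
  by rewrite -FE//; apply: bigcupT_measurable => n; exact: measurable_before.
by apply/seteqP; split=> w /=; [move=> /hr [n h]; exists n|case=> n _ h; apply/hr; exists n].
Qed.

(** The path has hit by time t if and only if its minimum over [0, t] is nonpositive; by continuity
    this means values below 1 / (n + 1) at clipped rational times, for every n. *)
Lemma stopping_time_hitting V : adapted F V -> (forall omega, continuous (V ^~ omega)) ->
  is_stopping_time F (fun omega => first_time [set t | V t omega <= 0]).
Proof.
move=> aV cV; split=> [w|t t0]; first exact: first_time_ge0.
have -> : [set w | (first_time [set t | (V t w <= 0)%R] <= t%:E)%E] =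
    \bigcap_n \bigcup_(q : rat) [set w | V (clip t (ratr q)) w < n.+1%:R^-1].
  have cVt w : continuous ((V ^~ w) \o clip t).
    by move=> s; apply: continuous_comp; [exact: continuous_clip|exact: cV].
  apply/seteqP; split=> w /=.
    move=> /(first_time_nonpositive (@cV w))[r _ [r0 rt Vr]] n _.
    have Vr' : ((V ^~ w) \o clip t) r < n.+1%:R^-1.
      by rewrite /= clip_id// (le_lt_trans Vr)// invr_gt0.
    have [e e0 he] := continuous_lt_near (@cVt w) Vr'.
    have re : r < r + e by rewrite ltrDl.
    have [q] := rat_in_itvoo re.
    rewrite in_itv/= => /andP[rq qre]; exists q => //=.
    by apply: he; rewrite gtr0_norm ?subr_gt0//; lra.
  move=> h; have [s s0t hs] := EVT_min t0 (continuous_subspaceT (@cV w)).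
  move: s0t; rewrite in_itv/= => /andP[s0 st].
  suff Vs : V s w <= 0 by apply: le_trans (first_time_le s0 Vs) _; rewrite lee_fin.
  apply/ler_addgt0Pr => e e0; rewrite add0r.
  pose n := Num.truncn (e^-1).
  have [q _ /= hq] := h n I.
  have : V s w <= V (clip t (ratr q)) w.
    by apply: hs; rewrite in_itv/= clip_ge0// clip_le.
  move=> /le_trans; apply; rewrite (le_trans (ltW hq))// -[leRHS]invrK lef_pV2 ?posrE ?invr_gt0//.
  by rewrite ltW// truncnS_gt.
rewrite -FE//; apply: bigcapT_measurable => n; apply: bigcupT_measurable_rat => q.
rewrite FE//; apply: (filtration_incr hF (clip_ge0 _ t0) (clip_le t _)).
rewrite (_ : [set _ | _] = V (clip t (ratr q)) @^-1` `]-oo, n.+1%:R^-1[).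
  by apply: aV => //; exact: clip_ge0.
by apply/seteqP; split=> w /=; rewrite in_itv.
Qed.

End stopping_times.

(** * Impulse times and inventory paths *)

Section jump_enumeration.
Context {R : realType}.
Implicit Types (A : set R) (r s t : R).

(* T lists all jump times in increasing order; the jumps of the kind under
   consideration are those i for which u i is finite. *)
Variables (T u : nat -> \bar R).
Hypothesis T0 : T 0%N = 0%E.
Hypothesis T_le : forall i, (T i <= T i.+1)%E.
Hypothesis T_lt : forall i, (T i < +oo)%E -> (T i < T i.+1)%E.
Hypothesis T_unbounded : forall t, exists i, (t%:E < T i)%E.
Hypothesis uT : forall i, u i = T i \/ u i = +oo%E.

Definition jump_set : set R := [set t | exists i, u i = t%:E].

Definition njumps i : nat := \sum_(j < i) (u j < +oo)%E.

(** The recursion is that of the band policy, with the set of constructed jumps in place of a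
    hitting set. The value at index 0 is a dummy. *)
Fixpoint jump_time n : \bar R :=
  match n with
  | 0%N => 0%E
  | 1%N => first_time jump_set
  | m.+1 => first_time_after (jump_time m) jump_set
  end.

Lemma jump_timeS n : (0 < n)%N ->
  jump_time n.+1 = first_time_after (jump_time n) jump_set.
Proof. by case: n. Qed.

Lemma jump_times_nd i j : (i <= j)%N -> (T i <= T j)%E.
Proof.
move=> /subnK <-; elim: (j - i)%N => [//|k ih]; rewrite addSn.
exact: le_trans (T_le _).
Qed.

Lemma jump_times_ge0 i : (0 <= T i)%E.
Proof. by rewrite -T0; exact: jump_times_nd. Qed.

Lemma jump_interval t : 0 <= t -> exists i, (T i <= t%:E)%E /\ (t%:E < T i.+1)%E.
Proof.
move=> t0; have [j] := T_unbounded t; elim: j => [|j ih].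
  by rewrite T0 lte_fin ltNge t0.
by move=> tTS; have [Tt|tT] := leP (T j) t%:E; [by exists j|exact: ih].
Qed.

Let u_lt_index i j : (u i < u j)%E -> (u j < +oo)%E -> (i < j)%N.
Proof.
move=> uij ujy; rewrite ltnNge; apply/negP => ji.
have uiT : u i = T i by case: (uT i) => // e; move: uij; rewrite e ltNge leey.
have ujT : u j = T j by case: (uT j) => // e; move: ujy; rewrite e ltxx.
by move: uij; rewrite uiT ujT ltNge jump_times_nd.
Qed.

Let u_lt i j : (i < j)%N -> (u i < +oo)%E -> (u j < +oo)%E -> (u i < u j)%E.
Proof.
move=> ij uiy ujy.
have uiT : u i = T i by case: (uT i) => // e; move: uiy; rewrite e ltxx.
have ujT : u j = T j by case: (uT j) => // e; move: ujy; rewrite e ltxx.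
rewrite uiT ujT; apply: lt_le_trans (jump_times_nd ij).
by apply: T_lt; rewrite -uiT.
Qed.

Lemma jump_set_ge0 t : jump_set t -> 0 <= t.
Proof.
move=> [i ui]; have : u i = T i by case: (uT i) => //; rewrite ui.
by rewrite -lee_fin -ui => ->; exact: jump_times_ge0.
Qed.

(** Jumps are locally finite: to the right of r there is none before the next T i, so a point of A
    approached from the right already equals r and the infimum is attained. *)
Lemma first_time_jumps A t : A `<=` jump_set ->
  (first_time A <= t%:E)%E <-> exists2 s, A s & s <= t.
Proof.
move=> AJ; split=> [h|[s As st]]; last first.
  by apply: le_trans (first_time_le _ As) _; rewrite ?lee_fin//; apply/jump_set_ge0/AJ.
suff [r _ [_ rt Ar]] : exists2 r, first_time A = r%:E & [/\ 0 <= r, r <= t & A r] by exists r.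
apply: first_time_attained h _ => r hr.
have r0 : 0 <= r.
  rewrite leNgt; apply/negP => r0.
  have r0' : 0 < - r by rewrite oppr_gt0.
  have [s As /andP[_ h]] := hr _ r0'.
  by have := jump_set_ge0 (AJ _ As); rewrite leNgt; rewrite subrr in h; rewrite h.
have [i [Tir rTi]] := jump_interval r0.
have [e e0 he] : exists2 e, 0 < e & ((r + e)%:E <= T i.+1)%E.
  case: (T i.+1) rTi => [p| |]//; last by exists 1; rewrite ?leey.
  by rewrite lte_fin => rp; exists (p - r); rewrite ?subr_gt0// addrC subrK.
have [s As /andP[rs sre]] := hr e e0.
suff -> : r = s by [].
apply/eqP; rewrite eq_le rs/=.
have [j uj] := AJ _ As.
have ujT : u j = T j by case: (uT j) => //; rewrite uj.
rewrite -lee_fin -uj ujT; apply: le_trans Tir; apply: jump_times_nd.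
rewrite leqNgt; apply/negP => /jump_times_nd; rewrite leNgt => /negP; apply.
by rewrite -ujT uj; apply: lt_le_trans he; rewrite lte_fin.
Qed.

Let njumpsS i : njumps i.+1 = (njumps i + (u i < +oo)%E)%N.
Proof. by rewrite /njumps big_ord_recr. Qed.

Let njumps_nd i j : (i <= j)%N -> (njumps i <= njumps j)%N.
Proof.
move=> /subnK <-; elim: (j - i)%N => [//|k ih]; rewrite addSn njumpsS.
exact: leq_trans (leq_addr _ _).
Qed.

Let last_jump j : (0 < njumps j)%N ->
  exists i, [/\ (i < j)%N, (u i < +oo)%E & njumps i.+1 = njumps j].
Proof.
elim: j => [|j ih]; first by rewrite /njumps big_ord0.
rewrite njumpsS; have [uj _|uj] := boolP (u j < +oo)%E.
  by exists j; split=> //; rewrite njumpsS uj.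
rewrite addn0 => /ih[i [ij ui e]]; exists i; split=> //.
exact: (ltn_trans ij).
Qed.

(** Links first times to counting: the n-th jump has occurred by t when some jump i has occurred and
    at least n jumps have index at most i. *)
Lemma jump_time_leP n t : (0 < n)%N ->
  (jump_time n <= t%:E)%E <-> exists i, (u i <= t%:E)%E /\ (n <= njumps i.+1)%N.
Proof.
elim: n t => [//|[|n] ih] t _.
  rewrite first_time_jumps//; split=> [[s [i ui] st]|[i [uit _]]].
    by exists i; rewrite ui lee_fin st njumpsS ui ltry addn1.
  case E : (u i) uit => [s| |]//.
    by rewrite lee_fin; exists s => //; exists i.
  by have := jump_times_ge0 i; case: (uT i) => [<-|]; rewrite E.
rewrite jump_timeS// /first_time_after first_time_jumps; last by move=> s [].
split=> [[s [ns [i ui]] st]|[j [ujt nj]]].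
  exists i; rewrite ui lee_fin; split=> //.
  case E : (jump_time n.+1) ns => [p| |]//; last first.
    have : (0 <= jump_time n.+1)%E by case: (n) => *; exact: first_time_ge0.
    by rewrite E.
  rewrite lte_fin => ps; have : (jump_time n.+1 <= p%:E)%E by rewrite E.
  move=> /(ih p isT)[k [ukp nk]].
  have uki : (u k < u i)%E by rewrite ui (le_lt_trans ukp)// lte_fin.
  have uiy : (u i < +oo)%E by rewrite ui ltry.
  rewrite njumpsS uiy addn1 ltnS; apply: leq_trans nk _.
  exact: (njumps_nd (u_lt_index uki uiy)).
have ujy : (u j < +oo)%E by exact: le_lt_trans ujt (ltry _).
have [i [ij ui e]] : exists i, [/\ (i < j)%N, (u i < +oo)%E & njumps i.+1 = njumps j].
  by apply: last_jump; move: nj; rewrite njumpsS ujy addn1 ltnS; exact: leq_trans.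
have uij := u_lt ij ui ujy.
case Ei : (u i) ui uij => [p| |]// _ uij; last first.
  by have := jump_times_ge0 i; case: (uT i) => [<-|]; rewrite Ei.
case Ej : (u j) ujy uij ujt => [s| |]// _; rewrite lte_fin lee_fin => ps st.
exists s => //; split; last by exists j.
apply: (@le_lt_trans _ _ p%:E); last by rewrite lte_fin.
apply/(ih p isT); exists i; rewrite Ei lexx e; split=> //.
by move: nj; rewrite njumpsS Ej ltry addn1 ltnS.
Qed.

Lemma jump_time_le_count n t i : (0 < n)%N -> (T i <= t%:E)%E -> (t%:E < T i.+1)%E ->
  (jump_time n <= t%:E)%E <-> (n <= njumps i.+1)%N.
Proof.
move=> n0 Tt tT; rewrite jump_time_leP//; split=> [[j [ujt nj]]|ni].
  apply: leq_trans nj _; apply: njumps_nd; rewrite ltnS leqNgt; apply/negP => ij.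
  have ujT : u j = T j by case: (uT j) => // e; move: ujt; rewrite e leye_eq.
  have := jump_times_nd ij; rewrite -ujT leNgt => /negP; apply.
  exact: le_lt_trans tT.
have [j [ji uj e]] := last_jump (leq_trans n0 ni).
exists j; rewrite e; split=> //.
have ujT : u j = T j by case: (uT j) => // e'; move: uj; rewrite e' ltxx.
rewrite ujT; apply: le_trans Tt; apply: jump_times_nd; by rewrite -ltnS.
Qed.

Lemma jump_time_nd n : (0 < n)%N -> (jump_time n <= jump_time n.+1)%E.
Proof.
move=> n0; rewrite jump_timeS//; apply: first_time_ge => t _ [h _]; exact: ltW.
Qed.

Lemma jump_time_ge0 n : (0 <= jump_time n)%E.
Proof. by case: n => [|[|n]] //; exact: first_time_ge0. Qed.

Let finite_time i t : (u i <= t%:E)%E -> exists2 s, u i = s%:E & s <= t.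
Proof.
case E : (u i) => [s| |]//; first by rewrite lee_fin; exists s.
by have := jump_times_ge0 i; case: (uT i) => [<-|]; rewrite E.
Qed.

(** With [jump_timeS_le], this writes the events in the definition of a stopping time as countable
    unions. *)
Lemma jump_time1_le t : (jump_time 1 <= t%:E)%E <-> exists i, (u i <= t%:E)%E.
Proof.
rewrite first_time_jumps//; split=> [[s [i ui] st]|[i /finite_time[s ui st]]].
  by exists i; rewrite ui lee_fin.
by exists s => //; exists i.
Qed.

Lemma jump_timeS_le n t : (0 < n)%N ->
  (jump_time n.+1 <= t%:E)%E <-> exists i, (after_time (jump_time n) (u i) <= t%:E)%E.
Proof.
move=> n0; rewrite jump_timeS// /first_time_after first_time_jumps; last by move=> s [].
split=> [[s [ns [i ui]] st]|[i /after_time_le[/finite_time[s ui st] nu]]].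
  by exists i; apply/after_time_le; rewrite ui lee_fin.
by exists s => //; split; [rewrite -ui|exists i].
Qed.

End jump_enumeration.

(** * Exit of a flow from the band between 0 and S *)

Section exit.
Context {R : realType}.
Implicit Types (V : R -> R) (s t r : R) (T : \bar R).

Lemma first_time_zero V r : continuous V -> 0 < V 0 ->
  first_time [set s | V s <= 0] = r%:E -> V r = 0.
Proof.
move=> cV V0 Er.
have [p e [p0 _ Vp]] : exists2 p, first_time [set s | V s <= 0] = p%:E & [/\ 0 <= p, p <= r & V p <= 0].
  by apply: first_time_nonpositive => //; rewrite Er.
move: e; rewrite Er => -[] rp; rewrite -rp {p rp} in p0 Vp.
apply/eqP; rewrite eq_le Vp/= leNgt; apply/negP => Vr.
have r0 : 0 < r by rewrite lt_neqAle p0 andbT; apply/eqP => e; have := Vp; rewrite -e leNgt V0.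
have [e e0 he] := continuous_lt_near cV Vr.
pose s := Num.max 0 (r - e / 2).
have s0 : 0 <= s by rewrite le_max lexx.
have sr : s < r by rewrite gt_max r0/=; lra.
have : V s <= 0.
  apply/ltW/he; rewrite distrC ger0_norm ?subr_ge0 ?(ltW sr)//.
  have : r - e / 2 <= s by rewrite le_max lexx orbT.
  by lra.
move=> Vs; have := @first_time_le _ [set s | V s <= 0] _ s0 Vs.
by rewrite Er lee_fin leNgt sr.
Qed.

Lemma first_time_gt V T : continuous V -> (0 <= T)%E -> (T < +oo)%E ->
  (forall s, (s%:E <= T)%E -> 0 < V s) -> (T < first_time [set s | (V s <= 0)%R])%E.
Proof.
move=> cV + + h; case: T h => [r| |]// h _ _; rewrite ltNge; apply/negP.
move=> /(first_time_nonpositive cV)[s _ [_ sr]]; apply/negP; rewrite -ltNge; exact: h.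
Qed.

Lemma first_time_pos V t : 0 <= t -> (t%:E < first_time [set s | (V s <= 0)%R])%E -> 0 < V t.
Proof.
move=> t0 h; rewrite ltNge; apply/negP => Vt.
by move: h; rewrite ltNge (@first_time_le _ [set s | V s <= 0] _ t0 Vt).
Qed.

Variables (b : R -> R) (M : R) (beta : R -> R) (S : R).
Hypothesis bM : forall x, `|b x| <= M.
Hypothesis cbeta : continuous beta.

(** Time is counted from 0 rather than T: until T the path rests at x, inside the band, so neither
    barrier can be hit before T. *)
Definition hit_zero T x : \bar R := first_time [set t | flow b beta T x t <= 0].
Definition hit_barrier T x : \bar R := first_time [set t | S - flow b beta T x t <= 0].
Definition next_up T x := before_time (hit_zero T x) (hit_barrier T x).
Definition next_down T x := before_time (hit_barrier T x) (hit_zero T x).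

Variables (T : \bar R) (x : R).
Hypothesis T0 : (0 <= T)%E.
Hypothesis x_gt0 : 0 < x.
Hypothesis x_lt : x < S.

Let y := flow b beta T x.
Let cy : continuous y. Proof. exact: (continuous_flow bM). Qed.
Let cSy : continuous (fun t => S - y t).
Proof. by move=> t; apply: cvgB; [exact: cvg_cst|exact: cy]. Qed.
Let y0 s : (s%:E <= T)%E -> y s = x.
Proof. exact: (flow_before bM). Qed.

Lemma hit_zero_value r : hit_zero T x = r%:E -> y r = 0.
Proof. by move=> /(first_time_zero cy); apply; rewrite y0. Qed.

Lemma hit_barrier_value r : hit_barrier T x = r%:E -> y r = S.
Proof.
move=> /(first_time_zero cSy); rewrite y0// subr_gt0 => /(_ x_lt)/eqP.
by rewrite subr_eq0 => /eqP.
Qed.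

Lemma next_time_gt : (T < +oo)%E -> (T < mine (next_up T x) (next_down T x))%E.
Proof.
move=> Ty.
have h0 : (T < hit_zero T x)%E by apply: first_time_gt => // s sT; rewrite -/y y0.
have hS : (T < hit_barrier T x)%E.
  by apply: first_time_gt => // s sT; rewrite -/y y0// subr_gt0.
by rewrite lt_min /next_up /next_down /before_time; apply/andP; split; case: ifP.
Qed.

Lemma before_next t : 0 <= t -> (t%:E < mine (next_up T x) (next_down T x))%E ->
  0 < y t < S.
Proof.
move=> t0 h; have [h0 hS] : (t%:E < hit_zero T x)%E /\ (t%:E < hit_barrier T x)%E.
  move: h; rewrite lt_min /next_up /next_down /before_time => /andP[].
  have [e|e|e] := ltgtP (hit_zero T x) (hit_barrier T x).
  - by move=> h _; split=> //; exact: lt_trans e.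
  - by move=> _ h; split=> //; exact: lt_trans e.
  (* Equal hitting times are both infinite, since a path cannot be at 0 and at S at once. *)
  rewrite -e; case E : (hit_zero T x) => [r| |]//.
    have := hit_zero_value E; rewrite E in e; rewrite (hit_barrier_value (esym e)).
    by move=> S0; have := lt_trans x_gt0 x_lt; rewrite S0 ltxx.
  by have := first_time_ge0 [set t | flow b beta T x t <= 0]; rewrite -/(hit_zero T x) E.
rewrite (first_time_pos t0 h0)/= -subr_gt0.
exact: (@first_time_pos (fun t => S - y t)).
Qed.

Lemma next_up_value r : next_up T x = r%:E -> y r = 0 /\ next_down T x = +oo%E.
Proof.
rewrite /next_up /next_down /before_time; case: ifP => // h /hit_zero_value ->; split=> //.
by rewrite ltNge (ltW h).
Qed.

Lemma next_down_value r : next_down T x = r%:E -> y r = S /\ next_up T x = +oo%E.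
Proof.
rewrite /next_up /next_down /before_time; case: ifP => // h /hit_barrier_value ->; split=> //.
by rewrite ltNge (ltW h).
Qed.

Lemma next_never : T = +oo%E -> next_up T x = +oo%E /\ next_down T x = +oo%E.
Proof.
move=> Ty; have yx t : y t = x by apply: y0; rewrite Ty leey.
have h0 : hit_zero T x = +oo%E.
  case E : (hit_zero T x) => [r| |]//.
    by have := hit_zero_value E; rewrite yx => e; move: x_gt0; rewrite e ltxx.
  by have := first_time_ge0 [set t | flow b beta T x t <= 0]; rewrite -/(hit_zero T x) E.
have hS : hit_barrier T x = +oo%E.
  case E : (hit_barrier T x) => [r| |]//.
    by have := hit_barrier_value E; rewrite yx => e; move: x_lt; rewrite e ltxx.
  by have := first_time_ge0 [set t | S - flow b beta T x t <= 0]; rewrite -/(hit_barrier T x) E.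
by rewrite /next_up /next_down /before_time h0 hS ltxx.
Qed.

End exit.

(** * Concatenation of stages between successive impulses *)

Section stages.
Context {R : realType}.
Implicit Types (s t r : R).
Local Notation mu := (@lebesgue_measure R).

Variables (b : R -> R) (M : R) (beta : R -> R) (q Q S x0 : R).
Hypothesis bM : forall x, `|b x| <= M.
Hypothesis cbeta : continuous beta.
Hypothesis q_gt0 : 0 < q.
Hypothesis q_lt_Q : q < Q.
Hypothesis Q_lt_S : Q < S.
Hypothesis x0_ge0 : 0 <= x0.

Definition restart_level : R := if x0 == 0 then q else if S <= x0 then Q else x0.

(* jump_times i = (u, d): the i-th impulse, whichever its direction, occurs at u
   if it is upward and at d if it is downward, the other entry being oo. Index 0
   stands for an impulse at time 0. *)
Fixpoint jump_times (i : nat) : \bar R * \bar R :=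
  match i with
  | 0%N => (if x0 == 0 then 0%E else +oo%E, if S <= x0 then 0%E else +oo%E)
  | j.+1 =>
    if j == 0%N then
      (next_up b beta S 0 restart_level, next_down b beta S 0 restart_level)
    else
      let p := jump_times j in
      (mine (next_up b beta S p.1 q) (next_up b beta S p.2 Q),
       mine (next_down b beta S p.1 q) (next_down b beta S p.2 Q))
  end.

Definition up_time i := (jump_times i).1.
Definition down_time i := (jump_times i).2.

Lemma up_timeSS i : up_time i.+2 =
  mine (next_up b beta S (up_time i.+1) q) (next_up b beta S (down_time i.+1) Q).
Proof. by []. Qed.

Lemma down_timeSS i : down_time i.+2 =
  mine (next_down b beta S (up_time i.+1) q) (next_down b beta S (down_time i.+1) Q).
Proof. by []. Qed.

Definition stage_start i := if i is 0%N then 0%E else mine (up_time i) (down_time i).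
Definition stage_level i :=
  if i is 0%N then restart_level else if (up_time i < +oo)%E then q else Q.
Definition stage_path i := flow b beta (stage_start i) (stage_level i).

(** Impulses of index above i are ignored, and one at time 0 is absorbed in [restart_level]. Each
    approximation is a finite switch between flows, through which measurability passes to the
    inventory. *)
Fixpoint inventory_upto (i : nat) (t : R) : R :=
  if i is j.+1 then
    if (up_time i <= t%:E)%E then flow b beta (up_time i) q t
    else if (down_time i <= t%:E)%E then flow b beta (down_time i) Q t
    else inventory_upto j t
  else flow b beta 0 restart_level t.

Definition inventory t := limn (fun n => inventory_upto n t).

Local Notation u := up_time.
Local Notation d := down_time.
Local Notation T := stage_start.

Let S_gt0 : 0 < S. Proof. by rewrite (lt_trans q_gt0)// (lt_trans q_lt_Q). Qed.
Let Q_gt0 : 0 < Q. Proof. exact: lt_trans q_gt0 q_lt_Q. Qed.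
Let q_lt_S : q < S. Proof. exact: lt_trans q_lt_Q Q_lt_S. Qed.

Lemma stage_level_bounds i : 0 < stage_level i /\ stage_level i < S.
Proof.
case: i => [|i] /=; last by case: ifP.
rewrite /restart_level; case: eqP => [//|/eqP x00]; case: (leP S x0) => // x0S.
by rewrite lt_neqAle eq_sym x00 x0_ge0.
Qed.

Lemma next_up_ge0 (t : \bar R) x : (0 <= next_up b beta S t x)%E.
Proof. by rewrite /next_up /before_time; case: ifP => // _; exact: first_time_ge0. Qed.

Lemma next_down_ge0 (t : \bar R) x : (0 <= next_down b beta S t x)%E.
Proof. by rewrite /next_down /before_time; case: ifP => // _; exact: first_time_ge0. Qed.

Lemma up_time_ge0 i : (0 <= u i)%E.
Proof.
case: i => [|[|i]]; first by rewrite /up_time/=; case: ifP.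
  by rewrite /up_time/= next_up_ge0.
by rewrite up_timeSS le_min !next_up_ge0.
Qed.

Lemma down_time_ge0 i : (0 <= d i)%E.
Proof.
case: i => [|[|i]]; first by rewrite /down_time/=; case: ifP.
  by rewrite /down_time/= next_down_ge0.
by rewrite down_timeSS le_min !next_down_ge0.
Qed.

Lemma stage_start_ge0 i : (0 <= T i)%E.
Proof. by case: i => [|i] //=; rewrite le_min up_time_ge0 down_time_ge0. Qed.

Let never x : 0 < x -> x < S ->
  next_up b beta S +oo x = +oo%E /\ next_down b beta S +oo x = +oo%E.
Proof. by move=> x1 x2; exact: (next_never bM). Qed.

(** Reconciles two descriptions. The recursion on pairs starts flows only at the constants q and Q,
    as adaptedness requires. Pathwise, one start time and one level suffice: at most one entry of a
    pair is finite, and a flow started at oo never exits, so the minimum selects the last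
    impulse. *)
Let stages i : [/\ u i = +oo%E \/ d i = +oo%E,
  u i.+1 = next_up b beta S (T i) (stage_level i) &
  d i.+1 = next_down b beta S (T i) (stage_level i)].
Proof.
have [nq1 nq2] := never q_gt0 q_lt_S; have [nQ1 nQ2] := never Q_gt0 Q_lt_S.
have exclusive x (t : \bar R) : (0 <= t)%E -> 0 < x -> x < S ->
    next_up b beta S t x = +oo%E \/ next_down b beta S t x = +oo%E.
  move=> t0 x1 x2; case E : (next_up b beta S t x) => [r| |]; last 2 first.
  - by left.
  - by have := next_up_ge0 t x; rewrite E.
  by right; have [] := next_up_value bM cbeta t0 x1 E.
elim: i => [|i [_ iu id]].
  split=> //; rewrite /up_time /down_time /=.
  have [->|] := eqVneq x0 0; last by left.
  by right; rewrite leNgt S_gt0.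
have [x1 x2] := stage_level_bounds i.
have e : u i.+1 = +oo%E \/ d i.+1 = +oo%E.
  by rewrite iu id; apply: exclusive => //; exact: stage_start_ge0.
split=> //=.
- rewrite up_timeSS; case: ifPn => ui.
    by case: e ui => [->|-> _] //; rewrite nQ1 miney /= miney.
  have -> : u i.+1 = +oo%E by apply/eqP; rewrite -leye_eq leNgt.
  by rewrite nq1 !minye.
- rewrite down_timeSS; case: ifPn => ui.
    by case: e ui => [->|-> _] //; rewrite nQ2 miney /= miney.
  have -> : u i.+1 = +oo%E by apply/eqP; rewrite -leye_eq leNgt.
  by rewrite nq2 !minye.
Qed.

Lemma up_or_down i : u i = +oo%E \/ d i = +oo%E.
Proof. by case: (stages i). Qed.

Lemma up_timeS i : u i.+1 = next_up b beta S (T i) (stage_level i).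
Proof. by case: (stages i). Qed.

Lemma down_timeS i : d i.+1 = next_down b beta S (T i) (stage_level i).
Proof. by case: (stages i). Qed.

Lemma up_time_start i : u i = T i \/ u i = +oo%E.
Proof.
case: i => [|i]; first by rewrite /up_time/=; case: ifP; [left|right].
by case: (up_or_down i.+1) => e; [right|left; rewrite /= e miney].
Qed.

Lemma down_time_start i : d i = T i \/ d i = +oo%E.
Proof.
case: i => [|i]; first by rewrite /down_time/=; case: ifP; [left|right].
by case: (up_or_down i.+1) => e; [left; rewrite /= e minye|right].
Qed.

Lemma stage_start_lt i : (T i < +oo)%E -> (T i < T i.+1)%E.
Proof.
move=> Ty; rewrite /= up_timeS down_timeS; have [x1 x2] := stage_level_bounds i.
by apply: (next_time_gt bM cbeta) => //; exact: stage_start_ge0.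
Qed.

Lemma stage_start_le i : (T i <= T i.+1)%E.
Proof.
have [/stage_start_lt/ltW//|] := boolP (T i < +oo)%E.
rewrite -leNgt leye_eq => /eqP Ty.
have [x1 x2] := stage_level_bounds i; have [e1 e2] := never x1 x2.
by rewrite [X in (_ <= X)%E]/= up_timeS down_timeS Ty e1 e2.
Qed.

Lemma stage_path_bounds i t : 0 <= t -> (t%:E < T i.+1)%E -> 0 < stage_path i t < S.
Proof.
move=> t0 tT; have [x1 x2] := stage_level_bounds i.
apply: (before_next bM cbeta (stage_start_ge0 i) x1 x2 t0).
by rewrite -up_timeS -down_timeS.
Qed.

Lemma stage_path_up i r : u i.+1 = r%:E -> stage_path i r = 0.
Proof.
rewrite up_timeS => /(next_up_value bM cbeta (stage_start_ge0 i)).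
by have [x1 x2] := stage_level_bounds i; case/(_ x1).
Qed.

Lemma stage_path_down i r : d i.+1 = r%:E -> stage_path i r = S.
Proof.
rewrite down_timeS => /(next_down_value bM cbeta (stage_start_ge0 i)).
by have [x1 x2] := stage_level_bounds i; case/(_ x2).
Qed.

Lemma continuous_stage_path i : continuous (stage_path i).
Proof. by apply: (continuous_flow bM) => //; exact: stage_start_ge0. Qed.

Lemma stage_path_start i : (T i < +oo)%E -> stage_path i (fine (T i)) = stage_level i.
Proof.
move=> Ty; apply: (flow_before bM _ cbeta (stage_start_ge0 i)).
by rewrite fineK// ge0_fin_numE// stage_start_ge0.
Qed.

Lemma stage_end i r : T i.+1 = r%:E -> (u i.+1 = r%:E /\ d i.+1 = +oo%E) \/
  (u i.+1 = +oo%E /\ d i.+1 = r%:E).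
Proof.
by rewrite /=; case: (up_or_down i.+1) => ->; rewrite ?minye ?miney => ->; [right|left].
Qed.

Lemma stage_start_unbounded t : exists i, (t%:E < T i)%E.
Proof.
apply: contrapT => /forallNP h.
have hT i : (T i <= t%:E)%E by rewrite leNgt; apply/negP/h.
pose r i := fine (T i).
have rE i : T i = (r i)%:E.
  rewrite /r fineK// ge0_fin_numE ?stage_start_ge0//.
  exact: le_lt_trans (hT i) (ltry _).
have rS i : r i < r i.+1.
  by rewrite -lte_fin -!rE stage_start_lt// rE ltry.
have rt i : r i <= t by rewrite -lee_fin -rE.
have cr : r n @[n --> \oo] --> limn r.
  apply: nondecreasing_is_cvgn; first by apply/nondecreasing_seqP => n; exact/ltW.
  by exists t => _ [n _ <-].
have cr' : r n.+1 @[n --> \oo] --> limn r by rewrite (cvg_shiftS r).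
(* Bounds the displacement during stage i; if the start times converged, it would tend to 0 by
   continuity of beta. *)
pose D i := M * (r i.+1 - r i) + `|beta (r i.+1) - beta (r i)|.
have D0 : D i @[i --> \oo] --> 0.
  have -> : 0 = M * (limn r - limn r) + `|beta (limn r) - beta (limn r)|.
    by rewrite !subrr mulr0 normr0 addr0.
  apply: cvgD; first by apply: cvgM; [exact: cvg_cst|exact: cvgB].
  apply: cvg_norm; apply: cvgB.
    by apply: continuous_cvg => //; exact: cbeta.
  by apply: continuous_cvg => //; exact: cbeta.
(* From q or Q, a path ending at 0 or S moves at least this far. Stage 0 may start anywhere in the
   band, which is why stage n + 1 is used. *)
pose e := Num.min q (S - Q).
have e0 : 0 < e by rewrite lt_min q_gt0 subr_gt0.
have [n _ hn] : \forall i \near \oo, `|0 - D i| < e by move/cvgr_dist_lt : D0; apply.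
have := hn n.+1 (leqnSn n); rewrite sub0r normrN => /ltr_normlW; apply/negP; rewrite -leNgt.
have dist : e <= `|stage_path n.+1 (r n.+2) - stage_path n.+1 (r n.+1)|.
  rewrite stage_path_start ?rE ?ltry//= /e ge_min.
  case: (stage_end (rE n.+2)) => -[e1 e2].
    rewrite (stage_path_up e1) sub0r normrN.
    by case: ifP => _; rewrite gtr0_norm// ?lexx// (ltW q_lt_Q).
  rewrite (stage_path_down e2).
  by case: ifP => _; rewrite gtr0_norm ?subr_gt0// ?lexx ?orbT// lerD2l lerN2 (ltW q_lt_Q) orbT.
apply: le_trans dist _.
have := flow_lipschitz bM (stage_level n.+1) cbeta (stage_start_ge0 n.+1) (r n.+1) (r n.+2).
rewrite -/(stage_path n.+1) flow_forcing.unlock rE !clampE (min_l (ltW (rS n.+1))) (min_l (lexx _)).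
rewrite (gtr0_norm (_ : 0 < r n.+2 - r n.+1)) ?subr_gt0// => hl.
rewrite (_ : stage_path n.+1 (r n.+2) - stage_path n.+1 (r n.+1) =
  ((stage_path n.+1 (r n.+2) - (stage_level n.+1 + (beta (r n.+2) - beta (r n.+1)))) -
   (stage_path n.+1 (r n.+1) - (stage_level n.+1 + (beta (r n.+1) - beta (r n.+1)))))
  + (beta (r n.+2) - beta (r n.+1))); last by ring.
by apply: le_trans (ler_normD _ _) _; rewrite lerD2r.
Qed.

Lemma stage_interval t : 0 <= t -> exists i, (T i <= t%:E)%E /\ (t%:E < T i.+1)%E.
Proof. exact: (jump_interval (erefl : T 0 = 0%E) stage_start_unbounded). Qed.

(** Intervals open on the left and closed on the right suit left limits: at an impulse time the
    stage that is ending must be selected. *)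
Lemma left_stage_interval t : 0 < t -> exists i, (T i < t%:E)%E /\ (t%:E <= T i.+1)%E.
Proof.
move=> t0; have [j /ltW] := stage_start_unbounded t; elim: j => [|j ih].
  by rewrite /= lee_fin leNgt t0.
by move=> tTS; have [tT|Tt] := leP t%:E (T j); [exact: ih|exists j].
Qed.

Lemma stage_start_nd i j : (i <= j)%N -> (T i <= T j)%E.
Proof. exact: (jump_times_nd stage_start_le). Qed.

Lemma up_time_start_le i : (T i <= u i)%E.
Proof. by case: (up_time_start i) => ->; rewrite ?leey. Qed.

Lemma down_time_start_le i : (T i <= d i)%E.
Proof. by case: (down_time_start i) => ->; rewrite ?leey. Qed.

Lemma inventory_uptoE i n t : (i <= n)%N -> (T i <= t%:E)%E -> (t%:E < T i.+1)%E ->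
  inventory_upto n t = stage_path i t.
Proof.
move=> /subnK <- Tt tT; elim: (n - i)%N => [|k ih].
  rewrite add0n; case: i Tt tT => [//|i] Tt _.
  rewrite [LHS]/= /stage_path /=; case: (up_or_down i.+1) => e.
    by move: Tt; rewrite /= e minye => -> /=.
  by move: Tt; rewrite /= e miney => Tt; rewrite Tt (le_lt_trans Tt (ltry _)).
rewrite addSn [LHS]/=.
have tTk : (t%:E < T (k + i).+1)%E.
  by apply: lt_le_trans tT _; apply: stage_start_nd; rewrite ltnS leq_addl.
rewrite !ifF//; apply/negbTE; rewrite -ltNge.
  exact: lt_le_trans tTk (down_time_start_le _).
exact: lt_le_trans tTk (up_time_start_le _).
Qed.

Lemma inventory_upto_cvg t : inventory_upto n t @[n --> \oo] --> inventory t.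
Proof.
suff [l hl] : exists l, inventory_upto n t @[n --> \oo] --> (l : R).
  by rewrite /inventory (cvg_lim _ hl).
have [t0|t0] := leP 0 t.
  have [i [Tt tT]] := stage_interval t0; exists (stage_path i t).
  apply: cvg_near_cst; exists i => // n /= ni; exact: inventory_uptoE.
exists (flow b beta 0 restart_level t); apply: cvg_near_cst; apply: nearW.
elim=> [//|n /= ->].
have h i : (t%:E < T i)%E by rewrite (@lt_le_trans _ _ 0%E) ?lte_fin// stage_start_ge0.
rewrite !ifF//; apply/negbTE; rewrite -ltNge.
  exact: lt_le_trans (h n.+1) (down_time_start_le _).
exact: lt_le_trans (h n.+1) (up_time_start_le _).
Qed.

Lemma inventoryE i t : (T i <= t%:E)%E -> (t%:E < T i.+1)%E -> inventory t = stage_path i t.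
Proof.
move=> Tt tT; apply/cvg_lim => //; apply: cvg_near_cst; exists i => // n /= ni.
exact: inventory_uptoE.
Qed.

Lemma inventory_gt0 t : 0 <= t -> 0 < inventory t.
Proof.
move=> t0; have [i [Tt tT]] := stage_interval t0; rewrite (inventoryE Tt tT).
by have /andP[] := stage_path_bounds t0 tT.
Qed.

Lemma inventory_left i t : 0 < t -> (T i < t%:E)%E -> (t%:E <= T i.+1)%E ->
  inventory s @[s --> t^'-] --> stage_path i t.
Proof.
move=> t0 Tt tT; apply: (@cvg_trans _ (stage_path i s @[s --> t^'-])); last first.
  by apply: cvg_at_left_filter; exact: continuous_stage_path.
have [r Er] : exists r, T i = r%:E.
  by case: (T i) (stage_start_ge0 i) Tt => [r| |]// _ _; exists r.
apply: near_eq_cvg; near=> s.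
have st : s < t by near: s; exact: nbhs_left_lt.
rewrite (@inventoryE i)//; last by rewrite (lt_le_trans _ tT)// lte_fin.
rewrite Er lee_fin; apply/ltW; near: s; apply: nbhs_left_gt.
by move: Tt; rewrite Er lte_fin.
Unshelve. all: by end_near. Qed.

Definition left_inventory t := if t == 0 then x0 else lim (inventory s @[s --> t^'-]).

Lemma left_inventoryE i t : 0 < t -> (T i < t%:E)%E -> (t%:E <= T i.+1)%E ->
  left_inventory t = stage_path i t.
Proof.
move=> t0 Tt tT; rewrite /left_inventory gt_eqF//; apply/cvg_lim => //.
exact: inventory_left.
Qed.

Let time_index i j t : (T i < t%:E)%E -> (t%:E <= T i.+1)%E -> T j = t%:E ->
  j = i.+1.
Proof.
move=> Tt tT e; apply/eqP; rewrite eqn_leq; apply/andP; split.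
  rewrite leqNgt; apply/negP => ij.
  have Ty : (T i.+1 < +oo)%E by rewrite (le_lt_trans (stage_start_nd (ltnW ij)))// e ltry.
  have := lt_le_trans (stage_start_lt Ty) (stage_start_nd ij).
  by rewrite e ltNge tT.
by rewrite ltnNge; apply/negP => /stage_start_nd; rewrite e leNgt Tt.
Qed.

Let pos_time_case i t : 0 < t -> (T i < t%:E)%E -> (t%:E <= T i.+1)%E ->
  [\/ u i.+1 = t%:E /\ d i.+1 = +oo%E /\ stage_path i t = 0,
      u i.+1 = +oo%E /\ d i.+1 = t%:E /\ stage_path i t = S |
      (t%:E < T i.+1)%E /\ 0 < stage_path i t < S].
Proof.
move=> t0 Tt; rewrite le_eqVlt => /orP[/eqP e|tT]; last first.
  by apply: Or33; split=> //; apply: stage_path_bounds => //; exact: ltW.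
case: (stage_end (esym e)) => -[e1 e2]; [apply: Or31|apply: Or32]; do 2!split=> //.
  exact: stage_path_up.
exact: stage_path_down.
Qed.

(** Identifies the times built stage by stage with those prescribed by the policy through the left
    limit; at time 0 the left value is x0. *)
Lemma up_timesP t : 0 <= t -> jump_set u t <-> left_inventory t = 0.
Proof.
rewrite le_eqVlt => /orP[/eqP <-|t0].
  rewrite /left_inventory eqxx; split=> [[[|i]]|e].
  - by rewrite /up_time /=; case: eqP.
  - move=> e; have := up_time_start_le i.+1; rewrite e leNgt => /negP[].
    have T1 : (0 < T 1)%E := stage_start_lt (ltry 0 : (T 0 < +oo)%E).
    by apply: lt_le_trans T1 _; exact: stage_start_nd.
  - by exists 0%N; rewrite /up_time /= e eqxx.
have [i [Tt tT]] := left_stage_interval t0.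
rewrite (left_inventoryE t0 Tt tT); split=> [[j uj]|e].
  have := up_time_start j; rewrite uj => -[/esym Tj|//].
  have ji := time_index Tt tT Tj; rewrite ji in uj; exact: stage_path_up.
case: (pos_time_case t0 Tt tT) => [[h _]|[_ [_ h]]|[_ /andP[h _]]].
- by exists i.+1.
- by move: S_gt0; rewrite -h e ltxx.
- by move: h; rewrite e ltxx.
Qed.

Lemma down_timesP t : 0 <= t -> jump_set d t <-> S <= left_inventory t.
Proof.
rewrite le_eqVlt => /orP[/eqP <-|t0].
  rewrite /left_inventory eqxx; split=> [[[|i]]|x0S].
  - by rewrite /down_time /=; case: ifP.
  - move=> e; have := down_time_start_le i.+1; rewrite e leNgt => /negP[].
    have T1 : (0 < T 1)%E := stage_start_lt (ltry 0 : (T 0 < +oo)%E).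
    by apply: lt_le_trans T1 _; exact: stage_start_nd.
  - by exists 0%N; rewrite /down_time /= x0S.
have [i [Tt tT]] := left_stage_interval t0.
rewrite (left_inventoryE t0 Tt tT); split=> [[j dj]|e].
  have := down_time_start j; rewrite dj => -[/esym Tj|//].
  by have ji := time_index Tt tT Tj; rewrite ji in dj; rewrite (stage_path_down dj).
case: (pos_time_case t0 Tt tT) => [[_ [_ h]]|[_ [h _]]|[_ /andP[_ h]]].
- by move: S_gt0; rewrite ltNge -h e.
- by exists i.+1.
- by move: h; rewrite ltNge e.
Qed.

(** The left value can exceed S only at time 0. Afterwards the conditions [S <= Xl t] and [Xl t = S]
    of the policy coincide. *)
Lemma left_inventory_le t : 0 < t -> left_inventory t <= S.
Proof.
move=> t0; have [i [Tt tT]] := left_stage_interval t0.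
rewrite (left_inventoryE t0 Tt tT).
case: (pos_time_case t0 Tt tT) => [[_ [_ ->]]|[_ [_ ->]]|[_ /andP[_ /ltW]]]//.
exact: ltW.
Qed.

Lemma measurable_inventory : measurable_fun setT inventory.
Proof.
have mflow (t : \bar R) x : (0 <= t)%E -> measurable_fun setT (flow b beta t x).
  by move=> t0; apply: continuous_measurable_fun; exact: (continuous_flow bM).
apply: (@measurable_fun_cvg _ _ R setT inventory_upto); last first.
  by move=> t _; exact: inventory_upto_cvg.
have mle (t : \bar R) : measurable_fun setT (fun s : R => (t <= s%:E)%E).
  apply: (measurable_fun_bool true); rewrite setTI.
  case: t => [r| |].
  - rewrite (_ : _ @^-1` _ = `[r, +oo[%classic)//.
    by apply/seteqP; split=> s /=; rewrite in_itv/= andbT lee_fin.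
  - by rewrite (_ : _ @^-1` _ = set0)//; apply/seteqP; split.
  - by rewrite (_ : _ @^-1` _ = setT)//; apply/seteqP; split=> s //= _; rewrite leNye.
elim=> [|n ih]; first by apply: mflow.
apply: measurable_fun_ifT => //; first by apply: mflow; exact: up_time_ge0.
apply: measurable_fun_ifT => //; apply: mflow; exact: down_time_ge0.
Qed.

Definition down_size n : R := if n == 1%N then Num.max S x0 - Q else S - Q.

Section balance.
Hypothesis mb : measurable_fun setT b.
Hypothesis regular : forall r x, 0 <= r -> exists2 Z, mu.-negligible Z &
  forall s, r <= s -> ~ Z s -> {for flow b beta r%:E x s, continuous b}.

Let mbX : measurable_fun setT (b \o inventory).
Proof. by apply: measurableT_comp => //; exact: measurable_inventory. Qed.

Lemma integrable_inventory_drift s t :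
  mu.-integrable `[s, t] (fun r => (b (inventory r))%:E).
Proof.
apply: (@measurable_bounded_integrable _ _ _ mu (b \o inventory) `[s, t]%classic) => //.
- have := @lebesgue_measure_itv R `[s, t]; rewrite /= => ->.
  by case: ifP => _; rewrite ?ltry// -EFinB ltry.
- exact: measurable_funTS.
- exists M; split; first exact: num_real.
  by move=> x /ltW Mx r _; exact: le_trans (bM _) Mx.
Qed.

Let stage_integral i r t : T i = r%:E -> r <= t -> (t%:E <= T i.+1)%E ->
  stage_path i t =
  stage_level i + (beta t - beta r) + \int[mu]_(s in `[r, t]) b (inventory s).
Proof.
move=> Tr rt tT.
have r0 : 0 <= r by rewrite -lee_fin -Tr stage_start_ge0.
have [Z Z0 hZ] := regular (stage_level i) r0.
rewrite /stage_path Tr.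
have Tr0 : (0 <= r%:E)%E by rewrite lee_fin.
have [intb ->] := flow_integral bM (x := stage_level i) cbeta Tr0 (erefl _) rt mb Z0
  (fun s rs _ Zs => hZ s rs Zs).
congr (_ + _).
have co_cc : (`[r, t[%classic : set R) `<=` `[r, t]%classic.
  by move=> s /=; rewrite !in_itv/= => /andP[-> /ltW].
(* At t = T (i + 1) the inventory has already jumped, so the two integrands are compared on the
   half-open interval. *)
rewrite -!Rintegral_itv_bndo_bndc; last 2 first.
- by apply: integrableS (integrable_inventory_drift r t).
- by apply: integrableS intb.
apply: eq_Rintegral => s; rewrite inE/= in_itv/= => /andP[rs st].
rewrite (@inventoryE i)// ?Tr ?lee_fin// ?/stage_path ?Tr//.
by rewrite (lt_le_trans _ tT)// lte_fin.
Qed.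

Let up_total n : R := \sum_(1 <= m < n.+1) q.
Let down_total n : R := \sum_(1 <= m < n.+1) down_size m.

(** The impulse ending stage i leads from 0 or S to the next restart level, and its size is what the
    running totals gain. *)
Let totalsS i : stage_level i.+1 - (if (u i.+1 < +oo)%E then 0 else S) =
  up_total (njumps u i.+2) - down_total (njumps d i.+2)
  - (up_total (njumps u i.+1) - down_total (njumps d i.+1)) \/ (T i.+1 = +oo%E).
Proof.
have njS (v : nat -> \bar R) j : njumps v j.+1 = (njumps v j + (v j < +oo)%E)%N.
  by rewrite /njumps big_ord_recr.
rewrite /up_total /down_total (njS u i.+1) (njS d i.+1) /=.
case E : (mine (u i.+1) (d i.+1)) => [r| |]; last 2 first.
- by right.
- by have := stage_start_ge0 i.+1; rewrite /= E.
left; case: (stage_end E) => -[-> ->]; rewrite ltry ltxx addn0 addn1.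
  by rewrite (big_nat_recr _.+1)//=; ring.
rewrite (big_nat_recr (njumps d i.+1).+1)//= /down_size eqSS.
(* If this downward impulse is the first one, there was none at time 0, so x0 < S and its size max S
   x0 - Q equals S - Q. *)
case: eqP => [n0|_]; last by ring.
have d0 : (d 0 < +oo)%E = false.
  apply/negbTE/negP => h; move: n0; rewrite /njumps big_ord_recl.
  by rewrite [X in (X + _)%N](_ : _ = 1%N)//= h.
suff -> : Num.max S x0 = S by ring.
apply/max_l; move: d0; rewrite /down_time/=; case: (leP S x0) => [_|/ltW//].
by rewrite ltry.
Qed.

(** Stated up to and including T (i + 1), where [stage_path i] still has its value before the
    impulse; the induction step adds that impulse. *)
Lemma stage_balance i t : (T i <= t%:E)%E -> (t%:E <= T i.+1)%E ->
  stage_path i t = x0 + \int[mu]_(s in `[0, t]) b (inventory s) + (beta t - beta 0)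
    + up_total (njumps u i.+1) - down_total (njumps d i.+1).
Proof.
elim: i t => [|i ih] t Tt tT.
  rewrite (stage_integral (r := 0) _ _ tT)//.
  suff -> : stage_level 0 = x0 + up_total (njumps u 1) - down_total (njumps d 1) by ring.
  rewrite /up_total /down_total /njumps !big_ord1 /up_time /down_time /= /restart_level.
  have [->|x00] := eqVneq x0 0.
    by rewrite (lt_geF S_gt0) ltry ltxx /= big_nat1 big_geq//; ring.
  case: (leP S x0) => [Sx0|_]; rewrite ltxx ?ltry /=.
    by rewrite big_nat1 big_geq// /down_size eqxx max_r//; ring.
  by rewrite !big_geq//; ring.
have [r Tr] : exists r, T i.+1 = r%:E.
  by case: (T i.+1) (stage_start_ge0 i.+1) Tt => [r| |]// _ _; exists r.
have rt : r <= t by rewrite -lee_fin -Tr.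
have r0 : 0 <= r by rewrite -lee_fin -Tr stage_start_ge0.
have Tir : (T i <= r%:E)%E by rewrite -Tr stage_start_le.
have rTi : (r%:E <= T i.+1)%E by rewrite Tr.
have := ih r Tir rTi.
rewrite (stage_integral Tr rt tT) (Rintegral_itv_add r0 rt (integrable_inventory_drift 0 t)).
case: (totalsS i) => [|e]; last by rewrite e in Tr.
have -> : (if (u i.+1 < +oo)%E then 0 else S) = stage_path i r.
  case: (stage_end Tr) => -[e1 e2].
    by rewrite e1 ltry (stage_path_up e1).
  by rewrite e1 ltxx (stage_path_down e2).
lra.
Qed.

End balance.

End stages.

(** * The closed loop *)

Section monotone_discontinuities.
Context {R : realType}.
Implicit Types (f : R -> R).

(** A rational strictly inside the jump at x separates the values of f left of x from those right of
    x; such rationals differ at different jumps. *)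
Lemma nondecreasing_discontinuities_countable f : {homo f : x y / x <= y} ->
  countable [set x | ~ {for x, continuous f}].
Proof.
move=> f_nd; set D := [set x | _].
have hD x : exists p : rat, D x -> (forall y, y < x -> f y < ratr p) /\
    (forall y, x < y -> ratr p < f y).
  have [Dx|] := EM (D x); last by exists 0%R.
  have [e e0 he] : exists2 e : R, 0 < e & forall r : R, 0 < r ->
      exists2 y, `|x - y| < r & e <= `|f x - f y|.
    apply: contrapT => h; apply: Dx; apply/cvgrPdist_lt => e e0.
    apply: contrapT => h'; apply: h; exists e => // r r0.
    apply: contrapT => h''; apply: h'; apply/nbhs_ballP; exists r => // y xy /=.
    by rewrite ltNge; apply/negP => fe; apply: h''; exists y.
  (* The jump is on the left of x, or else on the right: values closer than e to f x on both sides
     would trap f within e of f x near x. *)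
  have [hl|hl] := EM (forall y, y < x -> f y <= f x - e).
    have : f x - e < f x by lra.
    move=> /rat_in_itvoo[p]; rewrite in_itv/= => /andP[p1 p2].
    exists p => _; split=> y yx; first exact: le_lt_trans (hl y yx) p1.
    exact: lt_le_trans p2 (f_nd _ _ (ltW yx)).
  have : f x < f x + e by lra.
  move=> /rat_in_itvoo[p]; rewrite in_itv/= => /andP[p1 p2].
  exists p => _; split=> y yx; first exact: le_lt_trans (f_nd _ _ (ltW yx)) p1.
  apply: lt_le_trans p2 _; rewrite leNgt; apply/negP => fy.
  apply: hl => z zx; rewrite leNgt; apply/negP => fz.
  have r0 : 0 < Num.min (x - z) (y - x) by rewrite lt_min !subr_gt0 zx.
  have [v xv] := he _ r0; apply/negP; rewrite -ltNge.
  move: xv; rewrite lt_min => /andP[xv1 xv2].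
  have zv : f z <= f v by apply: f_nd; have := ler_norm (x - v); lra.
  have vy : f v <= f y.
    by apply: f_nd; have := ler_norm (v - x); rewrite distrC in xv2 *; lra.
  by rewrite ltr_norml; lra.
have [p hp] := choice hD.
have plt x y : D x -> D y -> x < y -> p x != p y.
  move=> /(hp x)[_ hx] /(hp y)[hy _] xy; apply/eqP => e.
  have := lt_trans (hx ((x + y) / 2) _) (hy ((x + y) / 2) _).
  by rewrite e ltxx => /(_ _ _)/negP; case; lra.
apply/countable_injP; exists (pickle \o p) => x y; rewrite !inE => Dx Dy.
move=> /(pcan_inj pickleK) e; have [xy|xy|//] := ltgtP x y.
  by have := plt _ _ Dx Dy xy; rewrite e eqxx.
by have := plt _ _ Dy Dx xy; rewrite e eqxx.
Qed.

(* With xs the turning point, b is the sum of the monotone functions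
   b (min x xs) and b (max x xs), up to a constant. *)
Lemma unimodal_regular (b : R -> R) (xs : R) :
  (forall x y, x <= y -> y <= xs -> b y <= b x) ->
  (forall x y, xs <= x -> x <= y -> b x <= b y) ->
  countable [set x | ~ {for x, continuous b}] /\ measurable_fun setT b.
Proof.
move=> b_ni b_nd.
pose b1 x := - b (Num.min x xs); pose b2 x := b (Num.max x xs).
have b1_nd : {homo b1 : x y / x <= y}.
  move=> x y xy; rewrite lerN2; apply: b_ni; last by rewrite ge_min lexx orbT.
  by rewrite le_min !ge_min xy lexx orbT.
have b2_nd : {homo b2 : x y / x <= y}.
  move=> x y xy; apply: b_nd; first by rewrite le_max lexx orbT.
  by rewrite ge_max !le_max xy lexx orbT.
have bE : b = (fun x => b2 x - b1 x - b xs).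
  apply/funext => x; rewrite /b1 /b2; have [xl|xl] := leP x xs; ring.
split; last first.
  rewrite bE; apply: measurable_funB => //; apply: measurable_funB.
    exact: nondecreasing_measurable.
  exact: nondecreasing_measurable.
apply: sub_countable (_ : countable ([set x | ~ {for x, continuous b1}] `|`
  [set x | ~ {for x, continuous b2}])).
  apply: subset_card_le => x /= bx; apply/not_andP => -[c1 c2]; apply: bx.
  rewrite bE; apply: cvgB; last exact: cvg_cst.
  exact: cvgB.
by rewrite -bigcup2E; apply: bigcup_countable => // -[|[|i]] _ //=;
  exact: nondecreasing_discontinuities_countable.
Qed.

End monotone_discontinuities.

Section first_time_ext.
Context {R : realType}.
Implicit Types (A : set R) (t : R).

Lemma eq_first_time A A' : (forall t, 0 <= t -> A t <-> A' t) ->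
  first_time A = first_time A'.
Proof.
move=> h; rewrite /first_time; congr (ereal_inf [set _ | _ in _]).
by apply/seteqP; split=> t /= [t0] /(h t t0).
Qed.

Lemma cumulative_impulseE (Omega : Type) (Y : impulses R Omega) t w N :
  (forall n, (0 < n)%N -> (imp_time Y n w <= t%:E)%E <-> (n <= N)%N) ->
  cumulative_impulse Y t w = (\sum_(1 <= n < N.+1) imp_size Y n w)%:E.
Proof.
move=> hN; rewrite /cumulative_impulse.
have cN n : (0 < n)%N -> ((n%:R)%:E <= impulse_count Y t w)%E = (n <= N)%N.
  move=> n0; apply/idP/idP => [h|nN]; last first.
    by apply: ereal_sup_ubound; exists n => //; split=> //; apply/hN.
  rewrite leqNgt; apply/negP => Nn.
  have : (impulse_count Y t w <= (n.-1%:R)%:E)%E.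
    apply: ge_ereal_sup => _ [m [m0 /(hN m m0) mN] <-].
    by rewrite lee_fin ler_nat -ltnS prednK// (leq_ltn_trans mN).
  by move=> /(le_trans h); rewrite lee_fin ler_nat leqNgt prednK// leqnn.
apply/cvg_lim => //; apply: cvg_near_cst; exists N.+1 => // n /= Nn.
rewrite (@big_cat_nat _ _ _ N.+1)//= [X in (_ + X)%E]big1_seq ?adde0.
  rewrite -sumEFin big_nat_cond [RHS]big_nat_cond; apply: eq_bigl => i.
  case: (boolP (1 <= i < N.+1)%N) => //= /andP[i0]; rewrite ltnS => iN.
  by rewrite cN.
move=> i /andP[]; rewrite mem_index_iota => + /andP[Ni _].
by rewrite cN ?(leq_trans _ Ni)// leqNgt Ni.
Qed.

End first_time_ext.

(** * The policy on a filtered space carrying a Brownian motion *)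

Section closed_loop.
Context {R : realType} {dd : measure_display} {Omega : measurableType dd}.
Variables (P : probability Omega R) (F : R -> set (set Omega)) (B : R -> Omega -> R).
Hypothesis hF : is_filtration F.
Hypothesis hB : is_brownian_motion P F B.
Variables (sigma : R) (U : set R) (b m : R -> R) (M q Q S x0 : R).
Hypothesis sigma_gt0 : 0 < sigma.
Hypothesis bM : forall x, `|b x| <= M.
Hypothesis bU : forall x, U (b x).
Hypothesis bm : forall x : R, 0 <= x -> b x = m x.
Hypothesis mb : measurable_fun setT b.
Hypothesis b_disc : countable [set x | ~ {for x, continuous b}].
Hypothesis q_gt0 : 0 < q.
Hypothesis q_lt_Q : q < Q.
Hypothesis Q_lt_S : Q < S.
Hypothesis x0_ge0 : 0 <= x0.
Local Notation mu := (@lebesgue_measure R).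
Implicit Types (t s : R) (w : Omega).

Let beta t w := sigma * B (Num.max t 0) w.
Let u i w := up_time b (beta ^~ w) q Q S x0 i.
Let d i w := down_time b (beta ^~ w) q Q S x0 i.
Let X t w := inventory b (beta ^~ w) q Q S x0 t.
Let T i w := stage_start b (beta ^~ w) q Q S x0 i.
Let up n w := jump_time (u ^~ w) n.
Let down n w := jump_time (d ^~ w) n.

Let phi : policy R Omega := {|
  drift := fun t w => b (X t w) ;
  upward := {| imp_time := up ; imp_size := fun _ _ => q |} ;
  downward := {| imp_time := down ; imp_size := fun n _ => down_size Q S x0 n |} |}.

Let cbeta w : continuous (beta ^~ w).
Proof.
move=> t; apply: cvgM; first exact: cvg_cst.
have cB := continuous_extend0 (@bm_continuous _ _ _ _ _ _ hB w); exact: cB.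
Qed.

Let abeta : adapted F beta.
Proof.
apply: (adapted_comp (Y := fun t w => B (Num.max t 0) w) (f := fun x => sigma * x)).
  exact: mulrl_measurable.
by move=> t t0; rewrite max_l//; exact: (bm_adapted hB).
Qed.

Let adapted_path tau x : is_stopping_time F tau ->
  adapted F (fun t w => flow b (beta ^~ w) (tau w) x t).
Proof. by move=> htau; apply: (adapted_flow hF bM _ cbeta abeta htau). Qed.

Let path_continuous tau x w : is_stopping_time F tau ->
  continuous (flow b (beta ^~ w) (tau w) x).
Proof. by case=> tau0 _; apply: (continuous_flow bM (@cbeta w)). Qed.

Let stopping_hit_zero tau x : is_stopping_time F tau ->
  is_stopping_time F (fun w => hit_zero b (beta ^~ w) (tau w) x).
Proof.
move=> htau; apply: (stopping_time_hitting hF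
  (V := fun t w => flow b (beta ^~ w) (tau w) x t)); first exact: adapted_path.
by move=> w; exact: path_continuous.
Qed.

Let stopping_hit_barrier tau x : is_stopping_time F tau ->
  is_stopping_time F (fun w => hit_barrier b (beta ^~ w) S (tau w) x).
Proof.
move=> htau; apply: (stopping_time_hitting hF
  (V := fun t w => S - flow b (beta ^~ w) (tau w) x t)).
  apply: (adapted_sub hF); [exact: (adapted_cst hF)|exact: adapted_path].
by move=> w t; apply: cvgB; [exact: cvg_cst|exact: path_continuous].
Qed.

Let stopping_up tau x : is_stopping_time F tau ->
  is_stopping_time F (fun w => next_up b (beta ^~ w) S (tau w) x).
Proof.
by move=> h; apply: (stopping_time_before_time hF);
  [exact: stopping_hit_zero|exact: stopping_hit_barrier].
Qed.

Let stopping_down tau x : is_stopping_time F tau ->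
  is_stopping_time F (fun w => next_down b (beta ^~ w) S (tau w) x).
Proof.
by move=> h; apply: (stopping_time_before_time hF);
  [exact: stopping_hit_barrier|exact: stopping_hit_zero].
Qed.

Let stopping_ud i : is_stopping_time F (u i) /\ is_stopping_time F (d i).
Proof.
have h0 : is_stopping_time F (fun=> 0%E) by exact: (stopping_time_cst hF).
elim: i => [|[|i] [hu hd]].
- by split; apply: (stopping_time_cst hF); case: ifP.
- by split; [exact: (stopping_up _ h0)|exact: (stopping_down _ h0)].
- by split; apply: (stopping_time_min hF); (exact: stopping_up || exact: stopping_down).
Qed.

Let adapted_X : adapted F X.
Proof.
apply: (adapted_lim hF (Y := fun n t w => inventory_upto b (beta ^~ w) q Q S x0 n t));
  last by move=> t w _; exact: (inventory_upto_cvg bM (@cbeta w) q_gt0 q_lt_Q Q_lt_S x0_ge0).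
elim=> [|n ih] /=.
  apply: (adapted_path (tau := fun=> 0%E)); exact: (stopping_time_cst hF).
have [hu hd] := stopping_ud n.+1.
apply: (adapted_switch hF (tau := u n.+1)
  (Y := fun t w => flow b (beta ^~ w) (u n.+1 w) q t)) => //; first exact: adapted_path.
apply: (adapted_switch hF (tau := d n.+1)
  (Y := fun t w => flow b (beta ^~ w) (d n.+1 w) Q t)) => //; exact: adapted_path.
Qed.

Let T_le w i : (T i w <= T i.+1 w)%E. Proof. exact: (stage_start_le bM (@cbeta w) q_gt0 q_lt_Q Q_lt_S x0_ge0). Qed.
Let T_lt w i : (T i w < +oo)%E -> (T i w < T i.+1 w)%E.
Proof. exact: (stage_start_lt bM (@cbeta w) q_gt0 q_lt_Q Q_lt_S x0_ge0). Qed.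
Let T_unbounded w t : exists i, (t%:E < T i w)%E.
Proof. exact: (stage_start_unbounded bM (@cbeta w) q_gt0 q_lt_Q Q_lt_S x0_ge0). Qed.
Let uT w i : u i w = T i w \/ u i w = +oo%E.
Proof. exact: (up_time_start bM (@cbeta w) q_gt0 q_lt_Q Q_lt_S x0_ge0). Qed.
Let dT w i : d i w = T i w \/ d i w = +oo%E.
Proof. exact: (down_time_start bM (@cbeta w) q_gt0 q_lt_Q Q_lt_S x0_ge0). Qed.

Let T0 w : T 0 w = 0%E. Proof. by []. Qed.

Let stopping_jump (v : nat -> Omega -> \bar R) n :
  (forall i, is_stopping_time F (v i)) -> (forall w i, v i w = T i w \/ v i w = +oo%E) ->
  (0 < n)%N -> is_stopping_time F (fun w => jump_time (v ^~ w) n).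
Proof.
move=> hv vT; elim: n => [//|[|n] ih] _.
  apply: (stopping_time_attained_inf hF hv) => w; last exact: jump_time_ge0.
  by move=> t; exact: (jump_time1_le (T0 w) (T_le w) (T_unbounded w) (vT w)).
apply: (stopping_time_attained_inf hF
  (tau := fun i w => after_time (jump_time (v ^~ w) n.+1) (v i w))).
- by move=> i; apply: (stopping_time_after_time hF); [exact: hv|exact: ih].
- by move=> w t; exact: (jump_timeS_le (T0 w) (T_le w) (T_unbounded w) (vT w)).
- by move=> w; exact: jump_time_ge0.
Qed.

Let predictable_cst tau (c : R) : measurable_wrt (sigma_minus F tau) (fun=> c).
Proof.
have [h0 hC _] := smallest_sigma_algebra (setT : set Omega) (F 0 `|`
  [set E | exists t (A : set Omega), [/\ 0 <= t, F t A & E = A `&` [set w | (t%:E < tau w)%E]]]).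
move=> C _; have [Cc|Cc] := EM (C c).
  rewrite (_ : _ @^-1` _ = setT `\` set0); first exact: hC.
  by rewrite setD0; apply/seteqP; split.
by rewrite (_ : _ @^-1` _ = set0)//; apply/seteqP; split.
Qed.

Let down_size_ge0 n : 0 <= down_size Q S x0 n.
Proof.
rewrite /down_size; case: ifP => _; rewrite subr_ge0 ?(ltW Q_lt_S)//.
by rewrite le_max (ltW Q_lt_S).
Qed.

Let up_admissible : are_admissible_impulses F (upward phi).
Proof.
split=> [n n0|n w n0|n w n0|n n0] /=.
- by apply: stopping_jump n0 => [i|w i]; [case: (stopping_ud i)|exact: uT].
- exact: jump_time_nd.
- exact: ltW.
- exact: predictable_cst.
Qed.

Let down_admissible : are_admissible_impulses F (downward phi).
Proof.
split=> [n n0|n w n0|n w n0|n n0] /=.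
- by apply: stopping_jump n0 => [i|w i]; [case: (stopping_ud i)|exact: dT].
- exact: jump_time_nd.
- exact: down_size_ge0.
- exact: predictable_cst.
Qed.

Let X_gt0 t w : 0 <= t -> 0 < X t w.
Proof. by move=> t0; exact: (inventory_gt0 bM (@cbeta w) q_gt0 q_lt_Q Q_lt_S x0_ge0). Qed.

(** Agreement at positive times is enough from the second jump on, because it comes strictly after a
    nonnegative time. At time 0 the two conditions on the downward side may differ. *)
Let jump_step (v : nat -> \bar R) (A : R -> Prop) n :
  (forall t, 0 < t -> jump_set v t <-> A t) -> (2 <= n)%N ->
  jump_time v n = first_time_after (jump_time v n.-1) [set t | A t].
Proof.
move=> h; case: n => [|[|n]]// _; rewrite jump_timeS//; apply: eq_first_time => t t0.
have pos : (jump_time v n.+1 < t%:E)%E -> 0 < t.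
  by move=> nt; rewrite -lte_fin (le_lt_trans _ nt)// jump_time_ge0.
by split=> -[nt vt]; split=> //; apply/h => //; exact: pos.
Qed.

Let follows : follows_band_policy P x0 q Q S m phi X.
Proof.
apply: aeW => w /=; have cw := @cbeta w.
split.
- by move=> t t0; rewrite bm// ltW// X_gt0.
- split; first by apply: eq_first_time => t t0; exact: (up_timesP bM (@cbeta w) q_gt0 q_lt_Q Q_lt_S x0_ge0).
  move=> n n2; apply: jump_step => // t /ltW t0; exact: (up_timesP bM (@cbeta w) q_gt0 q_lt_Q Q_lt_S x0_ge0).
- by [].
- split; first by apply: eq_first_time => t t0; exact: (down_timesP bM (@cbeta w) q_gt0 q_lt_Q Q_lt_S x0_ge0).
  move=> n n2; apply: jump_step => // t t0.
  have hP := down_timesP bM cw q_gt0 q_lt_Q Q_lt_S x0_ge0 (ltW t0).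
  split=> [/hP h|h].
    apply/eqP; rewrite eq_le; apply/andP; split=> //.
    exact: (left_inventory_le bM cw q_gt0 q_lt_Q Q_lt_S x0_ge0 t0).
  by apply/hP; move: h; rewrite /left_value /left_inventory => ->.
- split=> // n n2; rewrite /down_size; case: eqP n2 => // ->; by [].
Qed.

Let regular : {ae P, forall w r x, 0 <= r -> exists2 Z, mu.-negligible Z &
  forall s, r <= s -> ~ Z s -> {for flow b (beta ^~ w) r%:E x s, continuous b}}.
Proof.
apply: filterS (brownian_lipschitz_graph_null hF hB) => w hw r x r0.
have [e e_inj] := countable_injP _ b_disc.
have r0' : (0 <= r%:E)%E by rewrite lee_fin.
pose y := flow b (beta ^~ w) r%:E x; pose f := flow_forcing (beta ^~ w) r%:E x.
(* The value that B must take at time s for the path to be at a. It is Lipschitz in s with constant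
   M / sigma, and only countably many a matter. *)
pose g (a : R) s := (a - (y s - f s) - x + beta r w) / sigma.
pose Z := [set s | 0 <= s /\ exists2 a, ~ {for a, continuous b} & B s w = g a s].
exists Z; last first.
  move=> s rs Zs; apply: contrapT => cs; apply: Zs; split; first exact: le_trans rs.
  exists (y s) => //; rewrite /g /f flow_forcing.unlock clampE min_l// /beta.
  rewrite (max_l (le_trans r0 rs)); field; exact: lt0r_neq0.
have Zn (a : R) : mu.-negligible [set s | 0 <= s /\ B s w = g a s].
  apply: (hw (M / sigma)) => s t; rewrite /g -mulrBl normrM (gtr0_norm (_ : 0 < sigma^-1)) ?invr_gt0//.
  rewrite mulrAC ler_wpM2r ?invr_ge0 ?(ltW sigma_gt0)//.
  rewrite (_ : _ + _ - _ = (y t - f t) - (y s - f s)); last by ring.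
  by rewrite (distrC s t); exact: (flow_lipschitz bM x (@cbeta w) r0' s t).
have ZS : Z `<=` \bigcup_n [set s | 0 <= s /\
    exists2 a, ~ {for a, continuous b} /\ e a = n & B s w = g a s].
  by move=> s [s0 [a ha e1]]; exists (e a) => //; split=> //; exists a.
apply: (@negligibleS _ _ _ mu _ _ ZS); apply: negligible_bigcup => n.
have [[a [ha en]]|h] := EM (exists a, ~ {for a, continuous b} /\ e a = n).
  apply: negligibleS (Zn a) => s [s0 [a' [ha' en'] h]]; split=> //.
  by rewrite h (e_inj a a') ?inE// en en'.
by apply: negligibleS (Zn 0) => s [_ [a ha _]]; case: h; exists a.
Qed.

Let inventory_balance : is_controlled_inventory P B sigma x0 phi X.
Proof.
apply: filterS regular => w hw t t0 /=; have cw := @cbeta w.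
split; first exact: (integrable_inventory_drift bM (@cbeta w) q_gt0 q_lt_Q Q_lt_S x0_ge0).
have [i [Tt tT]] : exists i, (T i w <= t%:E)%E /\ (t%:E < T i.+1 w)%E.
  exact: (stage_interval bM (@cbeta w) q_gt0 q_lt_Q Q_lt_S x0_ge0).
rewrite (cumulative_impulseE (N := njumps (u ^~ w) i.+1)); last first.
  by move=> n n0; exact: (jump_time_le_count (T0 w) (T_le w) (@T_lt w) (T_unbounded w) (uT w)).
rewrite (cumulative_impulseE (N := njumps (d ^~ w) i.+1)); last first.
  by move=> n n0; exact: (jump_time_le_count (T0 w) (T_le w) (@T_lt w) (T_unbounded w) (dT w)).
rewrite -EFinD; apply: (@etrans _ _ (_ - _)%:E); last exact: EFinB; congr (_%:E).
rewrite /X (inventoryE bM cw q_gt0 q_lt_Q Q_lt_S x0_ge0 Tt tT).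
rewrite (stage_balance bM cw q_gt0 q_lt_Q Q_lt_S x0_ge0 mb hw Tt (ltW tT)).
by rewrite /beta max_l// maxxx (bm_start hB) mulr0 subr0.
Qed.

Lemma band_policy_closed_loop : band_policy_admissible P F B sigma x0 U q Q S m.
Proof.
exists phi, X; split; first exact: follows.
split.
- exact: inventory_balance.
- by move=> t w _; exact: bU.
- by apply: (adapted_comp (f := b)) => //; exact: adapted_X.
- exact: up_admissible.
- exact: down_admissible.
- by apply: aeW => w t t0; exact/ltW/X_gt0.
Qed.

End closed_loop.

(** * The optimal drift rate and its value *)

Section drift.
Context {R : realType}.
Variables (U : set R) (c : R -> R).
Hypothesis smallest_minimizer : forall w : R,
  exists m, is_minimum (argmin U (drift_objective c w)) m.
Implicit Types (v w x : R).

Let opt := optimal_drift U c.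

Lemma optimal_driftP w :
  U (opt w) /\ (forall v, U v -> opt w * w + c (opt w) <= v * w + c v).
Proof. by have [[]] := xgetPex 0 (smallest_minimizer w). Qed.

Lemma drift_valueE w : drift_value U c w = opt w * w + c (opt w).
Proof.
have [Uo ho] := optimal_driftP w.
have : is_minimum (drift_objective c w @` U) (drift_value U c w).
  apply: xgetPex; exists (opt w * w + c (opt w)); split; first by exists (opt w).
  by move=> _ [v Uv <-]; exact: ho.
case=> -[v Uv <-] hv; apply/eqP; rewrite eq_le ho// andbT.
by apply: hv; exists (opt w).
Qed.

(** The minimizer at y is a competitor at x, and its objective changes by [opt y * (x - y)]. *)
Lemma drift_value_lipschitz M : (forall v, U v -> `|v| <= M) ->
  forall x y, `|drift_value U c x - drift_value U c y| <= M * `|x - y|.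
Proof.
move=> UM; suff h x y : drift_value U c x - drift_value U c y <= M * `|x - y|.
  by move=> x y; rewrite ler_norml h andbT lerNl opprB distrC.
have [Ux hx] := optimal_driftP x; have [Uy hy] := optimal_driftP y.
rewrite !drift_valueE; apply: (@le_trans _ _ (opt y * (x - y))).
  by have := hx _ Uy; lra.
by rewrite (le_trans (ler_norm _))// normrM ler_wpM2r// UM.
Qed.

(** Adding the two optimality inequalities eliminates c and leaves (opt v - opt w) (w - v) >= 0. *)
Lemma optimal_drift_nonincreasing v w : v <= w -> opt w <= opt v.
Proof.
rewrite le_eqVlt => /predU1P[->//|vw].
have [Uv hv] := optimal_driftP v; have [Uw hw] := optimal_driftP w.
have := hv _ Uw; have := hw _ Uv => h1 h2.
by have : 0 <= (opt v - opt w) * (w - v) by [nra]; rewrite pmulr_lge0 ?subr_gt0// subr_ge0.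
Qed.

End drift.

Theorem theorem2p1 (R : realType) (sigma K k L l : R)
    (sigma_gt0 : 0 < sigma) (K_gt0 : 0 < K) (k_gt0 : 0 < k)
    (L_gt0 : 0 < L) (l_gt0 : 0 < l)
    (U : set R) (U_nonempty : U !=set0) (U_compact : compact U)
    (c : R -> R) (c_measurable : measurable_fun U c)
    (smallest_minimizer : forall w : R,
       exists m, is_minimum (argmin U (drift_objective c w)) m)
    (h : R -> R)
    (h_increasing : forall x y : R, 0 <= x -> x < y -> h x < h y)
    (h_continuous : {within `[0, +oo[, continuous h})
    (h0 : h 0 = 0)
    (h_infty : h x @[x --> +oo] --> +oo) :
  exists (q Q S gamma : R) (w dw : R -> R),
    [/\ 0 < q /\ q < Q /\ Q < S,
        is_C1_within `[0, +oo[ w dw,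
        (forall x : R, 0 <= x -> x <= S ->
           sigma ^+ 2 / 2 * dw x + drift_value U c (w x) + h x = gamma)
        /\ \int[lebesgue_measure]_(x in `[0, q]) (w x + k) = - K
        /\ \int[lebesgue_measure]_(x in `[Q, S]) (w x - l) = L
        /\ w q = - k /\ w Q = l /\ w S = l
      & let mu x := optimal_drift U c (w x) in
        (forall (d : measure_display) (Omega : measurableType d)
           (P : probability Omega R) (F : R -> set (set Omega))
           (B : R -> Omega -> R) (x0 : R),
           is_filtration F -> is_brownian_motion P F B -> 0 <= x0 ->
           band_policy_admissible P F B sigma x0 U q Q S mu)
        /\ exists x_star : R, [/\ Q < x_star, x_star < S,
             forall x y : R, 0 <= x -> x <= y -> y <= x_star -> mu y <= mu x
           & forall x y : R, x_star <= x -> x <= y -> mu x <= mu y]].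
Proof.
have [M M_gt0 UM] : exists2 M : R, 0 < M & forall v, U v -> `|v| <= M.
  have [N [_ hN]] := compact_bounded U_compact.
  exists (Num.max N 0 + 1) => [|v Uv]; first by rewrite ltr_wpDl// le_max lexx orbT.
  by apply: hN => //; rewrite (@le_lt_trans _ _ (Num.max N 0))// ?le_max ?lexx// ltrDl.
pose H x := h (Num.max x 0); pose pi := drift_value U c; pose a := 2 / sigma ^+ 2.
have HE (x : R) : 0 <= x -> H x = h x by move=> x0; rewrite /H max_l.
have cH : continuous H by exact: continuous_extend0.
have H_incr (x y : R) : 0 <= x -> x < y -> H x < H y.
  by move=> x0 xy; rewrite !HE ?h_increasing// (le_trans x0)// ltW.
have H_unbounded C : exists2 x : R, 0 <= x & C < H x.
  have [x [x0 Cx]] : exists x, 0 <= x /\ C < h x.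
    apply: (@filter_ex _ (pinfty_nbhs R)); apply: filterI.
      exact: nbhs_pinfty_ge.
    exact: (cvgryPgt h).1 h_infty C.
  by exists x; rewrite // HE.
have a_gt0 : 0 < a by rewrite divr_gt0// exprn_gt0.
have piM := drift_value_lipschitz smallest_minimizer UM.
pose W := solution a pi H (- k).
have cW q g : continuous (W q g) by exact: (continuous_solution a_gt0 M_gt0 piM cH).
have Wode q g : solves_ode a pi H (W q g) g by exact: (solution_solves a_gt0 M_gt0 piM cH).
have Wq q g : W q g q = - k by exact: (solution_base a_gt0 M_gt0 piM cH).
have W_cvg := solution_cvg a_gt0 M_gt0 piM cH (- k).
(* For q <= 0 any constant will do; the implication makes the choice total. *)
have gam_ex (q : R) : exists g, 0 < q -> prim (fun x => W q g x + k) q = - K.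
  have [q0|q0] := ltP 0 q; last by exists 0.
  have [g hg] := area_solvable a_gt0 M_gt0 piM H_incr K_gt0 k_gt0 L_gt0 l_gt0 cW Wode Wq W_cvg q0.
  by exists g.
have [gam gamP] := choice gam_ex.
have [q [Q [S [xs [[q_gt0 qQ Qxs xsS] [wQ wS] wL w_incr w_decr]]]]] :=
  free_boundary_exists a_gt0 M_gt0 piM H_incr H_unbounded K_gt0 k_gt0 L_gt0 l_gt0 cW Wode Wq
    W_cvg gamP.
pose g := gam q; pose w := W q g; pose dw x := a * (g - pi (w x) - H x).
have cw : continuous w by exact: cW.
have dwP (x : R) : is_derive x 1 w (dw x) := Wode q g x.
have cpi : continuous pi by exact: lipschitz_continuous piM.
have cdw : continuous dw.
  move=> x; apply: cvgM; first exact: cvg_cst.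
  apply: cvgB; last exact: cH.
  apply: cvgB; first exact: cvg_cst.
  by apply: continuous_comp; [exact: cw|exact: cpi].
pose mu x := optimal_drift U c (w x).
have mu_decr (x y : R) : 0 <= x -> x <= y -> y <= xs -> mu y <= mu x.
  move=> x0 xy yxs; apply: optimal_drift_nonincreasing => //.
  by move: xy; rewrite le_eqVlt => /predU1P[->//|xy]; apply/ltW/w_incr.
have mu_incr (x y : R) : xs <= x -> x <= y -> mu x <= mu y.
  move=> xsx; rewrite le_eqVlt => /predU1P[->//|xy].
  by apply: optimal_drift_nonincreasing => //; apply/ltW/w_decr.
exists q, Q, S, g, w, dw; split.
- by split=> //; split=> //; exact: lt_trans xsS.
- split; last exact: continuous_subspaceT.
  (* Carathéodory's slope function is continuous at x and agrees with the difference quotient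
     elsewhere, which gives the limit within [0, oo[ as well. *)
  move=> x _; have /is_derive1_caratheodory[r [rE cr <-]] := dwP x.
  apply: (@cvg_trans _ (r y @[y --> x^'])).
    apply: (@cvg_trans _ ((w y - w x) / (y - x) @[y --> x^'])).
      by apply: cvg_app; exact: cvg_within.
    apply: near_eq_cvg; near=> y; rewrite rE mulfK// subr_eq0.
    by near: y; exact: nbhs_dnbhs_neq.
  by apply: cvg_trans cr; apply: cvg_app; exact: nbhs_dnbhs.
- split=> [x x0 _|].
    by rewrite /dw HE// /a -/pi; field; exact: lt0r_neq0.
  split; first rewrite (@prim_itv _ (fun x => w x + k)) ?ltW//.
  + by rewrite prim0 subr0 gamP.
  + by move=> x; apply: cvgD; [exact: cw|exact: cvg_cst].
  split; last by split; first exact: Wq.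
  rewrite (@prim_itv _ (fun x => w x - l))//.
  + by move=> x; apply: cvgB; [exact: cw|exact: cvg_cst].
  + by rewrite ltW// (lt_trans Qxs).
- split; last by exists xs.
  move=> d Omega P F B x0 hF hB x0_ge0.
  have xs0 : 0 <= xs by rewrite ltW// (lt_trans _ Qxs)// (lt_trans _ qQ).
  (* The constant extension to negative levels still decreases up to xs and increases afterwards; it
     agrees with mu wherever the inventory lives. *)
  pose b (x : R) := mu (Num.max x 0).
  have [disc mb] : countable [set x | ~ {for x, continuous b}] /\ measurable_fun setT b.
    have max_nd (x y : R) : x <= y -> Num.max x 0 <= Num.max y 0.
      by move=> xy; rewrite ge_max !le_max xy lexx orbT.
    apply: (@unimodal_regular _ _ xs) => x y.
      move=> xy yxs; apply: mu_decr; first by rewrite le_max lexx orbT.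
        exact: max_nd.
      by rewrite ge_max yxs.
    by move=> xsx xy; apply: mu_incr; [rewrite le_max xsx|exact: max_nd].
  apply: (band_policy_closed_loop hF hB (M := M) (b := b)) => //.
  + by move=> x; apply: UM; case: (optimal_driftP smallest_minimizer (w (Num.max x 0))).
  + by move=> x; case: (optimal_driftP smallest_minimizer (w (Num.max x 0))).
  + by move=> x x1; rewrite /b max_l.
  + exact: lt_trans xsS.
Unshelve. all: by end_near. Qed.
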